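(* Let $q\ge1$. Let $\widehat f_n^{(block)}$ be a block estimator with $V=[\mathbf 0,\mathbf 1]=[0,1]^d$. Assume $x_1,\ldots,x_n$ are i.i.d. random vectors in $[0,1]^d$ with a distribution $\mathbb P$ satisfying $\rho_1\mu^L_{u,v}\le\mathbb P\{x_i\in[u,v]\}\le\rho_2\mu^L_{u,v}$ for all $u\le v$, with fixed constants $0<\rho_1\le\rho_2<\infty$, where $\mu^L_{u,v}$ is the Lebesgue measure of $[u,v]$. Assume $f$ is non-decreasing and the $\varepsilon_i$ are independent with $\mathbb E\varepsilon_i=0$ and $\mathbb E|\varepsilon_i|^{q\vee2}\le\sigma^{q\vee2}$. Suppose $V$ has a disjoint partition into $K\le n$ hyper-rectangles $B_1,\ldots,B_K$ (each a product of intervals, which may or may not contain their end points, with lower corner $a_k$ and upper corner $b_k$) such that $f$ is constant on each $B_k$. Then $$R_q^*(\widehat f_n^{(block)},f)\lesssim_{q,d,\rho_1,\rho_2}\sigma^q(\Delta_{\mathbf 0,\mathbf 1}^q+1)\Big(\frac Kn\Big)^{\min\{1,q/2\}}\big(\log_+(n/K)\big)^{dI\{q=2\}+(d-1)I\{q>2\}},$$ where $\Delta_{\mathbf 0,\mathbf 1}=(f(\mathbf 1)-f(\mathbf 0))/\sigma$. In particular, when $q=2$, $$R_2^*(\widehat f_n^{(block)},f)\lesssim_{d,\rho_1,\rho_2}\sigma^2(\Delta_{\mathbf 0,\mathbf 1}^2+1)\frac Kn\log_+^d(n/K).$$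
   Context: We observe $(x_i,y_i)$ with $y_i=f(x_i)+\varepsilon_i$; given the design points the noise variables are independent with the stated moment conditions. Vectors in $[0,1]^d$ are ordered coordinatewise; $[u,v]=\{x:u\le x\le v\}$; $f:[0,1]^d\to\mathbb R$ is non-decreasing if $f(u)\le f(v)$ for $u\le v$. $n_{u,v}=\#\{i:x_i\in[u,v]\}$, $n_{u,*}=\#\{i:u\le x_i\}$, $n_{*,v}=\#\{i:x_i\le v\}$; $\overline y_{[u,v]}$ is the average of the $y_i$ with $x_i\in[u,v]$. $R_q^*(\widehat f_n,f)=\int_{[0,1]^d}\mathbb E|\widehat f_n(x)-f(x)|^qdx$. Max-min and min-max estimators: $$\widehat f_n^{(max-min)}(x)=\max_{u\le x,\,n_{u,*}>0}\ \min_{x\le v,\,n_{u,v}>0}\overline y_{[u,v]},\qquad\widehat f_n^{(min-max)}(x)=\min_{x\le v,\,n_{*,v}>0}\ \max_{u\le x,\,n_{u,v}>0}\overline y_{[u,v]}.$$ A block estimator is any estimator $\widehat f_n^{(block)}$ lying, for every $x\in V$, between the minimum and the maximum of these two. $a\vee b=\max(a,b)$, $\log_+x=1\vee\log x$, $\log_+^d(x)=(\log_+x)^d$, $I\{\cdot\}$ is an indicator. $A\lesssim_{\rm index}B$ means $A\le C_{\rm index}B$ with a constant depending only on the index. *)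

(* Defs.v *)
From HB Require Import structures.
From mathcomp Require Import all_boot all_order all_algebra.
From mathcomp Require Import all_classical all_reals all_analysis.

Set Implicit Arguments.
Unset Strict Implicit.
Unset Printing Implicit Defensive.

Import Order.TTheory GRing.Theory Num.Theory.
Import numFieldNormedType.Exports.

Local Open Scope classical_set_scope.
Local Open Scope ring_scope.

Section lebesgue_tuple.
Context {R : realType}.

Definition tuple_cons n (p : R * n.-tuple R) : n.+1.-tuple R :=
  [tuple of p.1 :: p.2].

Lemma measurable_tuple_cons n :
  measurable_fun [set: R * n.-tuple R] (@tuple_cons n).
Proof. exact: measurable_cons. Qed.

Definition lebesgue_cons n
    (m : {sigma_finite_measure set (n.-tuple R) -> \bar R}) :
    set (n.+1.-tuple R) -> \bar R :=
  pushforward ((@lebesgue_measure R) \x m)%E (@tuple_cons n).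

Section instances.
Context n (m : {sigma_finite_measure set (n.-tuple R) -> \bar R}).

Let m0 : lebesgue_cons m set0 = 0%E.
Proof. by rewrite /lebesgue_cons /pushforward preimage_set0 measure0. Qed.

Let m_ge0 A : (0 <= lebesgue_cons m A)%E.
Proof. by rewrite /lebesgue_cons /pushforward. Qed.

Let m_sigma_additive : semi_sigma_additive (lebesgue_cons m).
Proof.
move=> F mF tF mUF; rewrite /lebesgue_cons /pushforward preimage_bigcup.
apply: measure_semi_sigma_additive.
- by move=> i; rewrite -[X in measurable X]setTI;
    apply: measurable_tuple_cons.
- apply/trivIsetP => i j _ _ ij; rewrite -preimage_setI.
  by have /trivIsetP -> := tF; rewrite ?preimage_set0.
- by rewrite -preimage_bigcup -[X in measurable X]setTI;
    apply: measurable_tuple_cons.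
Qed.

HB.instance Definition _ := isMeasure.Build _ _ _ (lebesgue_cons m)
  m0 m_ge0 m_sigma_additive.

Let m_sigma_finite : sigma_finite setT (lebesgue_cons m).
Proof.
have /sigma_finiteP[F [TF ndF Foo]] := sigma_finiteT (@lebesgue_measure R).
have /sigma_finiteP[G [TG ndG Goo]] := sigma_finiteT m.
pose g (t : n.+1.-tuple R) : R * n.-tuple R := (thead t, [tuple of behead t]).
have gK p : g (tuple_cons p) = p.
  by case: p => a t; rewrite /g theadE; congr (_, _); exact/val_inj.
have mg : measurable_fun setT g.
  apply/measurable_fun_pair; first exact: measurable_tnth.
  exact: measurable_behead.
exists (fun i => g @^-1` (F i `*` G i)).
  apply/esym/seteqP; split => // t _.
  have [i _ Fi] : (\bigcup_i F i) (g t).1 by rewrite -TF.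
  have [j _ Gj] : (\bigcup_i G i) (g t).2 by rewrite -TG.
  exists (maxn i j) => //; split.
    by move: Fi; exact/subsetPset/ndF/leq_maxl.
  by move: Gj; exact/subsetPset/ndG/leq_maxr.
move=> i; have [mFi Fioo] := Foo i; have [mGi Gioo] := Goo i; split.
  by rewrite -[X in measurable X]setTI; apply: mg => //; exact: measurableX.
rewrite /lebesgue_cons /pushforward (_ : _ @^-1` _ = F i `*` G i).
  by rewrite product_measure1E// lte_mul_pinfty// ge0_fin_numE.
by apply/funext => p; rewrite /preimage /mkset gK.
Qed.

HB.instance Definition _ := Measure_isSigmaFinite.Build _ _ _
  (lebesgue_cons m) m_sigma_finite.

End instances.

(* Lebesgue measure on (the Borel sets of) R^d, as an iterated product. *)
Fixpoint lebesgue_tuple d : {sigma_finite_measure set (d.-tuple R) -> \bar R} :=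
  match d with
  | 0 => \d_[tuple]
  | n.+1 => lebesgue_cons (lebesgue_tuple n)
  end.

End lebesgue_tuple.

Section points.
Context {R : realType} {d : nat}.
Implicit Types u v x : d.-tuple R.

Definition lev u v : bool := [forall j, tnth u j <= tnth v j].

Definition box u v : set (d.-tuple R) := [set x | lev u x && lev x v].

Definition zerov : d.-tuple R := [tuple 0 | _ < d].
Definition onev : d.-tuple R := [tuple 1 | _ < d].
Definition unit_cube : set (d.-tuple R) := box zerov onev.

(* Each side of B may be open, closed or half-open, as l and r prescribe:
   BSide true c cuts just before c, BSide false c just after c. *)
Definition hyperrectangle (B : set (d.-tuple R)) : Prop :=
  exists (a b : d.-tuple R) (l r : 'I_d -> bool),
    B = [set x | forall j, tnth x j \in
          Interval (BSide (l j) (tnth a j)) (BSide (r j) (tnth b j))].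

Definition nondecreasing_on_cube (f : d.-tuple R -> R) : Prop :=
  forall u v, unit_cube u -> unit_cube v -> lev u v -> f u <= f v.

Definition piecewise_constant (K : nat) (f : d.-tuple R -> R) : Prop :=
  exists B : 'I_K -> set (d.-tuple R),
    [/\ partition [set: 'I_K] B unit_cube,
        forall k, hyperrectangle (B k) &
        forall k x y, B k x -> B k y -> f x = f y].

End points.

Lemma lebesgue_tuple_box (R : realType) (d : nat) (u v : d.-tuple R) :
  lev u v ->
  lebesgue_tuple d (box u v) = (\prod_(j < d) (tnth v j - tnth u j))%:E.
Proof.
elim: d u v => [|d IHd] u v /forallP uv.
  rewrite big_ord0 (_ : box u v = setT); last first.
    by apply/seteqP; split => // x _; apply/andP; split; apply/forallP => -[].
  by rewrite /= diracT.
rewrite big_ord_recl; case/tupleP: u uv => a u; case/tupleP: v => b v uv.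
have ab : a <= b by have := uv ord0; rewrite !tnth0.
have {}uv : lev u v.
  by apply/forallP => j; have := uv (lift ord0 j); rewrite !tnthS.
have levS s t (x y : d.-tuple R) :
    lev [tuple of s :: x] [tuple of t :: y] = (s <= t) && lev x y.
  apply/forallP/andP => [h|[st /forallP h] j].
    split; first by have := h ord0; rewrite !tnth0.
    by apply/forallP => j; have := h (lift ord0 j); rewrite !tnthS.
  by case: (unliftP ord0 j) => [k|] ->; rewrite ?tnthS ?tnth0.
have mbox : measurable (box u v).
  rewrite (_ : box u v = \bigcap_(j in [set: 'I_d])
      ((@tnth d R)^~ j @^-1` `[tnth u j, tnth v j])).
    apply: fin_bigcap_measurable => // j _.
    by rewrite -[X in measurable X]setTI; exact: measurable_tnth.
  apply/seteqP; split => x.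
    by move=> /andP[/forallP h1 /forallP h2] j _ /=; rewrite in_itv/= h1 h2.
  move=> h; apply/andP; split; apply/forallP => j;
    by have := h j I; rewrite /= in_itv/= => /andP[].
under eq_bigr do rewrite !tnthS.
rewrite !tnth0 /= /lebesgue_cons /pushforward (_ : _ @^-1` _ = `[a, b] `*` box u v).
  rewrite product_measure1E// [X in (_ * X)%E]IHd//.
  rewrite [X in (X * _)%E]lebesgue_measure_itv /=.
  rewrite lte_fin; case: ltP => [_|ba]; first by rewrite -EFinB -EFinM.
  by rewrite (_ : b = a) ?subrr ?mul0r ?mul0e//; apply/eqP; rewrite eq_le ba ab.
apply/seteqP; split => -[s x] /=; rewrite /box /tuple_cons /= !levS in_itv /=.
  by move=> /andP[/andP[-> ->] /andP[-> ->]].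
by move=> [/andP[-> ->] /andP[-> ->]].
Qed.

Section estimators.
Context {R : realType} {d n : nat}.
Variables (xs : 'I_n -> d.-tuple R) (ys : 'I_n -> R).
Implicit Types u v x : d.-tuple R.

Definition count_box u v : nat := #|[pred i | lev u (xs i) && lev (xs i) v]|.
Definition count_ge u : nat := #|[pred i | lev u (xs i)]|.
Definition count_le v : nat := #|[pred i | lev (xs i) v]|.

Definition ybar u v : R :=
  (\sum_(i | lev u (xs i) && lev (xs i) v) ys i) / (count_box u v)%:R.

(* ybar takes finitely many values, and for 0 < n, design points in the cube
   and x in the cube none of the sets below is empty (take u = 0, resp. v = 1):
   each sup is a maximum and each inf a minimum. *)
Definition max_min x : R :=
  sup [set inf [set ybar u v | v in
                 [set v | [/\ unit_cube v, lev x v & (0 < count_box u v)%N]]]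
      | u in [set u | [/\ unit_cube u, lev u x & (0 < count_ge u)%N]]].

Definition min_max x : R :=
  inf [set sup [set ybar u v | u in
                 [set u | [/\ unit_cube u, lev u x & (0 < count_box u v)%N]]]
      | v in [set v | [/\ unit_cube v, lev x v & (0 < count_le v)%N]]].

(* g is the realization, on the data (xs, ys), of a block estimator. *)
Definition block_estimate (V : set (d.-tuple R)) (g : d.-tuple R -> R) : Prop :=
  forall x, V x -> Num.min (max_min x) (min_max x) <= g x
                <= Num.max (max_min x) (min_max x).

End estimators.

Section probability_model.
Context {R : realType} {disp : measure_display} {Omega : measurableType disp}.
Context (P : probability Omega R) {d n : nat}.

Definition iid (X : 'I_n -> {RV P >-> d.-tuple R}) : Prop :=
  (forall i j (A : set (d.-tuple R)), measurable A ->
     distribution P (X i) A = distribution P (X j) A) /\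
  (forall A : 'I_n -> set (d.-tuple R), (forall i, measurable (A i)) ->
     P (\bigcap_(i in [set: 'I_n]) (X i @^-1` A i)) =
     (\prod_(i < n) P (X i @^-1` A i))%E).

Definition design_point_law_bounds (rho1 rho2 : R)
    (X : 'I_n -> {RV P >-> d.-tuple R}) : Prop :=
  forall i u v, unit_cube u -> unit_cube v -> lev u v ->
    (rho1%:E * lebesgue_tuple d (box u v) <= P (X i @^-1` box u v)
       <= rho2%:E * lebesgue_tuple d (box u v))%E.

Definition design (X : 'I_n -> {RV P >-> d.-tuple R}) (w : Omega) :
    n.-tuple (d.-tuple R) := [tuple X i w | i < n].

(* kappa i is the conditional distribution of the i-th noise variable given the
   whole design (on the real line a regular version always exists); the second
   clause says that the noise variables are conditionally independent. The
   conditional moments are only required for almost every design. *)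
Definition noise_given_design (q sigma : R)
    (X : 'I_n -> {RV P >-> d.-tuple R}) (eps : 'I_n -> {RV P >-> R}) : Prop :=
  exists kappa : 'I_n -> R.-pker (n.-tuple (d.-tuple R)) ~> R,
    [/\ forall (A : set (n.-tuple (d.-tuple R))) (B : 'I_n -> set R),
          measurable A -> (forall i, measurable (B i)) ->
          P ((design X @^-1` A) `&`
             \bigcap_(i in [set: 'I_n]) (eps i @^-1` B i)) =
          (\int[P]_(w in design X @^-1` A)
             \prod_(i < n) kappa i (design X w) (B i))%E,
        forall i, {ae P, forall w,
          (\int[kappa i (design X w)]_e e%:E = 0)%E} &
        forall i, {ae P, forall w,
          (\int[kappa i (design X w)]_e (`|e| `^ Num.max q 2)%:E
             <= (sigma `^ Num.max q 2)%:E)%E}].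

(* The integrand is nonnegative, so this is the supremum of the integrals of
   the simple functions below it, even without measurability in x. *)
Definition integrated_risk (q : R) (fhat : Omega -> d.-tuple R -> R)
    (f : d.-tuple R -> R) : \bar R :=
  (\int[lebesgue_tuple d]_(x in unit_cube)
     'E_P[fun w => (`|fhat w x - f x| `^ q)%R])%E.

End probability_model.

Definition logp {R : realType} (x : R) : R := Num.max 1 (ln x).

(* Main.v *)
Require Import Defs.
From HB Require Import structures.
From mathcomp Require Import all_boot all_order all_algebra.
From mathcomp Require Import all_classical all_reals all_analysis.
From mathcomp Require Import measurable_realfun.
From mathcomp Require Import ring lra.

(** Fix a point x in the interior of a piece with corners a and b, and let v be the
   corner halfway between x and b. Since f is constant between x and v and
   non-decreasing, a block estimator exceeds f x by at most the largest average of
   the noise over the boxes from u to v with u below x, as soon as some design point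
   lies between x and v ([block_error_le]). The probability of none decreases
   exponentially with the expected number s of such points; the corner 1 then
   replaces v, at the price of the oscillation of f, which is how Delta enters the
   bound. Reflecting the cube gives the other side of the error, with the corner u
   halfway between a and x ([pointwise_risk]).

   The heart of the matter is the moment of order p = max(q, 2) of that largest
   average ([noise_sup_moment]). These boxes are sorted into shells, in which
   every side is known up to a factor 2. In one shell the sums of the noise are sums
   over orthants cut out of a single outer box, and the multi-parameter maximal
   inequality ([orthant_max]) bounds their maximum by the sum over the whole outer
   box: each coordinate orders the points, so that the sums over its upper sets form
   a martingale, and Doob's inequality removes that coordinate at the cost of a
   constant. The sum over the outer box has a p-th moment of order N^(p/2) for N
   points, and Chernoff's bounds replace the random numbers of points by their means
   ([box_ratio_moment]). The shells contribute a convergent geometric series in each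
   coordinate, whence a p-th moment of order s^(-p/2). All this is done conditionally
   on the design: it depends on the design only through finitely many comparisons of
   coordinates, and on the corresponding event the noise is a family of martingale
   differences ([independent_noise]).

   It remains to integrate s^(-q/2) over x, where s is up to a constant n times the
   product of the distances of x to d faces of its piece. For q < 2 the power is
   integrable. For q >= 2 it is bounded by s^(-theta), where 1 - theta is the inverse
   of 2 log_+ (n / K), and every coordinate gives a factor 1 / (1 - theta), which is a
   logarithm; for q > 2 the decay of the rate at infinity makes the first coordinate
   free of logarithm ([integral_piece]). A piece of volume V thus costs
   n^(-theta) V^(1 - theta). The volumes of the K pieces have a bounded sum, so the
   sum of these costs is of order (K / n)^theta by concavity ([sum_powR_le]), and
   theta was chosen so that this is of order K / n for q >= 2
   ([powR_exponent_le]). *)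

Set Implicit Arguments.
Unset Strict Implicit.
Unset Printing Implicit Defensive.

Import Order.TTheory GRing.Theory Num.Theory.
Import numFieldNormedType.Exports.

Local Open Scope classical_set_scope.
Local Open Scope ring_scope.

(** * Integration without measurability, and mixtures of measures *)

Section integral_extra.
Context d (T : measurableType d) (R : realType).
Variable mu : {measure set T -> \bar R}.
Local Open Scope ereal_scope.

(** The integral of a nonnegative function, measurable or not, is the supremum of
   the integrals of the simple functions below it. This matters for the risk, whose
   integrand is an arbitrary function of the point. *)
Lemma ge0_le_integral_nomeas (D : set T) (f g : T -> \bar R) :
  (forall x, D x -> 0 <= f x) -> (forall x, D x -> f x <= g x) ->
  \int[mu]_(x in D) f x <= \int[mu]_(x in D) g x.
Proof.
move=> f0 fg; rewrite !ge0_integralE//; last first.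
  by move=> x Dx; apply: le_trans (fg _ Dx); exact: f0.
apply: le_ereal_sup => _ [h hf <-]; exists h => // x.
apply: le_trans (hf x) _; rewrite !patchE; case: ifPn => // /[!inE] Dx.
exact: fg.
Qed.

End integral_extra.

Section mixture.
Context d d' (S : measurableType d) (T : measurableType d') (R : realType).
Variables (mu : {measure set S -> \bar R}) (k : S -> {measure set T -> \bar R}).
Hypothesis mk : forall A, measurable A -> measurable_fun [set: S] (k ^~ A).
Local Open Scope ereal_scope.

Definition mixture of (forall A, measurable A ->
  measurable_fun [set: S] (k ^~ A)) := fun A => \int[mu]_x k x A.

Let mixture0 : mixture mk set0 = 0.
Proof. by rewrite /mixture integral0_eq// => x _; rewrite measure0. Qed.

Let mixture_ge0 A : 0 <= mixture mk A.
Proof. by apply: integral_ge0. Qed.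

Let mixture_sigma_additive : semi_sigma_additive (mixture mk).
Proof.
move=> F mF tF mUF; rewrite /mixture.
rewrite [X in _ --> X](_ : _ = \sum_(i <oo) \int[mu]_x k x (F i)); last first.
  rewrite -integral_nneseries//; last by move=> n; exact: mk.
  by apply: eq_integral => x _; rewrite measure_semi_bigcup.
by apply: is_cvg_nneseries => n _ _; apply: integral_ge0.
Qed.

HB.instance Definition _ := isMeasure.Build _ _ _ (mixture mk)
  mixture0 mixture_ge0 mixture_sigma_additive.

Import HBNNSimple.

Let nnsfun_kE x (g : {nnsfun T >-> R}) :
  \int[k x]_t (g t)%:E = \sum_(r \in range g) r%:E * k x (g @^-1` [set r]).
Proof. by rewrite integralT_nnsfun sintegralE. Qed.

Lemma measurable_integral_family (g : T -> \bar R) :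
  (forall t, 0 <= g t) -> measurable_fun setT g ->
  measurable_fun setT (fun x => \int[k x]_t g t).
Proof. by move=> g0 mg; exact: measurable_fun_integral_kernel. Qed.

(** By monotone approximation of g with simple functions. *)
Lemma integral_mixture (g : T -> \bar R) :
  (forall t, 0 <= g t) -> measurable_fun setT g ->
  \int[mixture mk]_t g t = \int[mu]_x \int[k x]_t g t.
Proof.
move=> g0 mg.
pose g_ := nnsfun_approx measurableT mg.
have gE_ge0 n x : 0 <= (g_ n x)%:E by rewrite lee_fin.
have mgE n : measurable_fun setT (EFin \o g_ n) by exact/measurable_EFinP.
have nd x : {homo (fun n => (g_ n x)%:E) : n m / (n <= m)%O >-> n <= m}.
  by move=> ? ? ?; rewrite lee_fin; exact/lefP/nd_nnsfun_approx.
have gE t : g t = limn (fun n => (g_ n t)%:E).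
  by apply/esym/cvg_lim => //; exact: cvg_nnsfun_approx.
transitivity (limn (fun n => \int[mixture mk]_x (g_ n x)%:E)).
  by rewrite -monotone_convergence//; apply: eq_integral => t _.
transitivity (limn (fun n => \int[mu]_x \int[k x]_t (g_ n t)%:E)).
  apply: congr_lim; apply/funext => n.
  rewrite integralT_nnsfun sintegralE.
  under [RHS]eq_integral do rewrite nnsfun_kE.
  rewrite ge0_integral_fsum//; last 2 first.
  - by move=> r; apply: measurable_funeM; exact: mk.
  - by move=> r x _; apply: (mulemu_ge0 (fun r => g_ n @^-1` [set r])) => ?;
      exact: preimage_nnfun0.
  apply: eq_fsbigr => r _; rewrite /= /mixture.
  have [r0|r0] := leP 0%R r; first by rewrite ge0_integralZl//; exact: mk.
  rewrite [RHS]integral0_eq; last by move=> x _; rewrite preimage_nnfun0// measure0 mule0.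
  by rewrite integral0_eq ?mule0// => x _; rewrite preimage_nnfun0// measure0.
rewrite -[LHS]monotone_convergence//; last 3 first.
- by move=> n; apply: measurable_integral_family => //; exact: mgE.
- by move=> n x _; exact: integral_ge0.
- move=> x _ m n mn; apply: ge0_le_integral => //; [exact: mgE|exact: mgE|].
  by move=> t _; exact: nd.
apply: eq_integral => x _; rewrite -monotone_convergence//.
- by apply: eq_integral => t _; rewrite gE.
Qed.

End mixture.

Section weighted_pushforward.
Context d d' (S : measurableType d) (T : measurableType d') (R : realType).
Variables (mu : {measure set S -> \bar R}) (Y : S -> T).
Hypothesis mY : measurable_fun setT Y.
Local Open Scope ereal_scope.

(** The mixture of these point masses is the image under Y of the measure with
   density a. *)
Definition scaled_dirac (a : S -> R) (x : S) : {measure set T -> \bar R} :=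
  mscale (`|a x|%:nng)%R (\d_(Y x)).

Lemma measurable_scaled_dirac (a : S -> R) : measurable_fun setT a ->
  forall A, measurable A -> measurable_fun [set: S] ((scaled_dirac a) ^~ A).
Proof.
move=> ma A mA; rewrite /scaled_dirac /= /mscale /=.
apply: emeasurable_funM => //.
  by apply/measurable_EFinP; exact: measurableT_comp.
apply/measurable_EFinP.
apply: measurableT_comp mY; exact: measurable_indic.
Qed.

Lemma integral_weighted_pushforward (a : S -> R) (ma : measurable_fun setT a)
    (g : T -> \bar R) : (forall x, (0 <= a x)%R) ->
  (forall t, 0 <= g t) -> measurable_fun setT g ->
  \int[mixture mu (measurable_scaled_dirac ma)]_t g t
   = \int[mu]_x ((a x)%:E * g (Y x)).
Proof.
move=> a0 g0 mg; rewrite integral_mixture//; apply: eq_integral => x _.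
rewrite /scaled_dirac ge0_integral_mscale//= integral_dirac// diracT mul1e.
by rewrite ger0_norm.
Qed.

Lemma mixture_scaled_diracE (a : S -> R) (ma : measurable_fun setT a) A :
  (forall x, (0 <= a x)%R) ->
  mixture mu (measurable_scaled_dirac ma) A = \int[mu]_(x in Y @^-1` A) (a x)%:E.
Proof.
move=> a0; rewrite /mixture [RHS]integral_mkcond; apply: eq_integral => x _.
rewrite /scaled_dirac /= /mscale /= diracE patchE ger0_norm//.
have -> : (x \in Y @^-1` A) = (Y x \in A) by apply/idP/idP => /[!inE].
by case: ifP; rewrite ?mule1 ?mule0.
Qed.

(** Weights with the same integral over every {Y in A}, A in a generating
   pi-system, cannot be told apart by functions of Y. *)
Lemma eq_integral_weights (G : set (set T)) (a b : S -> R)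
    (g : T -> \bar R) :
  measurable = <<s G >> -> setI_closed G -> G setT ->
  measurable_fun setT a -> measurable_fun setT b ->
  (forall x, (0 <= a x)%R) -> (forall x, (0 <= b x)%R) ->
  \int[mu]_x (a x)%:E < +oo ->
  (forall A, G A -> \int[mu]_(x in Y @^-1` A) (a x)%:E =
                    \int[mu]_(x in Y @^-1` A) (b x)%:E) ->
  (forall t, 0 <= g t) -> measurable_fun setT g ->
  \int[mu]_x ((a x)%:E * g (Y x)) = \int[mu]_x ((b x)%:E * g (Y x)).
Proof.
move=> mG IG GT ma mb a0 b0 afin ab g0 mg.
rewrite -(integral_weighted_pushforward ma)// -(integral_weighted_pushforward mb)//.
apply: eq_measure_integral => A mA _.
apply: (measure_unique G (fun=> setT)) => //.
- by rewrite bigcup_const//; exists 0%N.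
- by move=> B GB; rewrite /= !mixture_scaled_diracE//; exact: ab.
- by move=> _; rewrite /= mixture_scaled_diracE// preimage_setT.
Qed.

End weighted_pushforward.

(** * The noise, given the design *)

Section coordinates.
Context {R : realType} {n : nat}.
Implicit Types (e : n.-tuple R) (i : 'I_n).

Definition upd i (a : R) e : n.-tuple R :=
  [tuple if j == i then a else tnth e j | j < n].

Definition free_of (V : Type) i (h : n.-tuple R -> V) :=
  forall e a, h (upd i a e) = h e.

Lemma measurable_upd i a : measurable_fun setT (upd i a).
Proof.
apply/measurable_fun_tnthP => j /=.
have [->|ji] := eqVneq j i.
  by apply: (eq_measurable_fun (cst a)) => // e _; rewrite /= tnth_mktuple eqxx.
apply: (eq_measurable_fun (fun e => tnth e j)); last exact: measurable_tnth.
by move=> e _; rewrite /= tnth_mktuple (negbTE ji).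
Qed.

Definition rectangle (B : 'I_n -> set R) : set (n.-tuple R) :=
  [set e | forall i, B i (tnth e i)].

Lemma measurable_tuple_rectangles :
  @measurable _ (n.-tuple R) =
  <<s [set rectangle B | B in [set B | forall i, measurable (B i)]] >>.
Proof.
apply/seteqP; split.
  apply: smallest_sub; first exact: smallest_sigma_algebra.
  rewrite -(@bigcup_seq _ _ (index_enum 'I_n)) => _ [i _ [B mB <-]].
  apply: sub_sigma_algebra; rewrite setTI.
  exists (fun j => if j == i then B else setT).
    by move=> j; case: ifP.
  apply/seteqP; split => e /=; first by move=> /(_ i); rewrite eqxx.
  by move=> Be j; case: eqVneq => [->|].
apply: smallest_sub; first exact: sigma_algebra_measurable.
move=> _ [B mB <-].
rewrite (_ : rectangle B = \bigcap_(i in setT) ((fun e => tnth e i) @^-1` B i)).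
  apply: fin_bigcap_measurable => // i _.
  by rewrite -[X in measurable X]setTI; exact: measurable_tnth.
by apply/seteqP; split => e Be i //=; exact: Be.
Qed.

Lemma setI_closed_rectangles :
  setI_closed [set rectangle B | B in [set B | forall i, measurable (B i)]].
Proof.
move=> _ _ [B mB <-] [C mC <-]; exists (fun i => B i `&` C i).
  by move=> i; apply: measurableI.
apply/seteqP; split => e /=.
  by move=> BC; split=> i; have [] := BC i.
by move=> [Be Ce] i; split; [exact: Be|exact: Ce].
Qed.

(** The only trace of independence that martingale arguments use: a weight h that
   is free of coordinate i integrates against that coordinate as if it were
   centred with p-th moment at most s^p. The mean is split into its positive and
   negative parts so that both sides make sense without integrability. *)
Definition independent_noise (p s : R)
    (Q : {measure set (n.-tuple R) -> \bar R}) : Prop :=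
  [/\ (Q setT < +oo)%E,
   forall i (h : n.-tuple R -> R), measurable_fun setT h ->
     (forall e, 0 <= h e) -> free_of i h ->
     (\int[Q]_e (h e * `|tnth e i| `^ p)%:E
       <= (s `^ p)%:E * \int[Q]_e (h e)%:E)%E &
   forall i (h : n.-tuple R -> R), measurable_fun setT h ->
     (forall e, 0 <= h e) -> free_of i h ->
     (\int[Q]_e (h e * Num.max (tnth e i) 0)%:E =
      \int[Q]_e (h e * Num.max (- tnth e i) 0)%:E)%E].

End coordinates.

Section noise_law.
Context {R : realType} {disp : measure_display} {Omega : measurableType disp}.
Context (P : probability Omega R) {d n : nat}.
Variables (q sigma : R) (X : 'I_n -> {RV P >-> d.-tuple R})
  (eps : 'I_n -> {RV P >-> R}).

Definition noise (w : Omega) : n.-tuple R := [tuple eps i w | i < n].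

Lemma measurable_noise : measurable_fun setT noise.
Proof.
apply/measurable_fun_tnthP => i /=.
rewrite (_ : _ \o _ = eps i)//.
by apply/funext => w; rewrite /= tnth_mktuple.
Qed.

Lemma measurable_design : measurable_fun setT (design X).
Proof.
apply/measurable_fun_tnthP => i /=.
rewrite (_ : _ \o _ = X i)//.
by apply/funext => w; rewrite /= tnth_mktuple.
Qed.

Lemma measurable_indic_design A : measurable A ->
  measurable_fun setT (fun w => \1_A (design X w) : R).
Proof.
by move=> mA; apply: measurableT_comp measurable_design; exact: measurable_indic.
Qed.

(** Restricting to an event of the design instead of conditioning on its value
   keeps the measure finite and avoids regular conditional laws. *)
Definition noise_law A (mA : measurable A) : {measure set (n.-tuple R) -> \bar R} :=
  mixture P (measurable_scaled_dirac measurable_noise (measurable_indic_design mA)).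

Lemma integral_noise_law A (mA : measurable A) (g : n.-tuple R -> \bar R) :
  (forall e, 0 <= g e)%E -> measurable_fun setT g ->
  (\int[noise_law mA]_e g e = \int[P]_(w in design X @^-1` A) g (noise w))%E.
Proof.
move=> g0 mg; rewrite integral_weighted_pushforward//.
rewrite [RHS]integral_mkcond; apply: eq_integral => w _.
rewrite patchE indicE.
have -> : (w \in design X @^-1` A) = (design X w \in A) by apply/idP/idP => /[!inE].
by case: ifP => _; rewrite ?mul1e ?mul0e.
Qed.

Hypothesis Hnoise : noise_given_design q sigma X eps.

Let D := design X.

Let mpre A : measurable A -> measurable (D @^-1` A).
Proof. by move=> mA; rewrite -[X in measurable X]setTI; exact: measurable_design. Qed.

(** Conditional independence is given on product sets only. Three applications of
   the uniqueness of finite measures on a pi-system extend it to a function of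
   the design, of the other noise variables and of one noise variable. *)
Lemma noise_disintegration (kappa : 'I_n -> R.-pker (n.-tuple (d.-tuple R)) ~> R) :
  (forall (A : set (n.-tuple (d.-tuple R))) (B : 'I_n -> set R),
     measurable A -> (forall i, measurable (B i)) ->
     P ((D @^-1` A) `&` \bigcap_(i in [set: 'I_n]) (eps i @^-1` B i)) =
     (\int[P]_(w in D @^-1` A) \prod_(i < n) kappa i (D w) (B i))%E) ->
  forall i A (h : n.-tuple R -> R) (g : R -> \bar R), measurable A ->
  measurable_fun setT h -> (forall e, 0 <= h e) -> free_of i h ->
  (forall t, 0 <= g t)%E -> measurable_fun setT g ->
  (\int[P]_w ((\1_A (D w) * h (noise w))%:E * g (eps i w)) =
   \int[P]_w ((\1_A (D w) * h (noise w))%:E * \int[kappa i (D w)]_t g t))%E.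
Proof.
move=> kE i A h g mA mh h0 hi g0 mg.
have mkap j C : measurable C ->
    measurable_fun setT (fun w => fine (kappa j (D w) C)).
  move=> mC; apply: measurableT_comp => //.
  apply: (measurableT_comp (f := fun x => kappa j x C)); first exact: measurable_kernel.
  exact: measurable_design.
have k1 j x : kappa j x setT = 1%E by exact: prob_kernel.
have kfin j x C : measurable C -> kappa j x C = (fine (kappa j x C))%:E.
  move=> mC; rewrite fineK// ge0_fin_numE ?measure_ge0//.
  by apply: le_lt_trans (ltry 1); rewrite -(k1 j x) le_measure// inE.
have k0 j x C : 0 <= fine (kappa j x C) by apply: fine_ge0.
have mE (B : 'I_n -> set R) : (forall j, measurable (B j)) ->
    measurable (\bigcap_(j in [set: 'I_n]) (eps j @^-1` B j)).
  by move=> mB; apply: fin_bigcap_measurable => // j _; exact: measurable_funPTI.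
have mprod (B : 'I_n -> set R) : (forall j, measurable (B j)) ->
    measurable_fun setT (fun w => \prod_(j < n) fine (kappa j (D w) (B j))).
  by move=> mB; apply: measurable_prod => j _; exact: mkap.
have indE (B : 'I_n -> set R) A' : measurable A' -> (forall j, measurable (B j)) ->
    (\int[P]_(w in D @^-1` A')
       (\1_(\bigcap_(j in [set: 'I_n]) (eps j @^-1` B j)) w : R)%:E =
     \int[P]_(w in D @^-1` A') (\prod_(j < n) fine (kappa j (D w) (B j)))%:E)%E.
  move=> mA' mB; rewrite integral_indic//; [|exact: mpre|exact: mE].
  rewrite setIC; apply: (etrans (kE A' B mA' mB)); apply: eq_integral => w _.
  rewrite -prodEFin; apply: eq_bigr => j _; exact: kfin.
(* sets in the space of designs form the pi-system; the noise stays in a rectangle *)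
have step1 (B : 'I_n -> set R) (psi : n.-tuple (d.-tuple R) -> \bar R) :
    (forall j, measurable (B j)) ->
    (forall x, 0 <= psi x)%E -> measurable_fun setT psi ->
    (\int[P]_w ((\1_(\bigcap_(j in [set: 'I_n]) (eps j @^-1` B j)) w)%:E * psi (D w)) =
     \int[P]_w ((\prod_(j < n) fine (kappa j (D w) (B j)))%:E * psi (D w)))%E.
  move=> mB psi0 mpsi.
  apply: (@eq_integral_weights _ _ _ _ _ P D measurable_design measurable _ _ psi) => //.
  - apply/seteqP; split; first exact: sub_sigma_algebra.
    by apply: smallest_sub; first exact: sigma_algebra_measurable.
  - by move=> ? ? ? ?; exact: measurableI.
  - by apply: measurable_indic; exact: mE.
  - exact: mprod.
  - by move=> w; apply: prodr_ge0 => j _; exact: k0.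
  - rewrite integral_indic//; last exact: mE.
    by apply: le_lt_trans (ltry 1); apply: probability_le1; rewrite setIT; exact: mE.
  - by move=> A' mA'; exact: indE.
(* rectangles form the pi-system; coordinate i is frozen at 0, h being free of it *)
have step2 C : measurable C ->
    (\int[P]_w ((\1_A (D w) * \1_C (eps i w))%:E * (h (upd i 0 (noise w)))%:E) =
     \int[P]_w ((\1_A (D w) * fine (kappa i (D w) C))%:E
        * (h (upd i 0 (noise w)))%:E))%E.
  move=> mC.
  apply: (@eq_integral_weights _ _ _ _ _ P (fun w => upd i 0 (noise w)) _
    [set rectangle B | B in [set B | forall i, measurable (B i)]]
    (fun w => \1_A (D w) * \1_C (eps i w))
    (fun w => \1_A (D w) * fine (kappa i (D w) C))
    (fun e => (h e)%:E)) => //.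
  - by apply: measurableT_comp measurable_noise; exact: measurable_upd.
  - exact: measurable_tuple_rectangles.
  - exact: setI_closed_rectangles.
  - by exists (fun=> setT) => //; apply/seteqP; split.
  - apply: measurable_funM; first exact: measurable_indic_design.
    by apply: measurableT_comp => //; exact: measurable_indic.
  - by apply: measurable_funM; [exact: measurable_indic_design|exact: mkap].
  - apply: (@le_lt_trans _ _ (\int[P]_w (cst 1 w)%E)%E).
      apply: ge0_le_integral_nomeas => w _; rewrite ?lee_fin ?mulr_ge0//=.
    rewrite integral_cst// mul1e.
    exact: le_lt_trans (probability_le1 P measurableT) (ltry 1).
  - move=> _ [B mB <-].
    pose B1 j := if j == i then C else B j.
    pose B2 j := if j == i then setT else B j.
    have mB1 j : measurable (B1 j) by rewrite /B1; case: ifP.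
    have mB2 j : measurable (B2 j) by rewrite /B2; case: ifP.
    have [B0|B0] := pselect (B i 0); last first.
      rewrite (_ : _ @^-1` _ = set0) ?integral_set0//.
      apply/seteqP; split => // w /= /(_ i).
      by rewrite tnth_mktuple eqxx.
    have preE : (fun w => upd i 0 (noise w)) @^-1` rectangle B =
        \bigcap_(j in [set: 'I_n]) (eps j @^-1` B2 j).
      apply/seteqP; split => w /= Bw j; first move=> _.
        have := Bw j; rewrite !tnth_mktuple /B2; case: eqVneq => //= _.
      have := Bw j Logic.I; rewrite !tnth_mktuple /B2 /=.
      by case: eqVneq => [->|].
    rewrite preE.
    transitivity (\int[P]_(w in D @^-1` A)
       (\1_(\bigcap_(j in [set: 'I_n]) (eps j @^-1` B1 j)) w : R)%:E)%E.
      rewrite integral_mkcond [RHS]integral_mkcond; apply: eq_integral => w _.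
      rewrite !patchE.
      have -> : (w \in D @^-1` A) = (D w \in A) by apply/idP/idP => /[!inE].
      rewrite !indicE; case: (D w \in A); rewrite ?mul1r ?mul0r ?if_same//.
      have -> : (w \in \bigcap_(j in [set: 'I_n]) (eps j @^-1` B1 j)) =
          (w \in \bigcap_(j in [set: 'I_n]) (eps j @^-1` B2 j)) && (eps i w \in C).
        apply/idP/andP => [|[]]; rewrite !inE.
          move=> H; split; last by have := H i Logic.I; rewrite /= /B1 eqxx.
          by move=> j _; have := H j Logic.I; rewrite /= /B1 /B2; case: ifP.
        move=> H Ci j _; have := H j Logic.I; rewrite /= /B1 /B2.
        by case: eqVneq => [->|].
      by case: (w \in _).
    rewrite indE//.
    transitivity (\int[P]_w ((\prod_(j < n) fine (kappa j (D w) (B2 j)))%:E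
        * (\1_A (D w) * fine (kappa i (D w) C))%:E))%E; last first.
      rewrite -(step1 B2 (fun x => (\1_A x * fine (kappa i x C))%:E))//.
      - rewrite [RHS]integral_mkcond; apply: eq_integral => w _.
        by rewrite patchE indicE; case: (w \in _); rewrite ?mul1e ?mul0e.
      - apply/measurable_EFinP; apply: measurable_funM; first exact: measurable_indic.
        by apply: measurableT_comp => //; exact: measurable_kernel.
    rewrite integral_mkcond; apply: eq_integral => w _; rewrite patchE.
    have -> : (w \in D @^-1` A) = (D w \in A) by apply/idP/idP => /[!inE].
    rewrite indicE -EFinM; case: (D w \in A); rewrite ?mul0r ?mulr0// mul1r.
    rewrite (bigD1 i)//= [in RHS](bigD1 i)//= /B1 /B2 eqxx k1 /=.
    rewrite mul1r mulrC; congr (_ * _)%:E.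
    by apply: eq_bigr => j ji; rewrite (negbTE ji).
  - exact/measurable_EFinP.
(* sets on the line form the pi-system, for the remaining noise variable *)
pose a w := \1_A (D w) * h (noise w).
have a0 w : 0 <= a w by rewrite mulr_ge0.
have ma : measurable_fun setT a.
  apply: measurable_funM; first exact: measurable_indic_design.
  exact: measurableT_comp measurable_noise.
pose k (w : Omega) : {measure set R -> \bar R} := mscale (NngNum (a0 w)) (kappa i (D w)).
have mk (C : set R) : measurable C -> measurable_fun [set: Omega] (k ^~ C).
  move=> mC; rewrite /k /= /mscale /=; apply: emeasurable_funM => //.
    by apply/measurable_EFinP.
  apply: (measurableT_comp (f := fun x => kappa i x C)); first exact: measurable_kernel.
  exact: measurable_design.
have mepsi : measurable_fun setT (eps i) by [].
transitivity (\int[mixture P (measurable_scaled_dirac mepsi ma)]_t g t)%E.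
  by rewrite integral_weighted_pushforward.
transitivity (\int[mixture P mk]_t g t)%E; last first.
  rewrite integral_mixture//; apply: eq_integral => w _.
  by rewrite ge0_integral_mscale.
apply: eq_measure_integral => C mC _; rewrite /= mixture_scaled_diracE//.
have := step2 C mC; rewrite /mixture => E.
transitivity (\int[P]_w ((\1_A (D w) * \1_C (eps i w))%:E
    * (h (upd i 0 (noise w)))%:E))%E.
  rewrite integral_mkcond; apply: eq_integral => w _; rewrite patchE indicE.
  have -> : (w \in eps i @^-1` C) = (eps i w \in C) by apply/idP/idP => /[!inE].
  rewrite hi -EFinM [in RHS]indicE /a; case: ifP => _; rewrite ?mulr1 ?mulr0 ?mul0r//.
rewrite E; apply: eq_integral => w _; rewrite /k /= /mscale /= hi.
rewrite [in RHS]kfin// -!EFinM /a; congr _%:E; ring.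
Qed.

Lemma independent_noise_law A (mA : measurable A) :
  independent_noise (Num.max q 2) sigma (noise_law mA).
Proof.
have [kappa [kE kmean kmom]] := Hnoise.
have mI (h : n.-tuple R -> R) : measurable_fun setT h ->
    measurable_fun setT (fun w => \1_A (D w) * h (noise w)).
  move=> mh; apply: measurable_funM; first exact: measurable_indic_design.
  exact: measurableT_comp measurable_noise.
have kint (g : R -> \bar R) i : (forall t, 0 <= g t)%E -> measurable_fun setT g ->
    measurable_fun setT (fun w => \int[kappa i (D w)]_t g t)%E.
  move=> g0 mg; apply: (measurableT_comp (f := fun x => \int[kappa i x]_t g t)%E);
    last exact: measurable_design.
  apply: measurable_integral_family => // B mB; exact: measurable_kernel.
have lawE (h : n.-tuple R -> R) (g : R -> R) i : measurable_fun setT h ->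
    (forall e, 0 <= h e) -> (forall t, 0 <= g t) -> measurable_fun setT g ->
    (\int[noise_law mA]_e (h e * g (tnth e i))%:E =
     \int[P]_w ((\1_A (D w) * h (noise w))%:E * (g (eps i w))%:E))%E.
  move=> mh h0 g0 mg; rewrite integral_noise_law//; last 2 first.
  - by move=> e; rewrite lee_fin mulr_ge0.
  - apply/measurable_EFinP; apply: measurable_funM => //.
    by apply: measurableT_comp => //; exact: measurable_tnth.
  rewrite integral_mkcond; apply: eq_integral => w _; rewrite patchE indicE.
  have -> : (w \in design X @^-1` A) = (D w \in A) by apply/idP/idP => /[!inE].
  rewrite /noise tnth_mktuple -EFinM.
  by case: (D w \in A); rewrite ?mul1r ?mul0r ?mul0e.
have lawE1 (h : n.-tuple R -> R) : measurable_fun setT h -> (forall e, 0 <= h e) ->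
    (\int[noise_law mA]_e (h e)%:E = \int[P]_w (\1_A (D w) * h (noise w))%:E)%E.
  move=> mh h0; rewrite integral_noise_law//; last exact/measurable_EFinP.
  rewrite integral_mkcond; apply: eq_integral => w _; rewrite patchE indicE.
  have -> : (w \in design X @^-1` A) = (D w \in A) by apply/idP/idP => /[!inE].
  by case: (D w \in A); rewrite ?mul1r ?mul0r.
have kM (h : n.-tuple R -> R) w : (forall e, 0 <= h e) ->
  (0 <= (\1_A (D w) * h (noise w))%:E :> \bar R)%E.
  by move=> h0; rewrite lee_fin mulr_ge0.
split.
- have -> : noise_law mA setT = (\int[noise_law mA]_e (cst 1 e)%:E)%E.
    by have := integral_cst (noise_law mA) measurableT 1%E; rewrite mul1e.
  rewrite (lawE1 (cst 1))//.
  apply: (@le_lt_trans _ _ (\int[P]_w (cst 1 w)%E)%E); last first.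
    rewrite integral_cst// mul1e.
    exact: le_lt_trans (probability_le1 P measurableT) (ltry 1).
  apply: ge0_le_integral_nomeas => w _; rewrite ?lee_fin ?mulr_ge0//=.
- move=> i h mh h0 hi.
  pose g (t : R) : R := `|t| `^ Num.max q 2.
  have g0 t : 0 <= g t by exact: powR_ge0.
  have mg : measurable_fun setT g.
    by apply: (measurableT_comp (measurable_powR _)); exact: normr_measurable.
  rewrite (lawE h g)// (@noise_disintegration kappa kE i A h (EFin \o g))//; last exact/measurable_EFinP.
  rewrite lawE1// -ge0_integralZl//; last 3 first.
  - by apply/measurable_EFinP; exact: mI.
  - by move=> w _; exact: kM.
  - by rewrite lee_fin powR_ge0.
  apply: ae_ge0_le_integral => //.
  - move=> w _; apply: mule_ge0; first exact: kM.
    by apply: integral_ge0 => t _; rewrite lee_fin.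
  - apply: emeasurable_funM; first by apply/measurable_EFinP; exact: mI.
    by apply: kint => //; exact/measurable_EFinP.
  - by move=> w _; apply: mule_ge0; [rewrite lee_fin powR_ge0|exact: kM].
  - apply: measurable_funeM; apply/measurable_EFinP; exact: mI.
  - have [N [mN N0 sN]] := kmom i; exists N; split => // w /= Hw.
    apply: sN => /= Hk; apply: Hw => _.
    rewrite [leRHS]muleC; apply: lee_wpmul2l; [exact: kM|].
    exact: Hk.
- move=> i h mh h0 hi.
  have mmax (s : R) : measurable_fun setT (fun t : R => Num.max (s * t) 0).
    by apply: measurable_maxr => //; exact: measurable_funM.
  have m1 : measurable_fun setT (fun t : R => Num.max t 0).
    by apply: (eq_measurable_fun _ _ (mmax 1)) => t _; rewrite mul1r.
  have m2 : measurable_fun setT (fun t : R => Num.max (- t) 0).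
    by apply: (eq_measurable_fun _ _ (mmax (-1))) => t _; rewrite mulN1r.
  have max0 (t : R) : 0 <= Num.max t 0 by rewrite le_max lexx orbT.
  rewrite (lawE h (fun t => Num.max t 0))// (lawE h (fun t => Num.max (- t) 0))//.
  rewrite (@noise_disintegration kappa kE i A h (fun t => (Num.max t 0)%:E))//; last exact/measurable_EFinP.
  rewrite (@noise_disintegration kappa kE i A h (fun t => (Num.max (- t) 0)%:E))//; last exact/measurable_EFinP.
  apply: ge0_ae_eq_integral => //.
  - apply: emeasurable_funM; first by apply/measurable_EFinP; exact: mI.
    by apply: kint; [move=> t; rewrite lee_fin|exact/measurable_EFinP].
  - apply: emeasurable_funM; first by apply/measurable_EFinP; exact: mI.
    by apply: kint; [move=> t; rewrite lee_fin|exact/measurable_EFinP].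
  - move=> w _; apply: mule_ge0; first exact: kM.
    by apply: integral_ge0 => t _; rewrite lee_fin.
  - move=> w _; apply: mule_ge0; first exact: kM.
    by apply: integral_ge0 => t _; rewrite lee_fin.
  - have [N [mN N0 sN]] := kmean i; exists N; split => // w /= Hw.
    apply: sN => /= Hk; apply: Hw => _; congr (_ * _)%E.
    move: Hk; rewrite integralE /=.
    have -> : (\int[kappa i (design X w)]_x ((fun t : R => t%:E)^\+ x) =
        \int[kappa i (design X w)]_(x in setT) (Num.max x 0)%:E)%E.
      by apply: eq_integral => t _; rewrite funeposE EFin_max.
    have -> : (\int[kappa i (design X w)]_x ((fun t : R => t%:E)^\- x) =
        \int[kappa i (design X w)]_(x in setT) (Num.max (- x) 0)%:E)%E.
      by apply: eq_integral => t _; rewrite funenegE EFin_max.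
    case: (integral _ _ _) => [x| |]; case: (integral _ _ _) => [y| |]//.
    by rewrite -EFinB => -[] /eqP; rewrite subr_eq0 => /eqP ->.
  - by move=> t; rewrite lee_fin; exact: max0.
Qed.

End noise_law.

(** * Scalar inequalities for powers *)

Section powers.
Context {R : realType}.
Implicit Types (x y a b p : R).

Lemma powRD_pos x a b : 0 < x -> x `^ (a + b) = x `^ a * x `^ b.
Proof. by move=> x0; rewrite powRD//; apply/implyP => _; rewrite gt_eqF. Qed.

Lemma sqr_normr x : `|x| ^+ 2 = x ^+ 2.
Proof. by rewrite real_normK ?num_real. Qed.

Lemma powR_pred p x : 0 <= x -> 1 < p -> x `^ (p - 1) * x = x `^ p.
Proof.
rewrite le_eqVlt => /predU1P[<-|x0] p1.
  by rewrite mulr0 powR0// gt_eqF//; lra.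
by rewrite -[X in _ * X]powRr1 ?ltW// -powRD_pos// subrK.
Qed.

Lemma powR_pred2 p x : 0 < x -> x `^ (p - 2) * x ^+ 2 = x `^ p.
Proof. by move=> x0; rewrite -powR_mulrn ?ltW// -powRD_pos// subrK. Qed.

Lemma ler_powR2 p x y : 0 <= p -> 0 <= x -> x <= y -> x `^ p <= y `^ p.
Proof.
by move=> p0 x0 xy; rewrite ge0_ler_powR// nnegrE//; exact: le_trans xy.
Qed.

Lemma powR_add_le p x y : 0 <= p -> 0 <= x -> 0 <= y ->
  (x + y) `^ p <= 2 `^ p * (x `^ p + y `^ p).
Proof.
move=> p0 x0 y0.
wlog xy : x y x0 y0 / x <= y.
  by move=> H; case: (leP x y) => [|/ltW] xy; [|rewrite addrC [x `^ p + _]addrC]; exact: H.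
apply: (@le_trans _ _ ((2 * y) `^ p)).
  by apply: ler_powR2 => //; [rewrite addr_ge0|rewrite mulr2n mulrDl !mul1r lerD2r].
by rewrite powRM// ler_wpM2l ?powR_ge0// lerDr powR_ge0.
Qed.

(** Arithmetic-geometric mean, with t ^ (p - 1) <= t ^ (p / 2) for t <= 1. *)
Lemma powR_pred_mul_le p a b : 2 <= p -> 0 <= a -> a <= b ->
  a `^ (p - 1) * b <= 2^-1 * a `^ p + 2^-1 * b `^ p.
Proof.
move=> p2 a0 ab.
have [->|b0] := eqVneq b 0.
  by rewrite mulr0 addr_ge0// mulr_ge0// powR_ge0.
have {}b0 : 0 < b by rewrite lt_neqAle eq_sym b0 (le_trans a0).
have [->|an0] := eqVneq a 0.
  by rewrite powR0 ?mul0r ?addr_ge0// ?mulr_ge0 ?powR_ge0// gt_eqF//; lra.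
have {}a0 : 0 < a by rewrite lt_neqAle eq_sym an0.
have H : a `^ (p - 1) * b <= a `^ (p / 2) * b `^ (p / 2).
  have -> : p - 1 = p / 2 + (p / 2 - 1) by field.
  rewrite powRD_pos// -mulrA ler_wpM2l ?powR_ge0//.
  have -> : b `^ (p / 2) = b `^ (p / 2 - 1) * b.
    by rewrite -[X in _ = _ * X]powRr1 ?ltW// -powRD_pos// subrK.
  rewrite ler_wpM2r ?(ltW b0)//.
  by apply: ler_powR2 => //; [lra|exact: ltW].
apply: le_trans H _.
have sq x : 0 < x -> x `^ p = (x `^ (p / 2)) ^+ 2.
  by move=> x0; rewrite expr2 -powRD_pos//; congr (_ `^ _); field.
rewrite (sq a)// (sq b)//.
have := sqr_ge0 (a `^ (p / 2) - b `^ (p / 2)); nra.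
Qed.

(** Young's inequality, with a first constant small enough to be absorbed in
   Doob's inequality. *)
Lemma powR_pred_mul_le4 p a b : 2 <= p -> 0 <= a -> 0 <= b ->
  a `^ (p - 1) * b <= 4^-1 * a `^ p + 4 `^ (p - 1) * b `^ p.
Proof.
move=> p2 a0 b0; have [ba|ab] := leP (4 * b) a.
  rewrite (@le_trans _ _ (4^-1 * a `^ p))// ?lerDl ?mulr_ge0 ?powR_ge0//.
  rewrite -(@powR_pred p a)//; last lra.
  by rewrite mulrCA ler_wpM2l ?powR_ge0//; lra.
rewrite (@le_trans _ _ (4 `^ (p - 1) * b `^ p))// ?lerDr ?mulr_ge0 ?powR_ge0//.
rewrite -(@powR_pred p b)//; last lra.
rewrite mulrA -powRM// ler_wpM2r//.
by apply: ler_powR2 => //; [lra|exact: ltW].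
Qed.

Lemma expR_le2 x : `|x| <= 2^-1 -> expR x <= 1 + x + 2 * x ^+ 2.
Proof.
move=> /ler_normlP[x1 x2].
have h : 1 - x <= expR (- x) by have := expR_ge1Dx (- x); rewrite addrC.
have x0 : 0 < 1 - x by lra.
rewrite -[x in expR x]opprK expRN invf_ple ?posrE ?expR_gt0//; last nra.
apply: le_trans h; rewrite -[leLHS]mul1r ler_pdivrMr; nra.
Qed.

Definition taylor_cst p : R := (2 * p + 1) `^ p + 2 * p ^+ 2.

Lemma taylor_cst_ge1 p : 2 <= p -> 1 <= taylor_cst p.
Proof.
move=> p2; rewrite /taylor_cst (@le_trans _ _ (2 * p ^+ 2))//; first nra.
by rewrite lerDr powR_ge0.
Qed.

(** Near 0 the exponential dominates 1 + x and has a second-order expansion; away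
   from 0 the p-th power of x dominates everything. *)
Lemma powR_norm1D_le p x : 2 <= p ->
  `|1 + x| `^ p <= 1 + p * x + taylor_cst p * (x ^+ 2 + `|x| `^ p).
Proof.
move=> p2; have p0 : 0 < p by lra.
have [x1|x1] := leP `|p * x| 2^-1.
  have px : `|x| <= 2^-1.
    apply: le_trans x1; rewrite normrM (gtr0_norm p0) ler_peMl//; lra.
  have x2 : 0 <= 1 + x by move/ler_normlP : px => [? ?]; lra.
  rewrite ger0_norm//.
  apply: (@le_trans _ _ (expR x `^ p)).
    by apply: ler_powR2 => //; [exact: ltW|exact: expR_ge1Dx].
  rewrite -expRM mulrC (le_trans (expR_le2 x1))// lerD2l /taylor_cst [leRHS]mulrDl.
  rewrite (@le_trans _ _ (2 * p ^+ 2 * (x ^+ 2 + `|x| `^ p)))//.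
    rewrite exprMn mulrA ler_wpM2l//; first nra.
    by rewrite lerDl powR_ge0.
  by rewrite lerDr mulr_ge0 ?powR_ge0// addr_ge0 ?sqr_ge0 ?powR_ge0.
have x1' : 1 <= 2 * p * `|x|.
  by move: x1; rewrite normrM (gtr0_norm p0); lra.
have n0 := normr_ge0 x.
have H1 : `|1 + x| `^ p <= (2 * p + 1) `^ p * `|x| `^ p.
  rewrite -powRM//; last lra.
  apply: ler_powR2 => //; first exact: ltW.
  apply: le_trans (ler_normD _ _) _; rewrite normr1; lra.
have H2 : 0 <= 1 + p * x + 2 * p ^+ 2 * x ^+ 2.
  have : - `|x| <= x by rewrite lerNl ler_normr lexx orbT.
  rewrite -(sqr_normr x) => ?.
  have : p * `|x| <= 2 * p ^+ 2 * `|x| ^+ 2.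
    have -> : 2 * p ^+ 2 * `|x| ^+ 2 = (p * `|x|) * (2 * p * `|x|) by ring.
    by rewrite ler_peMr// mulr_ge0// ltW.
  nra.
have H3 := powR_ge0 `|x| p; have H4 := powR_ge0 (2 * p + 1) p.
have H5 := sqr_ge0 x.
rewrite /taylor_cst; apply: le_trans H1 _; nra.
Qed.

(** Second-order Taylor bound, by homogeneity from the case a = 1. *)
Lemma powR_normD_le p a b : 2 <= p ->
  `|a + b| `^ p <= `|a| `^ p + (p * (`|a| `^ (p - 2) * a)) * b
    + taylor_cst p * (`|a| `^ (p - 2) * b ^+ 2 + `|b| `^ p).
Proof.
move=> p2; have p0 : 0 < p by lra.
have [->|a0] := eqVneq a 0.
  rewrite add0r normr0 powR0 ?gt_eqF// !mulr0 mul0r !add0r.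
  have T1 := taylor_cst_ge1 p2.
  rewrite (@le_trans _ _ (taylor_cst p * `|b| `^ p))//.
    by rewrite ler_peMl// powR_ge0.
  rewrite ler_wpM2l//; first lra.
  by rewrite lerDr mulr_ge0 ?powR_ge0 ?sqr_ge0.
have na : 0 < `|a| by rewrite normr_gt0.
have := powR_norm1D_le (b / a) p2.
rewrite -(ler_pM2l (powR_gt0 p na)) -powRM// -normrM => H.
have E1 : a * (1 + b / a) = a + b by field.
rewrite E1 in H; apply: le_trans H _.
rewrite mulrDr mulrDr mulr1 le_eqVlt; apply/orP; left; apply/eqP; congr (_ + _ + _).
  by rewrite -(powR_pred2 p na) sqr_normr; field.
rewrite mulrCA; congr (_ * _); rewrite mulrDr; congr (_ + _).
  by rewrite -(powR_pred2 p na) sqr_normr; field.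
by rewrite -powRM// -normrM; congr (`|_| `^ _); field.
Qed.

(** The second-order term of the expansion: for N steps, a fraction 1 / N of the
   current p-th moment can be lost at each step. *)
Lemma powR_variance_le p a s (N : R) : 2 <= p -> 0 <= a -> 0 < s -> 1 <= N ->
  a `^ (p - 2) * s ^+ 2 <= a `^ p / N + N `^ (p / 2 - 1) * s `^ p.
Proof.
move=> p2 a0 s0 N1; have N0 : 0 < N by lra.
have [h|h] := leP (N * s ^+ 2) (a ^+ 2).
  have {}a0 : 0 < a.
    rewrite lt_neqAle a0 andbT eq_sym; apply/eqP => aE; move: h; rewrite aE.
    have : 0 < s ^+ 2 by rewrite exprn_gt0.
    nra.
  rewrite (@le_trans _ _ (a `^ p / N))//; last first.
    by rewrite lerDl mulr_ge0 ?powR_ge0.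
  rewrite -(powR_pred2 p a0) -mulrA ler_wpM2l ?powR_ge0// ler_pdivlMr//.
  by rewrite mulrC.
rewrite (@le_trans _ _ (N `^ (p / 2 - 1) * s `^ p))//; last first.
  by rewrite lerDr divr_ge0 ?powR_ge0// ltW.
rewrite -(powR_pred2 p s0) mulrA ler_wpM2r ?sqr_ge0//.
have -> : s `^ (p - 2) = (s ^+ 2) `^ (p / 2 - 1).
  by rewrite -powR_mulrn ?ltW// -powRrM; congr (_ `^ _); field.
rewrite -powRM ?sqr_ge0 ?(ltW N0)//.
have -> : a `^ (p - 2) = (a ^+ 2) `^ (p / 2 - 1).
  by rewrite -powR_mulrn// -powRrM; congr (_ `^ _); field.
by apply: ler_powR2; [lra|exact: sqr_ge0|exact: ltW].
Qed.

(** Truncation at s reduces the second moment to the p-th one. *)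
Lemma sqr_le_powR p s x : 2 <= p -> 0 < s ->
  x ^+ 2 <= s ^+ 2 + s `^ (2 - p) * `|x| `^ p.
Proof.
move=> p2 s0; rewrite -sqr_normr; have x0 := normr_ge0 x.
have [xs|sx] := leP `|x| s.
  rewrite (@le_trans _ _ (s ^+ 2))// ?lerDl ?mulr_ge0 ?powR_ge0//.
  by rewrite ler_sqr// nnegrE// ltW.
rewrite (@le_trans _ _ (s `^ (2 - p) * `|x| `^ p))// ?lerDr ?sqr_ge0//.
have {}x0 : 0 < `|x| by lra.
rewrite -(powR_pred2 p x0) mulrA -[leLHS]mul1r ler_wpM2r ?sqr_ge0//.
rewrite [leLHS](_ : 1 = s `^ (2 - p) * s `^ (p - 2)); last first.
  by rewrite -powRD_pos// (_ : 2 - p + _ = 0) ?powRr0//; ring.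
rewrite ler_wpM2l ?powR_ge0//.
by apply: ler_powR2; [lra|exact: ltW|exact: ltW].
Qed.

End powers.

(** * Maximal inequalities for independent noise *)

Section growth.
Context {R : realType} {n : nat}.
Implicit Types (e : n.-tuple R) (f g : n.-tuple R -> R) (r : R).

Definition size_of e : R := 1 + \sum_(i < n) `|tnth e i|.

(** Measurable of growth at most r at infinity: enough for integrability when r
   is the order of the moments of the noise, and stable under products. *)
Definition growth r f : Prop :=
  measurable_fun setT f /\
  exists2 c, 0 <= c & forall e, `|f e| <= c * size_of e `^ r.

Lemma size_of_ge1 e : 1 <= size_of e.
Proof. by rewrite lerDl sumr_ge0. Qed.

Lemma size_of_gt0 e : 0 < size_of e.
Proof. exact: lt_le_trans ltr01 (size_of_ge1 e). Qed.

Lemma measurable_coord i : measurable_fun setT (fun e => tnth e i).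
Proof. exact: measurable_tnth. Qed.

Lemma growth_le r r' f : r <= r' -> growth r f -> growth r' f.
Proof.
move=> rr' [mf [c c0 cf]]; split => //; exists c => // e.
apply: le_trans (cf e) _; rewrite ler_wpM2l// ler_powR//.
exact: size_of_ge1.
Qed.

Lemma growthD r f g : growth r f -> growth r g -> growth r (fun e => f e + g e).
Proof.
move=> [mf [c c0 cf]] [mg [c' c'0 cg]]; split; first exact: measurable_funD.
exists (c + c'); first exact: addr_ge0.
by move=> e; rewrite mulrDl (le_trans (ler_normD _ _))// lerD.
Qed.

Lemma growthM r r' f g : growth r f -> growth r' g ->
  growth (r + r') (fun e => f e * g e).
Proof.
move=> [mf [c c0 cf]] [mg [c' c'0 cg]]; split; first exact: measurable_funM.
exists (c * c'); first exact: mulr_ge0.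
move=> e; rewrite powRD_pos ?size_of_gt0// mulrACA normrM.
by apply: ler_pM.
Qed.

Lemma growth_cst r k : 0 <= r -> growth r (fun=> k).
Proof.
move=> r0; split; first exact: measurable_cst.
exists `|k| => // e; rewrite ler_peMr//.
by apply: le_trans (ler_powR2 r0 ler01 (size_of_ge1 e)); rewrite powR1.
Qed.

Lemma growthZ r k f : growth r f -> growth r (fun e => k * f e).
Proof.
by move=> gf; rewrite -(add0r r); apply: growthM gf; exact: growth_cst.
Qed.

Lemma growth_abs r f : growth r f -> growth r (fun e => `|f e|).
Proof.
move=> [mf [c c0 cf]]; split; first exact: measurableT_comp.
by exists c => // e; rewrite normr_id.
Qed.

Lemma growth_dom r f g : growth r f -> measurable_fun setT g ->
  (forall e, `|g e| <= `|f e|) -> growth r g.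
Proof.
move=> [mf [c c0 cf]] mg gf; split => //; exists c => // e.
exact: le_trans (cf e).
Qed.

Lemma growth_max r f g : growth r f -> growth r g ->
  growth r (fun e => Num.max (f e) (g e)).
Proof.
move=> gf gg; apply: growth_dom (growthD (growth_abs gf) (growth_abs gg)) _ _.
  by apply: measurable_maxr; [exact: gf.1|exact: gg.1].
move=> e; rewrite [leRHS]ger0_norm ?addr_ge0//.
by case: (leP (f e) (g e)) => _; [rewrite lerDr|rewrite lerDl].
Qed.

Lemma growth_coord i : growth 1 (fun e => tnth e i).
Proof.
split; first exact: measurable_coord.
exists 1 => // e; rewrite mul1r powRr1 ?(ltW (size_of_gt0 e))//.
rewrite /size_of (bigD1 i)//= addrCA lerDl addr_ge0// sumr_ge0//.
Qed.

Lemma growth_sum r (I : Type) (s : seq I) (f : I -> n.-tuple R -> R) : 0 <= r ->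
  (forall i, growth r (f i)) -> growth r (fun e => \sum_(i <- s) f i e).
Proof.
move=> r0 gf; elim: s => [|i s IHs].
  rewrite (_ : (fun _ => _) = (fun=> 0)); first exact: growth_cst.
  by apply/funext => e; rewrite big_nil.
rewrite (_ : (fun _ => _) = (fun e => f i e + \sum_(i <- s) f i e)).
  exact: growthD.
by apply/funext => e; rewrite big_cons.
Qed.

Lemma growth_bigmax r (I : Type) (s : seq I) (f : I -> n.-tuple R -> R) :
  0 <= r -> (forall i, growth r (f i)) ->
  growth r (fun e => \big[Num.max/0]_(i <- s) f i e).
Proof.
move=> r0 gf; elim: s => [|i s IHs].
  rewrite (_ : (fun _ => _) = (fun=> 0)); first exact: growth_cst.
  by apply/funext => e; rewrite big_nil.
rewrite (_ : (fun _ => _) =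
    (fun e => Num.max (f i e) (\big[Num.max/0]_(i <- s) f i e))).
  exact: growth_max.
by apply/funext => e; rewrite big_cons.
Qed.

Lemma growth_powR r r' f : 0 <= r' -> growth r f ->
  growth (r * r') (fun e => `|f e| `^ r').
Proof.
move=> r'0 [mf [c c0 cf]]; split.
  apply: (measurableT_comp (measurable_powR _)); exact: measurableT_comp.
exists (c `^ r'); first exact: powR_ge0.
move=> e; rewrite ger0_norm ?powR_ge0// powRrM -powRM ?powR_ge0//.
exact: ler_powR2.
Qed.

Lemma growth_if r (b : n.-tuple R -> bool) f g : measurable_fun setT b ->
  growth r f -> growth r g -> growth r (fun e => if b e then f e else g e).
Proof.
move=> mb gf gg; apply: growth_dom (growthD (growth_abs gf) (growth_abs gg)) _ _.
  by apply: measurable_fun_if => //; apply: measurable_funTS;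
    [exact: gf.1|exact: gg.1].
move=> e; rewrite [leRHS]ger0_norm ?addr_ge0//.
by case: ifP => _; [rewrite lerDl|rewrite lerDr].
Qed.

End growth.

Section maximal.
Context {R : realType} {n : nat}.
Variables (Q : {measure set (n.-tuple R) -> \bar R}) (p s : R).
Hypotheses (p2 : 2 <= p) (s0 : 0 < s) (HQ : independent_noise p s Q).
Implicit Types (e : n.-tuple R) (f g h : n.-tuple R -> R) (i : 'I_n).

Let p0 : 0 < p. Proof. exact: lt_le_trans p2. Qed.
Let p_ge0 : 0 <= p. Proof. exact: ltW. Qed.

Lemma noise_measure_fin : (Q setT < +oo)%E. Proof. by have [] := HQ. Qed.

Lemma noise_cstE (c : R) : (\int[Q]_e c%:E = c%:E * Q setT)%E.
Proof. exact: (integral_cst Q measurableT c%:E). Qed.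

Lemma noise_moment_fin i : (\int[Q]_e (`|tnth e i| `^ p)%:E < +oo)%E.
Proof.
have [Qfin + _] := HQ; move=> /(_ i (fun=> 1) (measurable_cst _) (fun=> ler01)).
move=> /(_ (fun _ _ => erefl)).
rewrite noise_cstE mul1e => H.
under eq_integral => e _ do rewrite -[_ `^ _]mul1r.
apply: le_lt_trans H _; rewrite lte_mul_pinfty// lee_fin powR_ge0//.
Qed.

Lemma integrable_size_of : (\int[Q]_e (size_of e `^ p)%:E < +oo)%E.
Proof.
rewrite /size_of.
have mpow (f : n.-tuple R -> R) : measurable_fun setT f ->
    measurable_fun setT (fun e => (f e `^ p)%:E).
  by move=> mf; apply/measurable_EFinP; exact: (measurableT_comp (measurable_powR _) mf).
have msum (r : seq 'I_n) : measurable_fun setT (fun e => 1 + \sum_(i <- r) `|tnth e i|).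
  apply: measurable_funD => //; apply: measurable_sum => i.
  by apply: measurableT_comp => //; exact: measurable_coord.
have mi i : measurable_fun setT (fun e => `|tnth e i|).
  by apply: measurableT_comp => //; exact: measurable_coord.
elim: (index_enum 'I_n) => [|i r IHr].
  under eq_integral do rewrite big_nil addr0 powR1.
  by rewrite noise_cstE mul1e noise_measure_fin.
apply: (@le_lt_trans _ _ (\int[Q]_e ((2 `^ p)%:E *
   ((`|tnth e i| `^ p)%:E + ((1 + \sum_(i <- r) `|tnth e i|) `^ p)%:E)))%E).
  apply: ge0_le_integral_nomeas => e _; rewrite lee_fin ?powR_ge0//.
  rewrite big_cons addrCA powR_add_le//.
  by rewrite addr_ge0// sumr_ge0.
rewrite ge0_integralZl//.
- rewrite lte_mul_pinfty ?lee_fin ?powR_ge0// ge0_integralD//.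
  + by rewrite lte_add_pinfty// noise_moment_fin.
  + exact: (mpow _ (mi i)).
  + by move=> e _; rewrite lee_fin powR_ge0.
  + exact: (mpow _ (msum r)).
- by apply: emeasurable_funD; [exact: (mpow _ (mi i))|exact: (mpow _ (msum r))].
- by move=> e _; rewrite adde_ge0// lee_fin powR_ge0.
Qed.

Lemma growth_integrable f : growth p f -> Q.-integrable setT (EFin \o f).
Proof.
move=> [mf [c c0 cf]]; apply/integrableP; split; first exact/measurable_EFinP.
apply: (@le_lt_trans _ _ (\int[Q]_e (c%:E * (size_of e `^ p)%:E))%E).
  apply: ge0_le_integral_nomeas => e _; first exact: abse_ge0.
  by rewrite /= lee_fin.
rewrite ge0_integralZl//.
- by rewrite lte_mul_pinfty// integrable_size_of.
- apply/measurable_EFinP; apply: (measurableT_comp (measurable_powR _)).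
  apply: measurable_funD => //; apply: measurable_sum => i.
  by apply: measurableT_comp => //; exact: measurable_coord.
- by move=> e _; rewrite lee_fin powR_ge0.
Qed.

Definition expect f : R := \int[Q]_e f e.

Lemma expectD f g : growth p f -> growth p g ->
  expect (fun e => f e + g e) = expect f + expect g.
Proof. by move=> gf gg; rewrite /expect RintegralD//; exact: growth_integrable. Qed.

Lemma expectZ k f : growth p f -> expect (fun e => k * f e) = k * expect f.
Proof. by move=> gf; rewrite /expect RintegralZl//; exact: growth_integrable. Qed.

Lemma expect_le f g : growth p f -> growth p g -> (forall e, f e <= g e) ->
  expect f <= expect g.
Proof. by move=> gf gg fg; apply: le_Rintegral => //; exact: growth_integrable. Qed.

Lemma expect_ge0 f : (forall e, 0 <= f e) -> 0 <= expect f.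
Proof. by move=> f0; apply: Rintegral_ge0. Qed.

Lemma EFin_expect f : growth p f -> ((expect f)%:E = \int[Q]_e (f e)%:E)%E.
Proof.
by move=> gf; rewrite /expect /Rintegral fineK//; apply: integrable_fin_num => //;
  exact: growth_integrable.
Qed.

Let growth_mul1 h f : growth (p - 1) h -> growth 1 f ->
  growth p (fun e => h e * f e).
Proof. by move=> gh gf; have := growthM gh gf; rewrite subrK. Qed.

Lemma free_ofP i (V W : Type) (F : V -> W) (f : n.-tuple R -> V) :
  free_of i f -> free_of i (fun e => F (f e)).
Proof. by move=> fi e a; rewrite fi. Qed.

Lemma expect_mean_ge0 i h : growth (p - 1) h -> free_of i h ->
  (forall e, 0 <= h e) -> expect (fun e => h e * tnth e i) = 0.
Proof.
move=> gh hi h0.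
have [_ _ /(_ i h gh.1 h0 hi) H] := HQ.
have gp : growth p (fun e => h e * Num.max (tnth e i) 0).
  apply: growth_mul1 => //; apply: growth_max; first exact: growth_coord.
  exact: growth_cst.
have gm : growth p (fun e => h e * Num.max (- tnth e i) 0).
  apply: growth_mul1 => //; apply: growth_max; last exact: growth_cst.
  rewrite (_ : (fun _ => _) = (fun e => -1 * tnth e i)).
    by apply: growthZ; exact: growth_coord.
  by apply/funext => e; rewrite mulN1r.
rewrite -!EFin_expect// in H; case: H => H.
rewrite (_ : (fun e => _) = (fun e => h e * Num.max (tnth e i) 0
    + -1 * (h e * Num.max (- tnth e i) 0))).
  rewrite expectD//; last exact: growthZ.
  by rewrite expectZ// H mulN1r subrr.
apply/funext => e; rewrite mulN1r -mulrBr; congr (_ * _).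
have [h1|h1] := leP (tnth e i) 0; case: leP => h2; lra.
Qed.

Lemma expect_mean i h : growth (p - 1) h -> free_of i h ->
  expect (fun e => h e * tnth e i) = 0.
Proof.
move=> gh hi.
have p1 : 0 <= p - 1 by rewrite subr_ge0; apply: le_trans p2; rewrite ler1n.
have gp : growth (p - 1) (fun e => Num.max (h e) 0).
  by apply: growth_max => //; exact: growth_cst.
have gm : growth (p - 1) (fun e => Num.max (-1 * h e) 0).
  by apply: growth_max; [exact: growthZ|exact: growth_cst].
rewrite (_ : (fun e => _) = (fun e => Num.max (h e) 0 * tnth e i
    + -1 * (Num.max (-1 * h e) 0 * tnth e i))).
  have c1 := growth_coord i.
  rewrite expectD; [|exact: growth_mul1|by apply: growthZ; exact: growth_mul1].
  rewrite expectZ; last exact: growth_mul1.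
  rewrite !expect_mean_ge0 ?mulr0 ?addr0//.
  - exact: (free_ofP (fun x => Num.max (-1 * x) 0)).
  - by move=> e; rewrite le_max lexx orbT.
  - exact: (free_ofP (fun x => Num.max x 0)).
  - by move=> e; rewrite le_max lexx orbT.
apply/funext => e; rewrite !mulN1r -mulrBl; congr (_ * _).
have [h1|h1] := leP (h e) 0; case: leP => h2; lra.
Qed.

Lemma expect_moment i h : growth 0 h -> free_of i h -> (forall e, 0 <= h e) ->
  expect (fun e => h e * `|tnth e i| `^ p) <= s `^ p * expect h.
Proof.
move=> gh hi h0; have [_ /(_ i h gh.1 h0 hi) H _] := HQ.
rewrite -lee_fin EFinM !EFin_expect//; first exact: growth_le gh.
have := growthM gh (growth_powR p_ge0 (growth_coord i)).
by rewrite add0r mul1r.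
Qed.

Lemma expect_variance i h : growth (p - 2) h -> free_of i h -> (forall e, 0 <= h e) ->
  expect (fun e => h e * tnth e i ^+ 2) <= 2 * s ^+ 2 * expect h.
Proof.
move=> gh hi h0; have [_ /(_ i h gh.1 h0 hi) H _] := HQ.
have ghp : growth p h by apply: (@growth_le _ _ (p - 2)) => //; rewrite gerBl.
rewrite -lee_fin EFinM !EFin_expect//; last first.
  have := growthM gh (growthM (growth_coord i) (growth_coord i)).
  by rewrite (_ : p - 2 + _ = p) 1?addrA ?subrK//; ring.
have mh : measurable_fun setT (fun e => (h e)%:E) by apply/measurable_EFinP; exact: gh.1.
have mhp : measurable_fun setT (fun e => (h e * `|tnth e i| `^ p)%:E).
  apply/measurable_EFinP; apply: measurable_funM; first exact: gh.1.
  by have := growth_powR p_ge0 (growth_coord i); case.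
apply: (@le_trans _ _ (\int[Q]_e ((s ^+ 2)%:E * (h e)%:E
    + (s `^ (2 - p))%:E * (h e * `|tnth e i| `^ p)%:E))%E).
  apply: ge0_le_integral_nomeas => e _.
    by rewrite lee_fin mulr_ge0// sqr_ge0.
  rewrite -!EFinM -EFinD lee_fin.
  have -> : s ^+ 2 * h e + s `^ (2 - p) * (h e * `|tnth e i| `^ p) =
    h e * (s ^+ 2 + s `^ (2 - p) * `|tnth e i| `^ p) by ring.
  apply: ler_wpM2l => //.
  exact: sqr_le_powR.
rewrite ge0_integralD//; last 4 first.
- by move=> e _; rewrite -EFinM lee_fin mulr_ge0// sqr_ge0.
- exact: measurable_funeM.
- by move=> e _; rewrite -EFinM lee_fin mulr_ge0 ?powR_ge0// mulr_ge0 ?powR_ge0.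
- exact: measurable_funeM.
rewrite ge0_integralZl//; last 2 first.
- by move=> e _; rewrite lee_fin.
- by rewrite lee_fin sqr_ge0.
rewrite ge0_integralZl//; last 2 first.
- by move=> e _; rewrite lee_fin mulr_ge0 ?powR_ge0.
- by rewrite lee_fin powR_ge0.
rewrite (_ : 2 * s ^+ 2 = s ^+ 2 + s ^+ 2); last ring.
rewrite EFinD ge0_muleDl ?lee_fin ?sqr_ge0//.
rewrite leeD2l//.
rewrite -(EFin_expect ghp) in H *.
apply: (le_trans (lee_wpmul2l _ H)); first by rewrite lee_fin powR_ge0.
rewrite muleA -EFinM lee_fin ler_wpM2r//; first exact: expect_ge0.
rewrite -powRD_pos// (_ : 2 - p + p = 2); last ring.
by rewrite powR_mulrn// ltW.
Qed.

(** ** Doob's inequality for families of weighted sums *)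

Section families.
Variable T : finType.
Implicit Types (a : T -> 'I_n -> R) (r : seq 'I_n).

Definition wsum (c : 'I_n -> R) r e : R := \sum_(i <- r) c i * tnth e i.

Definition family_max a r e : R := \big[Num.max/0]_(t : T) `|wsum (a t) r e|.

(** The largest value of [family_max] over the tails of r: the list is read from
   its end, so that the tails are the successive states of a martingale. *)
Fixpoint running_max a r e : R :=
  if r is _ :: r' then Num.max (family_max a r e) (running_max a r' e)
  else 0.

Lemma growth_wsum c r : growth 1 (wsum c r).
Proof. by apply: growth_sum => // i; apply: growthZ; exact: growth_coord. Qed.

Lemma growth_family_max a r : growth 1 (family_max a r).
Proof.
by apply: growth_bigmax => // t; apply: growth_abs; exact: growth_wsum.
Qed.

Lemma growth_running_max a r : growth 1 (running_max a r).
Proof.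
elim: r => [|i r IHr] /=; first exact: growth_cst.
by apply: growth_max => //; exact: growth_family_max.
Qed.

Lemma bigmaxr_ge0 (I : Type) (l : seq I) (F : I -> R) :
  0 <= \big[Num.max/0]_(i <- l) F i.
Proof.
elim: l => [|i l IHl]; first by rewrite big_nil.
by rewrite big_cons le_max IHl orbT.
Qed.

Lemma family_max_ge0 a r e : 0 <= family_max a r e.
Proof. exact: bigmaxr_ge0. Qed.

Lemma family_max_ge a r e t : `|wsum (a t) r e| <= family_max a r e.
Proof. exact: (le_bigmax_cond 0 (fun t => `|wsum (a t) r e|)). Qed.

Lemma family_max_le a r e x : 0 <= x ->
  (forall t, `|wsum (a t) r e| <= x) -> family_max a r e <= x.
Proof. by move=> x0 H; apply: bigmax_le => // t _; exact: H. Qed.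

Lemma running_max_ge0 a r e : 0 <= running_max a r e.
Proof. by case: r => //= i r; rewrite le_max family_max_ge0. Qed.

Lemma running_max_tail a r1 r2 e :
  family_max a r2 e <= running_max a (r1 ++ r2) e.
Proof.
elim: r1 => [|i r1 IH] /=; last by rewrite le_max IH orbT.
case: r2 => [|i r2] /=; last by rewrite le_max lexx.
by apply: family_max_le => // t; rewrite /wsum big_nil normr0.
Qed.

Lemma free_wsum c r i : i \notin r -> free_of i (wsum c r).
Proof.
move=> ir e x; rewrite /wsum; apply: eq_big_seq => j jr.
by rewrite tnth_mktuple; case: eqVneq => // ji; move: ir; rewrite -ji jr.
Qed.

Lemma free_family_max a r i : i \notin r -> free_of i (family_max a r).
Proof.
by move=> ir e x; rewrite /family_max; apply: eq_bigr => t _; rewrite free_wsum.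
Qed.

Lemma free_running_max a r i : i \notin r -> free_of i (running_max a r).
Proof.
elim: r => // j r IHr ir e x /=; rewrite free_family_max// IHr//.
by move: ir; rewrite inE negb_or => /andP[].
Qed.

(** Jensen's inequality: the sign of f, which is free of coordinate i, gives a
   supporting line of the absolute value, and the linear term has mean 0. *)
Lemma expect_norm_submartingale i h f (c : R) : growth (p - 1) h -> growth 1 f ->
  (forall e, 0 <= h e) -> free_of i h -> free_of i f ->
  expect (fun e => h e * `|f e|) <= expect (fun e => h e * `|f e + c * tnth e i|).
Proof.
move=> gh gf h0 hi fi.
have gt := growth_coord i.
have mb : measurable_fun setT (fun e => 0 <= f e).
  by apply: measurable_fun_ler => //; exact: gf.1.
pose k e := if 0 <= f e then c * h e else - c * h e.
have gk : growth (p - 1) k by apply: growth_if => //; exact: growthZ.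
have ki : free_of i k by move=> e x; rewrite /k hi fi.
have g1 : growth p (fun e => h e * `|f e|) by apply: growth_mul1 => //; exact: growth_abs.
have g2 : growth p (fun e => k e * tnth e i) by exact: growth_mul1.
rewrite -[leLHS]addr0 -(expect_mean gk ki) -expectD//.
apply: expect_le.
- exact: growthD.
- by apply: growth_mul1 => //; apply: growth_abs; apply: growthD => //; exact: growthZ.
move=> e; rewrite /k; case: ifPn => [f0|]; last rewrite -ltNge => f0.
  rewrite ger0_norm//.
  have -> : h e * f e + c * h e * tnth e i = h e * (f e + c * tnth e i) by ring.
  by rewrite ler_wpM2l// ler_norm.
rewrite ltr0_norm//.
have -> : h e * - f e + - c * h e * tnth e i = h e * - (f e + c * tnth e i) by ring.
by rewrite ler_wpM2l// -normrN ler_norm.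
Qed.

(** The absolute value of each sum is a submartingale, hence so is the maximum of
   the family: split according to the index that attains it. *)
Lemma expect_max_submartingale i h (l : seq T) (f : T -> n.-tuple R -> R) (c : T -> R) :
  growth (p - 1) h -> (forall t, growth 1 (f t)) ->
  (forall e, 0 <= h e) -> free_of i h -> (forall t, free_of i (f t)) ->
  expect (fun e => h e * \big[Num.max/0]_(t <- l) `|f t e|) <=
  expect (fun e => h e * \big[Num.max/0]_(t <- l) `|f t e + c t * tnth e i|).
Proof.
move=> gh gf h0 hi fi.
have p1 : 0 <= p - 1 by rewrite subr_ge0; apply: le_trans p2; rewrite ler1n.
elim: l h gh h0 hi => [|t l IHl] h gh h0 hi.
  by under eq_fun do rewrite big_nil; under [in leRHS]eq_fun do rewrite big_nil.
pose M e := \big[Num.max/0]_(t <- l) `|f t e|.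
pose N e := \big[Num.max/0]_(t <- l) `|f t e + c t * tnth e i|.
have gM : growth 1 M by apply: growth_bigmax => // u; exact: growth_abs.
have gft u : growth 1 (fun e => f u e + c u * tnth e i).
  by apply: growthD => //; apply: growthZ; exact: growth_coord.
have gN : growth 1 N by apply: growth_bigmax => // u; exact: growth_abs.
have Mi : free_of i M by move=> e x; rewrite /M; apply: eq_bigr => u _; rewrite fi.
have mb : measurable_fun setT (fun e => M e <= `|f t e|).
  apply: measurable_fun_ler; first exact: gM.1.
  by have := growth_abs (gf t); case.
pose h1 e := if M e <= `|f t e| then h e else 0.
pose h2 e := if M e <= `|f t e| then 0 else h e.
have gh1 : growth (p - 1) h1 by apply: growth_if => //; exact: growth_cst.
have gh2 : growth (p - 1) h2 by apply: growth_if => //; exact: growth_cst.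
have h10 e : 0 <= h1 e by rewrite /h1; case: ifP.
have h20 e : 0 <= h2 e by rewrite /h2; case: ifP.
have h1i : free_of i h1 by move=> e x; rewrite /h1 hi fi Mi.
have h2i : free_of i h2 by move=> e x; rewrite /h2 hi fi Mi.
have E1 : expect (fun e => h e * \big[Num.max/0]_(u <- t :: l) `|f u e|) =
    expect (fun e => h1 e * `|f t e|) + expect (fun e => h2 e * M e).
  rewrite -expectD; [|by apply: growth_mul1 => //; exact: growth_abs|exact: growth_mul1].
  congr expect; apply/funext => e; rewrite big_cons /h1 /h2 -/(M e).
  by case: leP => H; rewrite ?mul0r ?addr0 ?add0r// -?(max_idPl H)//.
rewrite E1.
apply: le_trans (lerD (expect_norm_submartingale (c t) gh1 (gf t) h10 h1i (fi t))
  (IHl h2 gh2 h20 h2i)) _.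
rewrite -expectD; [|by apply: growth_mul1 => //; exact: growth_abs|exact: growth_mul1].
apply: expect_le.
- by apply: growthD; apply: growth_mul1 => //; exact: growth_abs.
- by apply: growth_mul1 => //; apply: growth_bigmax => // u; exact: growth_abs.
move=> e; rewrite big_cons /h1 /h2 -/(N e).
case: ifP => _; rewrite ?mul0r ?addr0 ?add0r ler_wpM2l// le_max lexx ?orbT//.
Qed.

Lemma expect_family_max_cons a r i h : i \notin r -> growth (p - 1) h ->
  (forall e, 0 <= h e) -> free_of i h ->
  expect (fun e => h e * family_max a r e) <=
  expect (fun e => h e * family_max a (i :: r) e).
Proof.
move=> ir gh h0 hi.
rewrite (_ : (fun e => h e * family_max a (i :: r) e) =
  (fun e => h e * \big[Num.max/0]_(t : T) `|wsum (a t) r e + a t i * tnth e i|)).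
  apply: expect_max_submartingale => // t; first exact: growth_wsum.
  exact: free_wsum.
apply/funext => e; congr (_ * _); rewrite /family_max; apply: eq_bigr => t _.
by rewrite /wsum big_cons addrC.
Qed.

Let growth_pred f : growth 1 f -> growth (p - 1) (fun e => `|f e| `^ (p - 1)).
Proof.
move=> gf; rewrite -[X in growth X]mul1r; apply: growth_powR gf.
by rewrite subr_ge0; apply: le_trans p2; rewrite ler1n.
Qed.

Let growth_pow f : growth 1 f -> growth p (fun e => `|f e| `^ p).
Proof. by move=> gf; rewrite -[X in growth X]mul1r; exact: growth_powR. Qed.

(** Induction on the tails. A new state either leaves the running maximum
   unchanged, and then the current maximum can only grow in mean; or it becomes
   the running maximum, and [powR_pred_mul_le] pays for the increase. *)
Lemma running_max_half a r : uniq r ->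
  expect (fun e => 2^-1 * `|running_max a r e| `^ p) <=
  expect (fun e => `|running_max a r e| `^ (p - 1) * family_max a r e).
Proof.
have gr r' := growth_running_max a r'; have gm r' := growth_family_max a r'.
elim: r => [_|i r IHr /= /andP[ir ur]].
  apply: expect_le; first by apply: growthZ; exact: growth_pow.
    by apply: growth_mul1 => //; exact: growth_pred.
  by move=> e; rewrite /= normr0 !powR0 ?gt_eqF ?subr_gt0 ?(lt_le_trans _ p2) ?ltr1n//
    mulr0 mul0r.
set X := expect _; set Y := expect _.
pose Z1 := expect (fun e => 2^-1 * `|running_max a r e| `^ p).
pose Z2 := expect (fun e => `|running_max a r e| `^ (p - 1) * family_max a (i :: r) e).
have Z12 : Z1 <= Z2.
  apply: le_trans (IHr ur) _; apply: expect_family_max_cons => //.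
    exact: growth_pred.
  by apply: (free_ofP (fun x => `|x| `^ (p - 1))); exact: free_running_max.
suff : X + Z2 <= Z1 + Y by move: Z12; lra.
rewrite /X /Y /Z1 /Z2 -!expectD; last 4 first.
- by apply: growthZ; exact: growth_pow.
- by apply: growth_mul1 => //; exact: (growth_pred (gr (i :: r))).
- by apply: growthZ; exact: (growth_pow (gr (i :: r))).
- by apply: growth_mul1 => //; exact: growth_pred.
apply: expect_le.
- apply: growthD; first by apply: growthZ; exact: (growth_pow (gr (i :: r))).
  by apply: growth_mul1 => //; exact: growth_pred.
- apply: growthD; first by apply: growthZ; exact: growth_pow.
  by apply: growth_mul1 => //; exact: (growth_pred (gr (i :: r))).
move=> e /=.
have r0 := running_max_ge0 a r e; have m0 := family_max_ge0 a (i :: r) e.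
rewrite [in `|running_max a r e|]ger0_norm// [in `|Num.max _ _|]ger0_norm; last first.
  by rewrite le_max m0.
have [mr|/ltW mr] := leP (family_max a (i :: r) e) (running_max a r e); first by [].
have := powR_pred_mul_le p2 r0 mr.
rewrite (powR_pred m0 (lt_le_trans (ltr1n R 2) p2)).
set u := _ `^ _ * _; set v := _ `^ p; set w := _ `^ p; lra.
Qed.

(** Doob's maximal inequality: Young's inequality separates the two factors in
   [running_max_half], and the left-hand side absorbs the running maximum. *)
Lemma running_max_doob a r : uniq r ->
  expect (fun e => `|running_max a r e| `^ p) <=
  4 `^ p * expect (fun e => `|family_max a r e| `^ p).
Proof.
move=> ur; have H := running_max_half a ur.
have gr := growth_running_max a r; have gm := growth_family_max a r.
have g1 := growth_pow gr; have g2 := growth_pow gm.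
have : expect (fun e => `|running_max a r e| `^ (p - 1) * family_max a r e) <=
    expect (fun e => 4^-1 * `|running_max a r e| `^ p
      + 4 `^ (p - 1) * `|family_max a r e| `^ p).
  apply: expect_le.
  - by apply: growth_mul1 => //; exact: growth_pred.
  - by apply: growthD; exact: growthZ.
  - move=> e; rewrite (ger0_norm (family_max_ge0 a r e)).
    by apply: powR_pred_mul_le4 => //; exact: family_max_ge0.
rewrite expectD; [|exact: growthZ|exact: growthZ].
rewrite !expectZ// in H *.
rewrite -(@powR_pred _ p 4)//; last exact: lt_le_trans (ltr1n R 2) p2.
set w := expect (fun e => `|family_max a r e| `^ p).
rewrite -mulrA [4 * w]mulrC mulrA; set zw := _ * w.
move: H; set u := expect _; set v := expect _; lra.
Qed.

(** A coordinate of the design orders the indices; restricting the family to the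
   upper sets of that order multiplies the p-th moment by at most 4 ^ p. *)
Lemma family_max_chain a (c : T -> 'I_n -> bool) r r' : uniq r -> perm_eq r r' ->
  (forall t, exists r1 r2, r' = r1 ++ r2 /\ [seq i <- r' | c t i] = r2) ->
  expect (fun e => `|family_max (fun t i => a t i * (c t i)%:R) r e| `^ p) <=
  4 `^ p * expect (fun e => `|family_max a r e| `^ p).
Proof.
move=> ur rr' tails.
have permE a' e : family_max a' r e = family_max a' r' e.
  by apply: eq_bigr => t _; rewrite /wsum (perm_big _ rr').
under eq_fun do rewrite permE; under [in leRHS]eq_fun do rewrite permE.
have ur' : uniq r' by rewrite -(perm_uniq rr').
apply: le_trans (running_max_doob a ur'); apply: expect_le.
- by apply: growth_pow; exact: growth_family_max.
- by apply: growth_pow; exact: growth_running_max.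
move=> e; rewrite ger0_norm ?family_max_ge0// ger0_norm ?running_max_ge0//.
apply: ler_powR2 => //; first exact: family_max_ge0.
apply: family_max_le => [|t]; first exact: running_max_ge0.
have [r1 [r2 [r'E r2E]]] := tails t.
have -> : wsum (fun i => a t i * (c t i)%:R) r' e = wsum (a t) r2 e.
  rewrite -r2E /wsum big_filter [RHS]big_mkcond; apply: eq_bigr => i _.
  by case: (c t i); rewrite ?mulr1 ?mulr0 ?mul0r.
apply: le_trans (family_max_ge a r2 e t) _.
by rewrite r'E; exact: running_max_tail.
Qed.

End families.

(** ** Moments of sums, and the multi-parameter maximal inequality *)

(** Expansion around the sum without i: the first-order term has mean 0. With N
   the number of summands, N factors 1 + O(1 / N) stay bounded. *)
Lemma expect_wsum_cons (N : R) r i : 1 <= N -> i \notin r ->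
  expect (fun e => `|wsum (fun=> 1) (i :: r) e| `^ p) <=
  (1 + 2 * taylor_cst p / N) * expect (fun e => `|wsum (fun=> 1) r e| `^ p)
  + 3 * taylor_cst p * N `^ (p / 2 - 1) * s `^ p * expect (fun=> 1).
Proof.
move=> N1 ir; set T := taylor_cst p.
have T0 : 0 <= T by apply: le_trans (taylor_cst_ge1 p2).
have N0 : 0 <= N by exact: le_trans N1.
have pm2 : 0 <= p - 2 by rewrite subr_ge0.
pose S := wsum (fun=> 1) r.
have gS : growth 1 S by exact: growth_wsum.
have Si : free_of i S by exact: free_wsum.
have gc := @growth_coord R n i.
have gS2 : growth (p - 2) (fun e => `|S e| `^ (p - 2)).
  by rewrite -[X in growth X]mul1r; exact: growth_powR.
have gS1 : growth (p - 1) (fun e => p * (`|S e| `^ (p - 2) * S e)).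
  apply: growthZ; have := growthM gS2 gS.
  by rewrite (_ : p - 2 + 1 = p - 1)//; ring.
have gSp : growth p (fun e => `|S e| `^ p).
  by rewrite -[X in growth X]mul1r; exact: growth_powR.
have gep : growth p (fun e => `|tnth e i| `^ p).
  by rewrite -[X in growth X]mul1r; exact: growth_powR.
have g1 : growth p (fun e => p * (`|S e| `^ (p - 2) * S e) * tnth e i) by exact: growth_mul1.
have g2 : growth p (fun e => `|S e| `^ (p - 2) * tnth e i ^+ 2).
  have := growthM gS2 (growthM gc gc).
  by rewrite (_ : p - 2 + _ = p)//; ring.
have c1 : growth p (fun _ : n.-tuple R => 1 : R) by exact: growth_cst.
have SpE : expect (fun e => `|tnth e i| `^ p) <= s `^ p * expect (fun=> 1).
  have := @expect_moment i (fun=> 1) (growth_cst _ (lexx 0)) (fun _ _ => erefl) (fun=> ler01).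
  by under eq_fun do rewrite mul1r.
have S2E : expect (fun e => `|S e| `^ (p - 2) * tnth e i ^+ 2) <=
    2 * (N^-1 * expect (fun e => `|S e| `^ p) + N `^ (p / 2 - 1) * s `^ p * expect (fun=> 1)).
  have H := @expect_variance i (fun e => `|S e| `^ (p - 2)) gS2
    (free_ofP (fun x => `|x| `^ (p - 2)) Si) (fun e => powR_ge0 _ _).
  apply: le_trans H _; rewrite -mulrA ler_wpM2l//.
  rewrite -expectZ; last by apply: growth_le gS2; rewrite gerBl.
  rewrite -expectZ// -expectZ// -expectD; [|exact: growthZ|exact: growthZ].
  apply: expect_le.
  - by apply: growthZ; apply: growth_le gS2; rewrite gerBl.
  - by apply: growthD; exact: growthZ.
  - move=> e; rewrite mulr1 mulrC [N^-1 * _]mulrC.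
    exact: powR_variance_le.
have E1 : expect (fun e => `|wsum (fun=> 1) (i :: r) e| `^ p) <=
    expect (fun e => `|S e| `^ p + p * (`|S e| `^ (p - 2) * S e) * tnth e i
      + T * (`|S e| `^ (p - 2) * tnth e i ^+ 2 + `|tnth e i| `^ p)).
  apply: expect_le.
  - by rewrite -[X in growth X]mul1r; apply: growth_powR => //; exact: growth_wsum.
  - by apply: growthD; [exact: growthD|apply: growthZ; exact: growthD].
  - move=> e; rewrite /wsum big_cons -/(wsum _ r e) mul1r addrC.
    exact: powR_normD_le.
rewrite expectD in E1; [|exact: growthD|by apply: growthZ; exact: growthD].
rewrite expectD// expectZ in E1; last exact: growthD.
rewrite expectD// expect_mean// in E1; last first.
  by apply: (free_ofP (fun x => p * (`|x| `^ (p - 2) * x))).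
apply: le_trans E1 _; rewrite addr0.
have NP : 1 <= N `^ (p / 2 - 1).
  apply: le_trans (ler_powR N1 (_ : 0 <= _)); first by rewrite powRr0.
  by rewrite subr_ge0 ler_pdivlMr// mul1r.
have E0 : 0 <= expect (fun=> 1) by exact: expect_ge0.
set U := expect (fun=> 1) in S2E SpE E0 *.
set Z := expect (fun e => `|tnth e i| `^ p) in SpE *.
set Y := expect (fun e => `|S e| `^ (p - 2) * tnth e i ^+ 2) in S2E *.
rewrite -/S; set X := expect (fun e => `|S e| `^ p) in S2E *.
have sU : 0 <= s `^ p * U by rewrite mulr_ge0// powR_ge0.
have H3 : s `^ p * U <= N `^ (p / 2 - 1) * s `^ p * U by rewrite -mulrA ler_peMl.
have : T * (Y + Z) <= T * (2 * (N^-1 * X + N `^ (p / 2 - 1) * s `^ p * U)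
    + N `^ (p / 2 - 1) * s `^ p * U).
  by rewrite ler_wpM2l// lerD//; exact: le_trans SpE H3.
set V := N `^ (p / 2 - 1) * s `^ p * U => H.
rewrite -lerBrDl; apply: le_trans H _; rewrite /V le_eqVlt; apply/orP; left; apply/eqP; ring.
Qed.

Definition sum_moment_cst := 3 * taylor_cst p * expR (2 * taylor_cst p).

Lemma expect_wsum_le r : uniq r ->
  expect (fun e => `|wsum (fun=> 1) r e| `^ p) <=
  sum_moment_cst * (size r)%:R `^ (p / 2) * s `^ p * expect (fun=> 1).
Proof.
move=> ur; have E0 : 0 <= expect (fun=> 1) by exact: expect_ge0.
have T1 := taylor_cst_ge1 p2.
have T0 : 0 <= taylor_cst p by exact: le_trans T1.
have [r0|r0] := eqVneq r [::].
  rewrite r0 (_ : (fun _ => _) = (fun=> 0 * 1)); last first.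
    by apply/funext => e; rewrite /wsum big_nil normr0 powR0 ?gt_eqF// mul0r.
  rewrite expectZ ?mul0r; last exact: growth_cst.
  by rewrite !mulr_ge0 ?powR_ge0 ?expR_ge0.
pose N : R := (size r)%:R.
have N1 : 1 <= N by rewrite ler1n lt0n size_eq0.
have N0 : 0 < N by exact: lt_le_trans N1.
pose A := 1 + 2 * taylor_cst p / N.
have A1 : 1 <= A by rewrite lerDl mulr_ge0 ?invr_ge0 ?mulr_ge0// ltW.
pose B := 3 * taylor_cst p * N `^ (p / 2 - 1) * s `^ p * expect (fun=> 1).
have B0 : 0 <= B by rewrite !mulr_ge0 ?powR_ge0.
suff H r' : uniq r' ->
    expect (fun e => `|wsum (fun=> 1) r' e| `^ p) <= (size r')%:R * B * A ^+ size r'.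
  apply: le_trans (H r ur) _.
  have AN : A ^+ size r <= expR (2 * taylor_cst p).
    rewrite (_ : 2 * taylor_cst p = (2 * taylor_cst p / N) *+ size r); last first.
      by rewrite -[RHS]mulr_natr -/N divfK// gt_eqF.
    rewrite -[X in expR X]mulr_natl expRM_natl.
    rewrite ler_pXn2r ?nnegrE ?expR_ge0 ?lt0n ?size_eq0//; last exact: le_trans A1.
    exact: expR_ge1Dx.
  rewrite -/N /sum_moment_cst.
  apply: (@le_trans _ _ (N * B * expR (2 * taylor_cst p))).
    by rewrite ler_wpM2l// mulr_ge0// ltW.
  rewrite /B (_ : N `^ (p / 2) = N `^ (p / 2 - 1) * N).
    by rewrite le_eqVlt; apply/orP; left; apply/eqP; ring.
  by rewrite -[X in _ = _ * X]powRr1 ?(ltW N0)// -powRD_pos// subrK.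
elim: r' => [_|i r' IH /= /andP[ir ur']].
  rewrite (_ : (fun _ => _) = (fun=> 0 * 1)).
    by rewrite expectZ ?mul0r//; exact: growth_cst.
  by apply/funext => e; rewrite /wsum big_nil normr0 powR0 ?gt_eqF// mul0r.
apply: le_trans (expect_wsum_cons N1 ir) _; rewrite -/B -/A.
have A0 : 0 <= A by exact: le_trans A1.
apply: le_trans (lerD (ler_wpM2l A0 (IH ur')) (lexx B)) _.
have W1 : 1 <= A ^+ (size r').+1 by exact: exprn_ege1.
rewrite exprS in W1 *; rewrite -natr1.
set k := (size r')%:R; set W := A ^+ _ in W1 *.
have -> : A * (k * B * W) + B = k * B * (A * W) + B by ring.
have -> : (k + 1) * B * (A * W) = k * B * (A * W) + B * (A * W) by ring.
by rewrite lerD2l ler_peMr.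
Qed.

Lemma sorted_filter_ge (K : 'I_n -> R) (t : R) (r : seq 'I_n) :
  sorted (fun i j => K i <= K j) r ->
  exists r1 r2, r = r1 ++ r2 /\ [seq i <- r | t <= K i] = r2.
Proof.
elim: r => [|i r IH] /= ir; first by exists [::], [::].
have tr : transitive (fun i j => K i <= K j) by move=> a b c; exact: le_trans.
case: ifP => ti.
  exists [::], (i :: r); split=> //; congr (_ :: _).
  apply/all_filterP; apply: sub_all (order_path_min tr ir) => j.
  exact: le_trans ti.
have [r1 [r2 [rE fE]]] := IH (path_sorted ir).
by exists (i :: r1), r2; rewrite {1}rE.
Qed.

(** Cairoli's multi-parameter maximal inequality: the points z, one by one in each
   coordinate, order the noise variables; the maximum runs over all orthants
   whose corner has its coordinates among those of the points. *)
Lemma orthant_max d (z : 'I_n -> 'I_d -> R) (r : seq 'I_n) : uniq r ->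
  expect (fun e => `|family_max (fun (m : {ffun 'I_d -> 'I_n}) i =>
     \prod_(j < d) (z (m j) j <= z i j)%R%:R) r e| `^ p)
  <= (4 `^ p) ^+ d * (sum_moment_cst * (size r)%:R `^ (p / 2) * s `^ p * expect (fun=> 1)).
Proof.
move=> ur.
pose a (l : seq 'I_d) (m : {ffun 'I_d -> 'I_n}) i : R :=
  \prod_(j <- l) (z (m j) j <= z i j)%R%:R.
have H (l : seq 'I_d) : expect (fun e => `|family_max (a l) r e| `^ p) <=
    (4 `^ p) ^+ size l * expect (fun e => `|wsum (fun=> 1) r e| `^ p).
  elim: l => [|j l IH].
    rewrite expr0 mul1r; apply: expect_le.
    - rewrite -[X in growth X]mul1r; apply: growth_powR => //.
      exact: growth_family_max.
    - by rewrite -[X in growth X]mul1r; apply: growth_powR => //; exact: growth_wsum.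
    - move=> e; apply: ler_powR2 => //; rewrite ger0_norm ?family_max_ge0//.
      apply: family_max_le => // m; rewrite le_eqVlt; apply/orP; left; apply/eqP.
      by congr `|_|; apply: eq_bigr => i _; rewrite /a big_nil.
  rewrite /= exprS -mulrA.
  apply: le_trans (ler_wpM2l (powR_ge0 _ _) IH).
  pose r' := sort (fun i k => z i j <= z k j) r.
  have E : a (j :: l) = (fun m i => a l m i * (z (m j) j <= z i j)%R%:R).
    by apply/funext => m; apply/funext => i; rewrite /a big_cons mulrC.
  rewrite E; apply: (@family_max_chain _ (a l) _ r r') => //.
    by rewrite perm_sym perm_sort.
  move=> m; apply: (sorted_filter_ge (K := fun i => z i j)).
  by apply: sort_sorted => i k; exact: le_total.
have aE : (fun (m : {ffun 'I_d -> 'I_n}) i =>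
    \prod_(j < d) (z (m j) j <= z i j)%R%:R : R) = a (enum 'I_d).
  by apply/funext => m; apply/funext => i; rewrite /a big_enum.
rewrite aE; apply: le_trans (H _) _; rewrite size_enum_ord ler_wpM2l ?exprn_ge0 ?powR_ge0//.
exact: expect_wsum_le.
Qed.

End maximal.

(** * Counting independent points *)

Section counting.
Context {R : realType} {disp : measure_display} {Omega : measurableType disp}.
Variables (P : probability Omega R) (n : nat) (E : 'I_n -> set Omega).

Definition independent_events : Prop :=
  (forall i, measurable (E i)) /\
  forall J : {set 'I_n},
    P (\bigcap_(i in [set: 'I_n]) (if i \in J then E i else setT)) =
    (\prod_(i < n) P (if i \in J then E i else setT))%E.

Definition occurrences (w : Omega) : nat := \sum_(i < n) (w \in E i).

Hypothesis indep : independent_events.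

Let mE i : measurable (E i). Proof. exact: indep.1. Qed.

Lemma measurable_occurrences (g : nat -> R) :
  measurable_fun setT (fun w => g (occurrences w)).
Proof.
have m0 : measurable_fun setT (fun w => (occurrences w)%:R : R).
  rewrite (_ : (fun _ => _) = (fun w => \sum_(i < n) \1_(E i) w)); last first.
    by apply/funext => w; rewrite /occurrences natr_sum.
  by apply: measurable_sum => i; exact: measurable_indic.
rewrite (_ : (fun _ => _) = (fun x : R => g (Num.truncn x)) \o
    (fun w => (occurrences w)%:R)); last first.
  by apply/funext => w /=; rewrite natrK.
move=> _ Y mY; rewrite setTI comp_preimage.
rewrite (_ : (fun w => (occurrences w)%:R) @^-1` _ =
   \bigcup_(k in [set k | g k \in Y]) ((fun w => (occurrences w)%:R : R) @^-1` [set k%:R])).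
  apply: bigcup_measurable => k _; rewrite -[X in measurable X]setTI; exact: m0.
apply/seteqP; split => w /=.
  by rewrite natrK => H; exists (occurrences w) => //=; rewrite inE.
by move=> [k /= /[!inE] Yk ->]; rewrite natrK.
Qed.

(** The power is the product of the factors 1 + (c - 1) 1_(E i); expanding it makes
   every term an intersection of some of the events. *)
Lemma exp_occurrences (c : R) w : c ^+ occurrences w =
  \sum_(J in {set 'I_n}) (\prod_(i < n) (if i \in J then c - 1 else 1))
    * \1_(\bigcap_(i in [set: 'I_n]) (if i \in J then E i else setT)) w.
Proof.
rewrite /occurrences expr_sum.
transitivity (\prod_(i < n) ((c - 1) * \1_(E i) w + 1)).
  apply: eq_bigr => i _; rewrite indicE; case: (w \in E i).
    by rewrite expr1 mulr1 subrK.
  by rewrite expr0 mulr0 add0r.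
rewrite bigA_distr; apply: eq_bigr => J _.
have -> : \1_(\bigcap_(i in [set: 'I_n]) (if i \in J then E i else setT)) w =
    \prod_(i < n) \1_(if i \in J then E i else setT) w :> R.
  rewrite indicE; case: (boolP (w \in _)) => [/[!inE] H|].
    by rewrite big1// => i _; rewrite indicE mem_set//; exact: H.
  rewrite notin_setE => H; symmetry.
  have [i Hi] : exists i, ~ (if i \in J then E i else setT) w.
    by apply/existsNP => K; apply: H => i _; exact: K.
  by rewrite (bigD1 i)//= indicE memNset// mul0r.
rewrite -big_split /=; apply: eq_bigr => i _.
by case: (i \in J) => //; rewrite mul1r indicE in_setT.
Qed.

Lemma integral_exp_occurrences (c : R) :
  (\int[P]_w (c ^+ occurrences w)%:E =
   (\prod_(i < n) (1 + (c - 1) * fine (P (E i))))%:E)%E.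
Proof.
have mI (J : {set 'I_n}) : measurable
    (\bigcap_(i in [set: 'I_n]) (if i \in J then E i else setT)).
  by apply: fin_bigcap_measurable => // i _; case: ifP.
have iI (J : {set 'I_n}) : P.-integrable setT (EFin \o
    \1_(\bigcap_(i in [set: 'I_n]) (if i \in J then E i else setT))).
  exact: integrable_indic.
under eq_integral => w _ do rewrite exp_occurrences -sumEFin.
rewrite integral_sum//; last first.
  by move=> J; exact: (integrableZl measurableT (\prod_(i < n) (if i \in J then c - 1 else 1)) (iI J)).
transitivity (\sum_(J in {set 'I_n}) ((\prod_(i < n) (if i \in J then c - 1 else 1))
    * \prod_(i < n) (if i \in J then fine (P (E i)) else 1))%:E)%E.
  apply: eq_bigr => J _.
  apply: (etrans (integralZl measurableT (iI J) _)); rewrite EFinM; congr (_ * _)%E.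
  rewrite integral_indic// setIT; apply: (etrans (indep.2 J)).
  rewrite -prodEFin; apply: eq_bigr => i _; case: (i \in J); last exact: probability_setT.
  by rewrite fineK// fin_num_measure.
rewrite sumEFin; congr _%:E.
under [RHS]eq_bigr do rewrite addrC.
rewrite bigA_distr; apply: eq_bigr => J _; rewrite -big_split /=.
by apply: eq_bigr => i _; case: (i \in J); rewrite ?mulr1.
Qed.

Lemma integral_exp_occurrences_le (c a : R) : 0 <= c ->
  (forall i, (c - 1) * fine (P (E i)) <= a) ->
  (\int[P]_w (c ^+ occurrences w)%:E <= (expR (n%:R * a))%:E)%E.
Proof.
move=> c0 Ha; rewrite integral_exp_occurrences lee_fin.
have -> : expR (n%:R * a) = \prod_(i < n) expR a.
  by rewrite prodr_const card_ord expRM_natl.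
apply: ler_prod => i _; apply/andP; split.
  have p0 : 0 <= fine (P (E i)) by apply: fine_ge0.
  have p1 : fine (P (E i)) <= 1.
    by rewrite -lee_fin fineK ?fin_num_measure// probability_le1.
  nra.
apply: le_trans (expR_ge1Dx _).
by rewrite lerD2l.
Qed.

End counting.

Section ratio_moments.
Context {R : realType}.
Implicit Types (p x y rho s lam : R).

Lemma powRV x p : 0 <= x -> x^-1 `^ p = (x `^ p)^-1.
Proof. by move=> x0; rewrite -powR_inv1// -powRrM mulN1r powRN. Qed.

Lemma powR_le_expR p x : 0 < p -> 0 <= x -> x `^ p <= p `^ p * expR x.
Proof.
move=> p0 x0; have -> : expR x = (expR (x / p)) `^ p by rewrite -expRM divfK// gt_eqF.
rewrite -powRM ?(ltW p0) ?expR_ge0//; apply: ler_powR2 => //; first exact: ltW.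
have := expR_ge1Dx (x / p); rewrite -(ler_pM2l p0) => H.
by apply: le_trans H; rewrite mulrDr mulrCA divff ?gt_eqF// !mulr1 lerDr ltW.
Qed.

(** An average over about s points has a p-th moment of order s^(-p/2). When s is
   small the moment is of order 1 at most, and the exponent 1/2 is one for which
   the rate stays integrable at 0. *)
Definition rate p s : R := Num.min (s `^ (- 2^-1)) (s `^ (- (p / 2))).

Lemma rate_ge0 p s : 0 <= rate p s.
Proof. by rewrite le_min !powR_ge0. Qed.

Lemma rate_scale p s y : 1 <= p -> 0 < s -> 1 <= y ->
  rate p (s * y) <= rate p s * y `^ (- 2^-1).
Proof.
move=> p1 s0 y1; have y0 : 0 < y by exact: lt_le_trans y1.
rewrite /rate !powRM ?(ltW s0) ?(ltW y0)//.
have H : s `^ (- (p / 2)) * y `^ (- (p / 2)) <= s `^ (- (p / 2)) * y `^ (- 2^-1).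
  by rewrite ler_wpM2l ?powR_ge0// ler_powR// lerN2; lra.
by case: (leP (s `^ (- 2^-1)) (s `^ (- (p / 2)))) => _; rewrite ge_min ?lexx ?H ?orbT.
Qed.

(** Averages over boxes: nin and nout are the numbers of points of the inner and of
   the outer box of a shell. *)
Definition box_ratio p (nin nout : nat) : R :=
  nout%:R `^ (p / 2) / (Num.max 1 nin%:R) `^ p.

Lemma box_ratio_ge0 p nin nout : 0 <= box_ratio p nin nout.
Proof. by rewrite divr_ge0 ?powR_ge0. Qed.

Lemma box_ratio_small p nin nout : 0 < p ->
  box_ratio p nin nout <= 2 `^ (p / 2) * ((p / 2) `^ (p / 2)) * expR 2^-1 ^+ nout.
Proof.
move=> p0; rewrite /box_ratio.
apply: (@le_trans _ _ (nout%:R `^ (p / 2))).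
  rewrite ler_pdivrMr ?powR_gt0 ?lt_max ?ltr01// ler_peMr ?powR_ge0//.
  apply: (@le_trans _ _ (1 `^ p)); first by rewrite powR1.
  by apply: ler_powR2; rewrite ?(ltW p0)// le_max lexx.
have -> : nout%:R = 2 * (nout%:R / 2) :> R by field.
rewrite [leLHS]powRM ?divr_ge0// -mulrA ler_wpM2l ?powR_ge0//.
have -> : expR 2^-1 ^+ nout = expR (nout%:R / 2) :> R by rewrite -expRM_natl.
by apply: powR_le_expR; rewrite ?divr_ge0// divr_gt0.
Qed.

(** Young's inequality separates the two counts. The outer one is compared with an
   exponential; the inner one is either at least delta * lam, or in its lower
   tail. *)
Lemma box_ratio_large p nin nout lam delta : 2 <= p -> 1 <= lam -> 0 < delta ->
  box_ratio p nin nout <= lam `^ (- (p / 2)) *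
   ((2 * p) `^ p * expR (2 * lam)^-1 ^+ nout
    + (delta `^ (- (2 * p)) + lam `^ (2 * p) * expR (delta * lam) * expR (-1) ^+ nin)).
Proof.
move=> p2 l1 d0; have l0 : 0 < lam by exact: lt_le_trans l1.
have p0 : 0 < p by exact: lt_le_trans p2.
have m0 : 0 < Num.max 1 (nin%:R : R) by rewrite lt_max ltr01.
pose A := (nout%:R / lam) `^ (p / 2); pose B := (lam / Num.max 1 nin%:R) `^ p.
have -> : box_ratio p nin nout = lam `^ (- (p / 2)) * (A * B).
  rewrite /box_ratio /A /B !powRM ?invr_ge0 ?(ltW l0) ?(ltW m0)//.
  rewrite !powRV ?(ltW l0) ?(ltW m0)//.
  have e1 : lam `^ p = lam `^ (p / 2) * lam `^ (p / 2).
    by rewrite -powRD_pos//; congr (_ `^ _); field.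
  rewrite powRN e1; field.
  by rewrite !gt_eqF ?powR_gt0.
rewrite ler_wpM2l ?powR_ge0//.
apply: (@le_trans _ _ (A ^+ 2 + B ^+ 2)).
  have := sqr_ge0 (A - B); have := powR_ge0 (nout%:R / lam) (p / 2).
  have := powR_ge0 (lam / Num.max 1 nin%:R) p; rewrite -/A -/B; nra.
apply: lerD.
  have -> : A ^+ 2 = (nout%:R / lam) `^ p.
    by rewrite -powR_mulrn ?powR_ge0// -powRrM; congr (_ `^ _); field.
  have -> : nout%:R / lam = 2 * (nout%:R / (2 * lam)).
    by field; rewrite gt_eqF.
  have h0 : 0 <= nout%:R / (2 * lam) by rewrite divr_ge0 ?mulr_ge0 ?(ltW l0).
  rewrite [leLHS]powRM// [(2 * p) `^ p]powRM ?(ltW p0)// -mulrA ler_wpM2l ?powR_ge0//.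
  by rewrite -expRM_natl; exact: powR_le_expR.
have -> : B ^+ 2 = (lam / Num.max 1 nin%:R) `^ (2 * p).
  by rewrite -powR_mulrn ?powR_ge0// -powRrM; congr (_ `^ _); ring.
have p20 : 0 <= 2 * p by rewrite mulr_ge0// ltW.
have B0 : 0 <= lam / Num.max 1 nin%:R by rewrite divr_ge0 ?(ltW l0) ?(ltW m0).
have [h|h] := leP (delta * lam) (Num.max 1 nin%:R).
  apply: (@le_trans _ _ (delta `^ (- (2 * p)))); last first.
    by rewrite lerDl !mulr_ge0 ?powR_ge0 ?expR_ge0 ?exprn_ge0 ?expR_ge0.
  rewrite powRN -powRV ?(ltW d0)//; apply: ler_powR2 => //.
  by rewrite ler_pdivrMr// mulrC ler_pdivlMr// mulrC.
apply: (@le_trans _ _ (lam `^ (2 * p) * expR (delta * lam) * expR (-1) ^+ nin)); last first.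
  by rewrite lerDr powR_ge0.
rewrite -mulrA (@le_trans _ _ (lam `^ (2 * p)))//.
  apply: ler_powR2 => //; rewrite ler_pdivrMr// ler_peMr ?(ltW l0)//.
  by rewrite le_max lexx.
rewrite ler_peMr ?powR_ge0// -expRM_natl -expRD mulrN1.
rewrite -[leLHS]expR0 ler_expR subr_ge0 (le_trans _ (ltW h))//.
by rewrite le_max lexx orbT.
Qed.

End ratio_moments.

Section probability_integrals.
Context {R : realType} {disp : measure_display} {Omega : measurableType disp}.
Variable P : probability Omega R.

Lemma integral_probability_cst (c : R) : (\int[P]_w c%:E = c%:E)%E.
Proof.
apply: (etrans (integral_cst P measurableT c%:E)).
by rewrite -[RHS]mule1; congr (_ * _)%E; exact: probability_setT.
Qed.

Lemma integral_scale_le (c F : R) (f : Omega -> R) : 0 <= c ->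
  measurable_fun setT f -> (forall w, 0 <= f w) -> (\int[P]_w (f w)%:E <= F%:E)%E ->
  (\int[P]_w (c * f w)%:E <= (c * F)%:E)%E.
Proof.
move=> c0 mf f0 fF; under eq_integral do rewrite EFinM.
rewrite ge0_integralZl//; [|exact/measurable_EFinP|by move=> w _; rewrite lee_fin].
by rewrite EFinM lee_wpmul2l// lee_fin.
Qed.

Lemma integral_add_le (F G : R) (f g : Omega -> R) :
  measurable_fun setT f -> (forall w, 0 <= f w) -> (\int[P]_w (f w)%:E <= F%:E)%E ->
  measurable_fun setT g -> (forall w, 0 <= g w) -> (\int[P]_w (g w)%:E <= G%:E)%E ->
  (\int[P]_w (f w + g w)%:E <= (F + G)%:E)%E.
Proof.
move=> mf f0 fF mg g0 gG; under eq_integral do rewrite EFinD.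
rewrite ge0_integralD//; [|by move=> w _; rewrite lee_fin|exact/measurable_EFinP
  |by move=> w _; rewrite lee_fin|exact/measurable_EFinP].
by rewrite EFinD leeD.
Qed.

End probability_integrals.

Section box_ratio_moment.
Context {R : realType} {disp : measure_display} {Omega : measurableType disp}.
Variables (P : probability Omega R) (n : nat).
Variables (Ein Eout : 'I_n -> set Omega) (p alpha beta lam : R).
Hypotheses (p2 : 2 <= p) (alpha0 : 0 < alpha) (lam0 : 0 < lam) (n0 : (0 < n)%N).
Hypotheses (indin : independent_events P Ein) (indout : independent_events P Eout).
Hypotheses (Hin : forall i, alpha * (lam / n%:R) <= fine (P (Ein i)))
  (Hout : forall i, fine (P (Eout i)) <= beta * (lam / n%:R)).

Let n_gt0 : 0 < n%:R :> R. Proof. by rewrite ltr0n. Qed.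

Let beta0 : 0 <= beta.
Proof.
have : 0 <= beta * (lam / n%:R) by apply: le_trans (Hout (Ordinal n0)); exact: fine_ge0.
by rewrite pmulr_lge0// divr_gt0.
Qed.

Lemma expRN1_le_half : expR (-1) <= 2^-1 :> R.
Proof.
rewrite expRN lef_pV2 ?posrE ?expR_gt0//.
by apply: le_trans (expR_ge1Dx 1).
Qed.

(** Chernoff's bounds for the numbers of points in the two boxes. *)
Lemma occurrences_lower_tail :
  (\int[P]_w (expR (-1) ^+ occurrences Ein w)%:E <= (expR (- (alpha * lam / 2)))%:E)%E.
Proof.
apply: le_trans (integral_exp_occurrences_le indin (expR_ge0 _)
  (a := - (alpha * lam / (2 * n%:R))) _) _; last first.
  rewrite lee_fin ler_expR le_eqVlt; apply/orP; left; apply/eqP; field.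
  by rewrite gt_eqF.
move=> i; have H := Hin i; have := expRN1_le_half.
have : 0 <= fine (P (Ein i)) by exact: fine_ge0.
rewrite (_ : alpha * lam / (2 * n%:R) = 2^-1 * (alpha * (lam / n%:R))); last first.
  by field; rewrite gt_eqF.
set x := alpha * _ in H *; set y := fine _ in H *; set e := expR _; nra.
Qed.

Lemma occurrences_upper_tail x : 0 <= x -> x <= 2^-1 ->
  (\int[P]_w (expR x ^+ occurrences Eout w)%:E <= (expR (2 * x * beta * lam))%:E)%E.
Proof.
move=> x0 x1.
apply: le_trans (integral_exp_occurrences_le indout (expR_ge0 _)
  (a := 2 * x * (beta * (lam / n%:R))) _) _; last first.
  rewrite lee_fin ler_expR le_eqVlt; apply/orP; left; apply/eqP; field.
  by rewrite gt_eqF.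
move=> i; have H := Hout i.
have h0 : 0 <= fine (P (Eout i)) by exact: fine_ge0.
have e1 : expR x - 1 <= 2 * x.
  have := @expR_le2 R x; rewrite ger0_norm// => /(_ x1); nra.
apply: (@le_trans _ _ (2 * x * fine (P (Eout i)))).
  exact: ler_wpM2r.
by rewrite ler_wpM2l// mulr_ge0.
Qed.

Definition ratio_cst : R :=
  Num.max (2 `^ (p / 2) * ((p / 2) `^ (p / 2)) * expR beta)
    ((2 * p) `^ p * expR beta + ((alpha / 4) `^ (- (2 * p))
      + (2 * p) `^ (2 * p) * (4 / alpha) `^ (2 * p))).

Lemma ratio_cst_ge0 : 0 <= ratio_cst.
Proof. by rewrite le_max !mulr_ge0 ?powR_ge0 ?expR_ge0. Qed.

(** For lam <= 1 the exponential moments of the outer count are bounded, which is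
   enough; for larger lam both counts concentrate at the order of lam. *)
Lemma box_ratio_moment :
  (\int[P]_w (box_ratio p (occurrences Ein w) (occurrences Eout w))%:E
    <= (ratio_cst * rate p lam)%:E)%E.
Proof.
have p0 : 0 < p by exact: lt_le_trans p2.
have m (e : R) (F : 'I_n -> set Omega) : independent_events P F ->
    measurable_fun setT (fun w => e ^+ occurrences F w).
  by move=> indF; exact: (measurable_occurrences indF).
have [l1|/ltW l1] := leP 1 lam; last first.
  have r1 : 1 <= rate p lam.
    have H (r : R) : 0 <= r -> 1 <= lam `^ (- r).
      move=> r0; rewrite powRN invf_ge1 ?powR_gt0//.
      apply: (@le_trans _ _ (1 `^ r)); last by rewrite powR1.
      by apply: ler_powR2 => //; exact: ltW.
    by rewrite le_min !H// divr_ge0// ltW.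
  apply: (@le_trans _ _ ratio_cst%:E); last first.
    by rewrite lee_fin ler_peMr// ratio_cst_ge0.
  set c := 2 `^ (p / 2) * (p / 2) `^ (p / 2).
  have c0 : 0 <= c by rewrite mulr_ge0// powR_ge0.
  apply: (@le_trans _ _ (\int[P]_w (c * expR 2^-1 ^+ occurrences Eout w)%:E)%E).
    apply: ge0_le_integral_nomeas => w _; rewrite lee_fin ?box_ratio_ge0//.
    exact: box_ratio_small.
  apply: (@le_trans _ _ (c * expR beta)%:E); last by rewrite lee_fin le_max lexx.
  apply: integral_scale_le => //; first exact: m.
  apply: le_trans (occurrences_upper_tail _ _) _ => //.
  by rewrite lee_fin ler_expR divff// mul1r ler_piMr.
have -> : rate p lam = lam `^ (- (p / 2)).
  by apply/min_idPr; rewrite ler_powR// lerN2; have := p2; lra.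
have d0 : 0 < alpha / 4 by rewrite divr_gt0.
set a := (alpha / 4) `^ (- (2 * p)); set c := lam `^ (2 * p) * expR (alpha / 4 * lam).
have c0 : 0 <= c by rewrite mulr_ge0 ?powR_ge0 ?expR_ge0.
apply: (@le_trans _ _ (\int[P]_w (lam `^ (- (p / 2)) *
   ((2 * p) `^ p * expR (2 * lam)^-1 ^+ occurrences Eout w
    + (a + c * expR (-1) ^+ occurrences Ein w)))%:E)%E).
  apply: ge0_le_integral_nomeas => w _; rewrite lee_fin ?box_ratio_ge0//.
  exact: box_ratio_large.
have e0 (e : R) (k : nat) : 0 <= expR e ^+ k by rewrite exprn_ge0// expR_ge0.
have x1 : (2 * lam)^-1 <= 2^-1 by rewrite lef_pV2 ?posrE ?mulr_gt0// ler_peMr.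
have x0 : 0 <= (2 * lam)^-1 by rewrite invr_ge0 mulr_ge0// ltW.
have mA : measurable_fun setT (fun w => (2 * p) `^ p * expR (2 * lam)^-1 ^+ occurrences Eout w).
  by apply: measurable_funM => //; exact: m.
have mB : measurable_fun setT (fun w => c * expR (-1) ^+ occurrences Ein w).
  by apply: measurable_funM => //; exact: m.
have a0 : 0 <= a by exact: powR_ge0.
rewrite [X in (_ <= X)%E](_ : _ = (lam `^ (- (p / 2)) * ratio_cst)%:E); last first.
  by rewrite mulrC.
apply: integral_scale_le; first exact: powR_ge0.
- by apply: measurable_funD => //; exact: measurable_funD.
- by move=> w; rewrite addr_ge0 ?mulr_ge0 ?powR_ge0// addr_ge0// mulr_ge0.
apply: (@le_trans _ _ ((2 * p) `^ p * expR beta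
   + (a + (2 * p) `^ (2 * p) * (4 / alpha) `^ (2 * p)))%:E); last first.
  by rewrite lee_fin le_max lexx orbT.
apply: integral_add_le => //.
- by move=> w; rewrite mulr_ge0// powR_ge0.
- apply: integral_scale_le => //; [exact: powR_ge0|exact: m|].
  apply: le_trans (occurrences_upper_tail x0 x1) _; rewrite lee_fin ler_expR.
  by rewrite le_eqVlt; apply/orP; left; apply/eqP; field; rewrite gt_eqF.
- exact: measurable_funD.
- by move=> w; rewrite addr_ge0// mulr_ge0.
apply: integral_add_le => //; first by rewrite integral_probability_cst.
  by move=> w; rewrite mulr_ge0.
apply: (@le_trans _ _ (c * expR (- (alpha * lam / 2)))%:E).
  apply: integral_scale_le => //; [exact: m|exact: occurrences_lower_tail].
rewrite lee_fin /c -mulrA -expRD.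
have -> : alpha / 4 * lam - alpha * lam / 2 = - (alpha / 4 * lam) by field.
have -> : lam `^ (2 * p) = (4 / alpha) `^ (2 * p) * (alpha / 4 * lam) `^ (2 * p).
  rewrite -powRM ?divr_ge0 ?mulr_ge0 ?(ltW alpha0) ?(ltW lam0) ?(ltW d0)//.
  by congr (_ `^ _); field; rewrite gt_eqF.
rewrite -mulrA [leRHS]mulrC ler_wpM2l ?powR_ge0//.
have q0 : 0 < 2 * p by rewrite mulr_gt0.
have z0 : 0 <= alpha / 4 * lam by rewrite mulr_ge0// ltW.
move: z0; set z := alpha / 4 * lam => z0; have H := powR_le_expR q0 z0.
apply: le_trans (ler_wpM2r (expR_ge0 (- z)) H) _.
by rewrite -mulrA -expRD subrr expR0 mulr1.
Qed.

End box_ratio_moment.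

(** * The noise over all boxes with a common upper corner *)

Section partition_by_pattern.
Context {R : realType} {disp : measure_display} {Omega : measurableType disp}.
Variables (P : probability Omega R) (T : finType) (tau : Omega -> T).
Hypothesis mtau : forall t, measurable (tau @^-1` [set t]).

Lemma measurable_partition (F : T -> Omega -> R) :
  (forall t, measurable_fun setT (F t)) -> measurable_fun setT (fun w => F (tau w) w).
Proof.
move=> mF.
rewrite (_ : (fun _ => _) = (fun w => \sum_(t : T) F t w * \1_(tau @^-1` [set t]) w)).
  by apply: measurable_sum => t; apply: measurable_funM => //; exact: measurable_indic.
apply/funext => w; rewrite (bigD1 (tau w))//= big1 ?addr0.
  by rewrite indicE mem_set// mulr1.
by move=> t tw; rewrite indicE memNset ?mulr0//= => /esym/eqP; exact/negP.
Qed.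

(** Conditioning on a variable with finitely many values. *)
Lemma integral_partition_le (F : T -> Omega -> R) (G : T -> R) :
  (forall t, measurable_fun setT (F t)) -> (forall t w, 0 <= F t w) ->
  (forall t, 0 <= G t) ->
  (forall t, \int[P]_(w in tau @^-1` [set t]) (F t w)%:E <=
     (G t)%:E * P (tau @^-1` [set t]))%E ->
  (\int[P]_w (F (tau w) w)%:E <= \int[P]_w (G (tau w))%:E)%E.
Proof.
move=> mF F0 G0 FG.
have split (H : T -> Omega -> R) : (forall t, measurable_fun setT (H t)) ->
    (forall t w, 0 <= H t w) ->
    (\int[P]_w (H (tau w) w)%:E =
     \sum_(t : T) \int[P]_(w in tau @^-1` [set t]) (H t w)%:E)%E.
  move=> mH H0.
  transitivity (\int[P]_w \sum_(t : T) ((EFin \o H t) \_ (tau @^-1` [set t]) w))%E.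
    apply: eq_integral => w _; rewrite (bigD1 (tau w))//= big1 ?adde0.
      by rewrite patchE mem_set.
    by move=> t tw; rewrite patchE memNset//= => /esym/eqP; exact/negP.
  rewrite ge0_integral_sum//.
  - by apply: eq_bigr => t _; rewrite -integral_mkcond.
  - move=> t; apply/(measurable_restrictT _ (mtau t)); apply: measurable_funTS.
    exact/measurable_EFinP.
  - by move=> t w _; apply: erestrict_ge0 => w' _; rewrite lee_fin.
rewrite (split F)// (split (fun t _ => G t))//; apply: lee_sum => t _; apply: le_trans (FG t) _.
by rewrite (integral_cst P (mtau t) (G t)%:E).
Qed.

End partition_by_pattern.

Section model.
Context {R : realType} {disp : measure_display} {Omega : measurableType disp}.
Context (P : probability Omega R) {d n : nat}.
Variables (X : 'I_n -> Omega -> d.-tuple R) (eps : 'I_n -> {RV P >-> R}).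

Definition points (w : Omega) : n.-tuple (d.-tuple R) := [tuple X i w | i < n].

Definition volume (u v : d.-tuple R) : R := \prod_(j < d) (tnth v j - tnth u j).

(** What the argument needs of the law of the design; it is stable under the
   reflection of the cube, which exchanges upper and lower corners. *)
Definition design_model (rho1 rho2 : R) : Prop :=
  [/\ forall i, measurable_fun setT (X i),
      forall i w, unit_cube (X i w),
      forall u v, unit_cube u -> unit_cube v -> lev u v ->
        independent_events P (fun i => X i @^-1` box u v) &
      forall i u v, unit_cube u -> unit_cube v -> lev u v ->
        rho1 * volume u v <= fine (P (X i @^-1` box u v)) <= rho2 * volume u v].

(** Independent noise on every event of the design; like [design_model], it is
   stable under reflection. *)
Definition noise_model (p sigma : R) : Prop :=
  forall A, measurable A -> exists Q : {measure set (n.-tuple R) -> \bar R},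
    independent_noise p sigma Q /\
    forall g : n.-tuple R -> \bar R, (forall e, 0 <= g e)%E -> measurable_fun setT g ->
      (\int[Q]_e g e = \int[P]_(w in points @^-1` A) g (noise eps w))%E.

End model.

Section boxes.
Context {R : realType} {d : nat}.
Implicit Types u v x : d.-tuple R.

Lemma levP u v : reflect (forall j, tnth u j <= tnth v j) (lev u v).
Proof. exact: forallP. Qed.

Lemma lev_refl u : lev u u.
Proof. by apply/levP. Qed.

Lemma lev_trans v u x : lev u v -> lev v x -> lev u x.
Proof. by move=> /levP a /levP b; apply/levP => j; exact: le_trans (a j) (b j). Qed.

Lemma measurable_box u v : measurable (box u v).
Proof.
rewrite (_ : box u v = \bigcap_(j in [set: 'I_d])
    ((@tnth d R)^~ j @^-1` `[tnth u j, tnth v j])).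
  apply: fin_bigcap_measurable => // j _.
  by rewrite -[X in measurable X]setTI; exact: measurable_tnth.
apply/seteqP; split => x.
  by move=> /andP[/levP h1 /levP h2] j _ /=; rewrite in_itv/= h1 h2.
by move=> h; apply/andP; split; apply/levP => j;
  have := h j I; rewrite /= in_itv/= => /andP[].
Qed.

Lemma unit_cubeP x : unit_cube x <-> forall j, 0 <= tnth x j <= 1.
Proof.
split=> [/andP[/levP h0 /levP h1] j|h].
  by have := h0 j; have := h1 j; rewrite !tnth_mktuple => -> ->.
by apply/andP; split; apply/levP => j; rewrite tnth_mktuple; have /andP[] := h j.
Qed.

End boxes.

Lemma dyadic_scale {R : realType} (t y : R) : 0 < t -> t <= y ->
  exists k : nat, 2 ^+ k * t <= y < 2 ^+ k.+1 * t.
Proof.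
move=> t0 ty.
have ex : exists N : nat, y < 2 ^+ N * t.
  exists (Num.truncn (y / t)).+1; rewrite -ltr_pdivrMr//.
  apply: lt_le_trans (truncnS_gt _) _.
  by rewrite -natrX ler_nat ltnW// ltn_expl.
case: (ex_minnP ex) => -[|N] HN Hmin.
  by move: HN; rewrite expr0 mul1r ltNge ty.
exists N; rewrite HN andbT leNgt; apply/negP => /Hmin.
by rewrite ltnn.
Qed.

Section noise_bound.
Context {R : realType} {disp : measure_display} {Omega : measurableType disp}.
Context (P : probability Omega R) {d n : nat}.
Variables (X : 'I_n -> Omega -> d.-tuple R) (eps : 'I_n -> {RV P >-> R}).
Variables (p sigma rho1 rho2 : R).
Hypotheses (p2 : 2 <= p) (sigma0 : 0 < sigma) (rho10 : 0 < rho1) (n0 : (0 < n)%N).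
Hypotheses (HX : design_model P X rho1 rho2) (Heps : noise_model X eps p sigma).
Variables (x v : d.-tuple R).
Hypotheses (cx : unit_cube x) (cv : unit_cube v) (xv : forall j, tnth x j < tnth v j).
Implicit Types (z : n.-tuple (d.-tuple R)) (i : 'I_n) (j : 'I_d).

(** A shell: the boxes below v whose sides are 2 ^ (k j) to 2 ^ (k j + 1) times those
   of the box from x to v. All of them lie between the inner and the outer box. *)
Section shell.
Variable k : 'I_d -> nat.

Definition inner : d.-tuple R :=
  [tuple tnth v j - 2 ^+ k j * (tnth v j - tnth x j) | j < d].

Definition outer : d.-tuple R :=
  [tuple Num.max 0 (tnth v j - 2 ^+ (k j).+1 * (tnth v j - tnth x j)) | j < d].

Definition in_inner z i := lev inner (tnth z i) && lev (tnth z i) v.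
Definition in_outer z i := lev outer (tnth z i) && lev (tnth z i) v.

Definition orthant z (m : {ffun 'I_d -> 'I_n}) i : R :=
  \prod_(j < d) (tnth (tnth z (m j)) j <= tnth (tnth z i) j)%R%:R.

Definition shell_max z (e : n.-tuple R) : R :=
  family_max (orthant z) [seq i <- enum 'I_n | in_outer z i] e.

(** A shell depends on the design through these finitely many comparisons. On the
   event where they are prescribed, the design can be replaced by a fixed
   representative, and the noise is independent. *)
Definition pattern z : {ffun 'I_n -> bool} * {ffun 'I_n -> bool}
    * {ffun 'I_n * 'I_n * 'I_d -> bool} :=
  ([ffun i => in_inner z i], [ffun i => in_outer z i],
   [ffun t => tnth (tnth z t.1.1) t.2 <= tnth (tnth z t.1.2) t.2]).

Definition shell_ratio z (e : n.-tuple R) : R :=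
  `|shell_max z e| `^ p / Num.max 1 (\sum_(i < n) in_inner z i)%:R `^ p.

Lemma shell_ratio_pattern z z' : pattern z = pattern z' ->
  (shell_ratio z = shell_ratio z') *
  ((\sum_(i < n) in_inner z i) = (\sum_(i < n) in_inner z' i))%N *
  (in_outer z =1 in_outer z').
Proof.
move=> [/ffunP h1 /ffunP h2 /ffunP h3].
have H1 i : in_inner z i = in_inner z' i by have := h1 i; rewrite !ffunE.
have H2 i : in_outer z i = in_outer z' i by have := h2 i; rewrite !ffunE.
have H3 i i' j : (tnth (tnth z i) j <= tnth (tnth z i') j) =
    (tnth (tnth z' i) j <= tnth (tnth z' i') j).
  by have := h3 (i, i', j); rewrite !ffunE.
have E1 : (\sum_(i < n) in_inner z i = \sum_(i < n) in_inner z' i)%N.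
  by apply: eq_bigr => i _; rewrite H1.
split => //; split => //; apply/funext => e; rewrite /shell_ratio E1 /shell_max.
congr (`|_| `^ _ / _); rewrite (eq_filter H2) /family_max; apply: eq_bigr => m _.
congr `|_|; apply: eq_bigr => i _; congr (_ * _); apply: eq_bigr => j _.
by rewrite H3.
Qed.

Lemma measurable_pattern c : measurable (pattern @^-1` [set c]).
Proof.
case: c => -[c1 c2] c3.
have mb (b : bool) (A : set (n.-tuple (d.-tuple R))) : measurable A ->
    measurable [set z | `[< A z >] = b].
  move=> mA; case: b.
    rewrite (_ : [set _ | _] = A)//.
    by apply/seteqP; split=> z /asboolP.
  rewrite (_ : [set _ | _] = ~` A); first exact: measurableC.
  apply/seteqP; split=> z /= Az; first by move=> /asboolP; rewrite Az.
  by apply/negbTE/asboolPn.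
have mlev (u : d.-tuple R) i (b : bool) :
    measurable [set z : n.-tuple (d.-tuple R) | lev u (tnth z i) && lev (tnth z i) v = b].
  have := mb b ((fun z : n.-tuple (d.-tuple R) => tnth z i) @^-1` box u v).
  rewrite (_ : [set z | `[< _ >] = b] = [set z : n.-tuple (d.-tuple R) |
      lev u (tnth z i) && lev (tnth z i) v = b]); last first.
    by apply/seteqP; split=> z /=; rewrite /preimage /box /= asboolb.
  apply; rewrite -[X in measurable X]setTI.
  by apply: measurable_tnth => //; exact: measurable_box.
have mle (t : 'I_n * 'I_n * 'I_d) (b : bool) :
    measurable [set z : n.-tuple (d.-tuple R) |
      (tnth (tnth z t.1.1) t.2 <= tnth (tnth z t.1.2) t.2) = b].
  have mc i : measurable_fun setT (fun z : n.-tuple (d.-tuple R) => tnth (tnth z i) t.2).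
    apply: (measurableT_comp (f := fun u : d.-tuple R => tnth u t.2)).
      exact: measurable_tnth.
    exact: measurable_tnth.
  rewrite -[X in measurable X]setTI.
  exact: (measurable_fun_ler (mc t.1.1) (mc t.1.2) measurableT (Y := [set b])).
rewrite (_ : _ @^-1` _ =
  (\bigcap_(i in [set: 'I_n]) [set z | in_inner z i = c1 i]) `&`
  (\bigcap_(i in [set: 'I_n]) [set z | in_outer z i = c2 i]) `&`
  (\bigcap_(t in [set: 'I_n * 'I_n * 'I_d])
    [set z | (tnth (tnth z t.1.1) t.2 <= tnth (tnth z t.1.2) t.2) = c3 t])).
  apply: measurableI; first apply: measurableI.
  - by apply: fin_bigcap_measurable => // i _; exact: mlev.
  - by apply: fin_bigcap_measurable => // i _; exact: mlev.
  - by apply: fin_bigcap_measurable => // t _; exact: mle.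
apply/seteqP; split => z /=.
  move=> [<- <- <-]; split; first split.
  - by move=> i _ /=; rewrite ffunE.
  - by move=> i _ /=; rewrite ffunE.
  - by move=> t _ /=; rewrite ffunE.
move=> [[h1 h2] h3]; rewrite /pattern; congr (_, _, _); apply/ffunP => t; rewrite ffunE.
- exact: h1.
- exact: h2.
- exact: h3.
Qed.


Let Ein i := X i @^-1` box inner v.
Let Eout i := X i @^-1` box outer v.

Lemma occurrences_inner w :
  occurrences Ein w = (\sum_(i < n) in_inner (points X w) i)%N.
Proof.
apply: eq_bigr => i _; congr nat_of_bool; rewrite /in_inner tnth_mktuple.
by apply/idP/idP => /[!inE].
Qed.

Lemma occurrences_outer w :
  occurrences Eout w = size [seq i <- enum 'I_n | in_outer (points X w) i].
Proof.
rewrite size_filter -sum1_count big_enum_cond big_mkcond /=.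
apply: eq_bigr => i _; rewrite /in_outer tnth_mktuple.
have -> : (w \in Eout i) = lev outer (X i w) && lev (X i w) v.
  by apply/idP/idP => /[!inE].
by case: ifP.
Qed.

Lemma growth_shell_max z : growth 1 (shell_max z).
Proof. exact: growth_family_max. Qed.

Lemma growth_shell_pow z : growth p (fun e => `|shell_max z e| `^ p).
Proof.
rewrite -[X in growth X]mul1r; apply: growth_powR (growth_shell_max z).
exact: le_trans p2.
Qed.

Lemma measurable_shell_ratio z : measurable_fun setT (shell_ratio z).
Proof. by apply: measurable_funM => //; have [] := growth_shell_pow z. Qed.

Lemma shell_ratio_ge0 z e : 0 <= shell_ratio z e.
Proof. by rewrite divr_ge0 ?powR_ge0. Qed.

Lemma measurable_points : measurable_fun setT (points X).
Proof.
have [mX _ _ _] := HX; apply/measurable_fun_tnthP => i /=.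
rewrite (_ : _ \o _ = X i)//.
by apply/funext => w; rewrite /= tnth_mktuple.
Qed.

Definition shell_cst := (4 `^ p) ^+ d * sum_moment_cst p.

Lemma shell_cst_ge0 : 0 <= shell_cst.
Proof.
have := taylor_cst_ge1 p2 => /(le_trans ler01) T0.
by rewrite !mulr_ge0 ?exprn_ge0 ?powR_ge0 ?expR_ge0.
Qed.

Let rep c : n.-tuple (d.-tuple R) := xget [tuple zerov | _ < n] [set z | pattern z = c].

Let repP w : pattern (rep (pattern (points X w))) = pattern (points X w).
Proof. by apply: (@xgetPex _ _ [set z | pattern z = pattern (points X w)]); exists (points X w). Qed.

Let tau w := pattern (points X w).

Let G c := shell_cst * sigma `^ p *
  box_ratio p (\sum_(i < n) in_inner (rep c) i)%N
    (size [seq i <- enum 'I_n | in_outer (rep c) i]).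

Let mtau c : measurable (tau @^-1` [set c]).
Proof.
rewrite -[X in measurable X]setTI.
exact: (measurable_points measurableT (measurable_pattern c)).
Qed.

Lemma shell_pattern_moment c :
  (\int[P]_(w in tau @^-1` [set c]) (shell_ratio (rep c) (noise eps w))%:E <=
   (G c)%:E * P (tau @^-1` [set c]))%E.
Proof.
have [Q [HQ QE]] := Heps (measurable_pattern c).
rewrite -(QE (fun e => (shell_ratio (rep c) e)%:E)); last 2 first.
- by move=> e; rewrite lee_fin shell_ratio_ge0.
- by apply/measurable_EFinP; exact: measurable_shell_ratio.
have PQ : P (tau @^-1` [set c]) = ((expect Q (fun=> 1))%:E)%E.
  rewrite (EFin_expect p2 HQ); last by apply: growth_cst; exact: le_trans p2.
  rewrite (QE (fun=> 1%E))//.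
  by rewrite (integral_cst P (mtau c) 1%E) mul1e.
set N := Num.max 1 (\sum_(i < n) in_inner (rep c) i)%:R `^ p.
have N0 : 0 <= N^-1 by rewrite invr_ge0 powR_ge0.
have gs := growth_shell_pow (rep c).
have gN : growth p (fun e => N^-1 * `|shell_max (rep c) e| `^ p) by exact: growthZ.
have -> : (\int[Q]_e (shell_ratio (rep c) e)%:E =
   (expect Q (fun e => N^-1 * `|shell_max (rep c) e| `^ p))%:E)%E.
  rewrite (EFin_expect p2 HQ)//; apply: eq_integral => e _.
  by rewrite /shell_ratio mulrC.
rewrite PQ -EFinM lee_fin (expectZ p2 HQ)//.
have ur : uniq [seq i <- enum 'I_n | in_outer (rep c) i].
  by rewrite filter_uniq// enum_uniq.
have := orthant_max p2 sigma0 HQ (fun i j => tnth (tnth (rep c) i) j) ur.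
move=> /(ler_wpM2l N0) H; apply: le_trans H _.
rewrite /G /box_ratio -/N le_eqVlt; apply/orP; left; apply/eqP.
by rewrite /shell_cst; ring.
Qed.

(** A side of the outer box is at most twice that of the inner box, also where the
   outer corner is cut at 0. *)
Lemma volume_outer : (forall j, 0 <= tnth inner j) ->
  volume outer v <= 2 ^+ d * volume inner v.
Proof.
move=> i0; rewrite /volume.
have -> : 2 ^+ d = \prod_(j < d) (2 : R) by rewrite prodr_const card_ord.
rewrite -big_split /=; apply: ler_prod => j _.
have := i0 j; rewrite !tnth_mktuple => h0.
have := (unit_cubeP v).1 cv j => /andP[v0 v1].
have y0 : 0 <= 2 ^+ k j * (tnth v j - tnth x j).
  by rewrite mulr_ge0 ?exprn_ge0// subr_ge0 ltW.
rewrite exprS -mulrA; set y := 2 ^+ k j * _ in h0 y0 *.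
by case: (leP 0 (tnth v j - 2 * y)) => h; apply/andP; split; lra.
Qed.

(** One shell: conditionally on the pattern, the multi-parameter maximal inequality
   bounds the maximum by its value on the outer box. *)
Lemma shell_moment : (forall j, 0 <= tnth inner j) ->
  (\int[P]_w (shell_ratio (points X w) (noise eps w))%:E <=
   (shell_cst * sigma `^ p * (ratio_cst p rho1 (rho2 * 2 ^+ d)
      * rate p (n%:R * volume inner v)))%:E)%E.
Proof.
move=> i0; have [mX cX indX bX] := HX.
have c1 : unit_cube inner.
  apply/unit_cubeP => j; rewrite i0 /= tnth_mktuple.
  have := (unit_cubeP v).1 cv j => /andP[v0 v1].
  rewrite lerBlDr (le_trans v1)// lerDl mulr_ge0 ?exprn_ge0// subr_ge0.
  exact: ltW.
have c2 : unit_cube outer.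
  apply/unit_cubeP => j; rewrite tnth_mktuple le_max lexx /= ge_max ler01 /=.
  have := (unit_cubeP v).1 cv j => /andP[v0 v1].
  rewrite lerBlDr (le_trans v1)// lerDl mulr_ge0 ?exprn_ge0// subr_ge0.
  exact: ltW.
have l1 : lev inner v.
  apply/levP => j; rewrite tnth_mktuple gerBl mulr_ge0 ?exprn_ge0// subr_ge0.
  exact: ltW.
have l2 : lev outer v.
  apply/levP => j; rewrite tnth_mktuple ge_max.
  have := (unit_cubeP v).1 cv j => /andP[-> v1] /=.
  rewrite gerBl mulr_ge0 ?exprn_ge0// subr_ge0; exact: ltW.
have vol0 : 0 < volume inner v.
  apply: prodr_gt0 => j _; rewrite tnth_mktuple opprB addrC subrK.
  by rewrite mulr_gt0 ?exprn_gt0// subr_gt0.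
have n_gt0 : 0 < n%:R :> R by rewrite ltr0n.
have lam0 : 0 < n%:R * volume inner v by rewrite mulr_gt0.
have lamE : n%:R * volume inner v / n%:R = volume inner v.
  by rewrite mulrAC divff ?mul1r// gt_eqF.
have S0 : 0 <= shell_cst * sigma `^ p by rewrite mulr_ge0 ?shell_cst_ge0 ?powR_ge0.
have rho20 : 0 <= rho2.
  have /andP[h1 h2] := bX (Ordinal n0) _ _ c1 cv l1.
  have := le_trans h1 h2; rewrite ler_pM2r// => /(le_trans (ltW rho10)) //.
have [m1 _] := indX _ _ c1 cv l1; have [m2 _] := indX _ _ c2 cv l2.
apply: (@le_trans _ _ (\int[P]_w (G (tau w))%:E)%E).
  rewrite (_ : (fun w => (shell_ratio (points X w) (noise eps w))%:E) =
     (fun w => (shell_ratio (rep (tau w)) (noise eps w))%:E)); last first.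
    apply/funext => w; congr (_%:E).
    by have := shell_ratio_pattern (repP w); move=> [[-> _] _].
  apply: (@integral_partition_le _ _ _ P _ tau mtau
    (fun c w => shell_ratio (rep c) (noise eps w)) G).
  - move=> c; apply: measurableT_comp (measurable_noise _).
    exact: measurable_shell_ratio.
  - by move=> c w; exact: shell_ratio_ge0.
  - by move=> c; rewrite mulr_ge0// box_ratio_ge0.
  - exact: shell_pattern_moment.
rewrite (_ : (fun w => (G (tau w))%:E) = (fun w => (shell_cst * sigma `^ p *
   box_ratio p (occurrences Ein w) (occurrences Eout w))%:E)); last first.
  apply/funext => w; rewrite /G occurrences_inner occurrences_outer.
  have := shell_ratio_pattern (repP w); move=> [[_ ->] H].
  by rewrite (eq_filter H).
apply: integral_scale_le => //.
- have mm (F : 'I_n -> set Omega) (g : nat -> R) : independent_events P F ->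
      measurable_fun setT (fun w => g (occurrences F w)).
    by move=> indF; exact: (measurable_occurrences indF).
  rewrite /box_ratio; apply: measurable_funM; first exact: (mm _ (fun k => k%:R `^ (p / 2)) (indX _ _ _ _ _)).
  exact: (mm _ (fun k => (Num.max 1 k%:R `^ p)^-1) (indX _ _ _ _ _)).
- by move=> w; exact: box_ratio_ge0.
- apply: box_ratio_moment => //; first exact: indX.
  + exact: indX.
  + by move=> i; rewrite lamE; have /andP[] := bX i _ _ c1 cv l1.
  + move=> i; rewrite lamE; have /andP[_ h] := bX i _ _ c2 cv l2.
    apply: le_trans h _; rewrite -mulrA ler_wpM2l//; exact: volume_outer.
Qed.

End shell.

(** The lower corner of a box can be moved to the smallest coordinates of the points
   in it, which makes its points those of an orthant within the outer box. *)
Lemma box_average_shell z (e : n.-tuple R) (u : d.-tuple R) :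
  unit_cube u -> lev u x -> (0 < count_box (fun i => tnth z i) u v)%N ->
  exists k : 'I_d -> nat,
    [/\ forall j, 0 <= tnth (inner k) j,
        forall j, 2 ^+ k j * (tnth v j - tnth x j) <= 1 &
        `|ybar (fun i => tnth z i) (fun i => tnth e i) u v| `^ p <= shell_ratio k z e].
Proof.
move=> cu /levP ux; rewrite /count_box /ybar.
set I := [pred i | lev u (tnth z i) && lev (tnth z i) v] => cnt0.
have p_ge0 : 0 <= p by exact: le_trans p2.
have /fin_all_exists[k Hk] : forall j, exists k : nat,
    2 ^+ k * (tnth v j - tnth x j) <= tnth v j - tnth u j < 2 ^+ k.+1 * (tnth v j - tnth x j).
  move=> j; apply: dyadic_scale; first by rewrite subr_gt0.
  by rewrite lerD2l lerN2.
have u0 j : 0 <= tnth u j by have /andP[] := (unit_cubeP u).1 cu j.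
have v1 j : tnth v j <= 1 by have /andP[] := (unit_cubeP v).1 cv j.
have innerE j : tnth u j <= tnth (inner k) j.
  by rewrite tnth_mktuple; have /andP[h _] := Hk j; rewrite lerBrDr -lerBrDl.
exists k; split.
- by move=> j; exact: le_trans (innerE j).
- by move=> j; have /andP[h _] := Hk j; apply: le_trans h _; have := u0 j; have := v1 j; lra.
have outerE j : tnth (outer k) j <= tnth u j.
  rewrite tnth_mktuple ge_max u0 /=; have /andP[_ h] := Hk j.
  by rewrite lerBlDr -lerBlDl ltW.
have [i0 Ii0] : exists i, i \in I by apply/card_gt0P.
pose m : {ffun 'I_d -> 'I_n} :=
  [ffun j => [arg min_(i < i0 in I) (tnth (tnth z i) j)]%O].
have mI j : m j \in I by rewrite ffunE; case: arg_minP.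
have mle j i : i \in I -> tnth (tnth z (m j)) j <= tnth (tnth z i) j.
  by rewrite ffunE; case: arg_minP => // l _ + iI; exact.
have IE i : (i \in I) = in_outer k z i &&
    [forall j, tnth (tnth z (m j)) j <= tnth (tnth z i) j].
  apply/idP/andP => [iI|[/andP[_ zv] /forallP H]].
    split; last by apply/forallP => j; exact: mle.
    move: iI => /andP[/levP uz zv]; rewrite /in_outer zv andbT.
    by apply/levP => j; exact: le_trans (outerE j) (uz j).
  rewrite inE zv andbT; apply/levP => j; apply: le_trans (H j).
  by have := mI j; rewrite inE => /andP[/levP].
have SE : \sum_(i | lev u (tnth z i) && lev (tnth z i) v) tnth e i =
    wsum (orthant z m) [seq i <- enum 'I_n | in_outer k z i] e.
  rewrite /wsum big_filter big_enum_cond /= [LHS]big_mkcond [RHS]big_mkcond.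
  apply: eq_bigr => i _; have := IE i; rewrite inE => ->.
  case: (in_outer k z i) => //=; rewrite /orthant.
  case: forallP => H; first by rewrite big1 ?mul1r// => j _; rewrite H.
  have [j /negP Hj] : exists j, ~ (tnth (tnth z (m j)) j <= tnth (tnth z i) j).
    by apply/existsNP => K; apply: H.
  by rewrite (bigD1 j)//= (negbTE Hj) !mul0r.
rewrite /shell_ratio; set c := count_box _ u v.
have c1 : 1 <= c%:R :> R by rewrite ler1n.
have cin : (\sum_(i < n) in_inner k z i)%:R <= c%:R :> R.
  rewrite ler_nat /c /count_box -sum1_card [leqRHS]big_mkcond /=; apply: leq_sum => i _.
  rewrite /in_inner; case: (boolP (lev _ _)) => //= iz; rewrite inE.
  have -> // : lev u (tnth z i) by apply: lev_trans iz; apply/levP.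
rewrite normrM normfV powRM ?invr_ge0//; apply: ler_pM; rewrite ?powR_ge0//.
  apply: ler_powR2 => //; rewrite SE [leRHS]ger0_norm ?family_max_ge0//.
  exact: (family_max_ge (orthant z) _ e m).
rewrite powRV// lef_pV2 ?posrE ?powR_gt0 ?lt_max ?ltr01 ?normr_gt0//; last first.
  by rewrite gt_eqF// (lt_le_trans ltr01).
by rewrite ger0_norm//; apply: ler_powR2; rewrite // ?ge_max ?le_max ?ler01// c1 cin.
Qed.

Definition geometric_cst : R := (1 - 2 `^ (- 2^-1))^-1.

Lemma half_power_lt1 : 2 `^ (- 2^-1) < 1 :> R.
Proof.
have h0 : 0 < 2 `^ (- 2^-1) :> R by exact: powR_gt0.
rewrite -(ltr_pXn2r (n := 2)) ?nnegrE ?(ltW h0)// expr1n.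
rewrite -powR_mulrn ?(ltW h0)// -powRrM mulNr mulVf//.
by rewrite powR_inv1// invf_lt1// ltr1n.
Qed.

Lemma geometric_sum_le (g : R) L : 0 <= g -> g < 1 -> \sum_(l < L) g ^+ l <= (1 - g)^-1.
Proof.
move=> g0 g1; have h : 0 < 1 - g by rewrite subr_gt0.
rewrite -[leRHS]mul1r ler_pdivlMr// mulrC.
have := subrX1 g L; rewrite -(opprB 1 g) mulNr => /eqP; rewrite eq_sym eqr_oppLR => /eqP ->.
by rewrite opprB gerBl exprn_ge0.
Qed.

Definition noise_cst : R :=
  shell_cst * ratio_cst p rho1 (rho2 * 2 ^+ d) * geometric_cst ^+ d.

(** The shells contribute terms that decrease geometrically in each k j to the p-th
   moment of the largest average, so that the shell closest to x prevails. *)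
Lemma noise_sup_moment : exists Z : Omega -> R,
  [/\ measurable_fun setT Z, forall w, 0 <= Z w,
      forall w u, unit_cube u -> lev u x ->
        (0 < count_box (fun i => X i w) u v)%N ->
        `|ybar (fun i => X i w) (fun i => eps i w) u v| `^ p <= Z w &
      (\int[P]_w (Z w)%:E <=
        (noise_cst * sigma `^ p * rate p (n%:R * volume x v))%:E)%E].
Proof.
have t0 j : 0 < tnth v j - tnth x j by rewrite subr_gt0.
have [L HL] : exists L : nat, forall j k, 2 ^+ k * (tnth v j - tnth x j) <= 1 -> (k < L)%N.
  have /fin_all_exists[l Hl] : forall j, exists l : nat, 1 < 2 ^+ l * (tnth v j - tnth x j).
    move=> j; exists (Num.truncn ((tnth v j - tnth x j)^-1)).+1.
    rewrite -ltr_pdivrMr// mul1r; apply: lt_le_trans (truncnS_gt _) _.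
    by rewrite -natrX ler_nat ltnW// ltn_expl.
  exists (\max_j l j) => j k kj.
  apply: leq_trans (leq_bigmax j); rewrite ltnNge; apply/negP => lk.
  have K : 2 ^+ l j * (tnth v j - tnth x j) <= 2 ^+ k * (tnth v j - tnth x j).
    by rewrite ler_wpM2r ?(ltW (t0 j))// ler_weXn2l// ler1n.
  by have := lt_le_trans (Hl j) (le_trans K kj); rewrite ltxx.
pose valid (k : 'I_d -> nat) := [forall j, 0 <= tnth (inner k) j].
pose nk (kk : {ffun 'I_d -> 'I_L}) j : nat := kk j.
pose Zk kk w := if valid (nk kk) then shell_ratio (nk kk) (points X w) (noise eps w) else 0.
have Zk0 kk w : 0 <= Zk kk w by rewrite /Zk; case: ifP => // _; exact: shell_ratio_ge0.
exists (fun w => \sum_(kk : {ffun 'I_d -> 'I_L}) Zk kk w).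
have mratio k : measurable_fun setT (fun w => shell_ratio k (points X w) (noise eps w)).
  have [c rep] : exists c : {ffun 'I_n -> bool} * {ffun 'I_n -> bool}
      * {ffun 'I_n * 'I_n * 'I_d -> bool} -> n.-tuple (d.-tuple R),
      forall w, pattern k (c (pattern k (points X w))) = pattern k (points X w).
    exists (fun c => xget [tuple zerov | _ < n] [set z | pattern k z = c]) => w.
    by apply: (@xgetPex _ _ [set z | pattern k z = pattern k (points X w)]); exists (points X w).
  rewrite (_ : (fun w => _) = (fun w =>
      shell_ratio k (c (pattern k (points X w))) (noise eps w))); last first.
    by apply/funext => w; have := shell_ratio_pattern (rep w); move=> [[-> _] _].
  have mt t : measurable ((fun w => pattern k (points X w)) @^-1` [set t]).
    rewrite -[X in measurable X]setTI.
    exact: (measurable_points measurableT (measurable_pattern k t)).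
  have mF t : measurable_fun setT (fun w => shell_ratio k (c t) (noise eps w)).
    by apply: measurableT_comp (measurable_noise _); exact: measurable_shell_ratio.
  exact: (measurable_partition mt mF).
have mZ kk : measurable_fun setT (Zk kk).
  by rewrite /Zk; case: (valid (nk kk)).
split.
- by apply: measurable_sum => kk.
- by move=> w; apply: sumr_ge0.
- move=> w u cu ux cnt.
  have := @box_average_shell (points X w) (noise eps w) u cu ux.
  have -> : (fun i => tnth (points X w) i) = (fun i => X i w).
    by apply/funext => i; rewrite tnth_mktuple.
  have -> : (fun i => tnth (noise eps w) i) = (fun i => eps i w).
    by apply/funext => i; rewrite tnth_mktuple.
  move=> /(_ cnt)[k [k1 k2 H]]; apply: le_trans H _.
  pose kk : {ffun 'I_d -> 'I_L} := [ffun j => Ordinal (HL j (k j) (k2 j))].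
  have kE : nk kk = k by apply/funext => j; rewrite /nk ffunE.
  rewrite (bigD1 kk)//= /Zk kE (_ : valid k); last exact/forallP.
  by rewrite lerDl; apply: sumr_ge0 => kk' _; exact: Zk0.
have B0 : 0 <= ratio_cst p rho1 (rho2 * 2 ^+ d).
  have [_ _ _ bX] := HX.
  have vol0 : 0 < volume x v by apply: prodr_gt0 => j _.
  have /andP[h1 h2] := bX (Ordinal n0) x v cx cv (introT (levP _ _) (fun j => ltW (xv j))).
  have := le_trans h1 h2; rewrite ler_pM2r// => /(le_trans (ltW rho10)) r2.
  by apply: ratio_cst_ge0.
pose A := shell_cst * sigma `^ p * ratio_cst p rho1 (rho2 * 2 ^+ d).
have A0 : 0 <= A by rewrite mulr_ge0// mulr_ge0 ?powR_ge0 ?shell_cst_ge0.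
pose g : R := 2 `^ (- 2^-1).
have g0 : 0 <= g by exact: powR_ge0.
pose s := n%:R * volume x v.
have s0 : 0 < s by rewrite mulr_gt0 ?ltr0n// prodr_gt0.
pose b (kk : {ffun 'I_d -> 'I_L}) : R := A * rate p s * \prod_(j < d) g ^+ kk j.
have HZ kk : (\int[P]_w (Zk kk w)%:E <= (b kk)%:E)%E.
  have b0 : 0 <= b kk.
    apply: mulr_ge0; first by rewrite mulr_ge0 ?rate_ge0.
    by apply: prodr_ge0 => j _; exact: exprn_ge0.
  rewrite /Zk; case: (boolP (valid (nk kk))) => [/forallP vk|_]; last by rewrite integral0_eq.
  apply: le_trans (shell_moment vk) _; rewrite lee_fin /b mulrA -/A -[leRHS]mulrA.
  apply: ler_wpM2l => //.
  have -> : n%:R * volume (inner (nk kk)) v = s * 2 ^+ (\sum_(j < d) kk j).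
    rewrite /s -mulrA; congr (_ * _); rewrite /volume expr_sum -big_split /=.
    apply: eq_bigr => j _; rewrite tnth_mktuple opprB addrC subrK mulrC.
    by [].
  apply: le_trans (rate_scale _ s0 _) _; first exact: le_trans (ler1n R 2) p2.
    by rewrite exprn_ege1// ler1n.
  rewrite ler_wpM2l ?rate_ge0// -expr_sum /g -powR_mulrn ?powR_ge0// -powRrM.
  by rewrite mulrC powRrM powR_mulrn.
apply: (@le_trans _ _ (\sum_(kk : {ffun 'I_d -> 'I_L}) (b kk)%:E)%E).
  under eq_integral do rewrite -sumEFin.
  rewrite ge0_integral_sum//; first exact: lee_sum.
    by move=> kk; exact/measurable_EFinP.
  by move=> kk w _; rewrite lee_fin.
rewrite sumEFin lee_fin /b -mulr_sumr.
have -> : \sum_(kk : {ffun 'I_d -> 'I_L}) \prod_(j < d) g ^+ kk j =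
    \prod_(j < d) \sum_(l < L) g ^+ l.
  by rewrite (bigA_distr_bigA (fun (j : 'I_d) (l : 'I_L) => g ^+ l)).
rewrite /noise_cst /A -/s.
have -> : shell_cst * ratio_cst p rho1 (rho2 * 2 ^+ d) * geometric_cst ^+ d * sigma `^ p * rate p s
  = shell_cst * sigma `^ p * ratio_cst p rho1 (rho2 * 2 ^+ d) * rate p s * geometric_cst ^+ d.
  by ring.
apply: ler_wpM2l; first by rewrite -/A mulr_ge0 ?rate_ge0.
have -> : geometric_cst ^+ d = \prod_(j < d) geometric_cst by rewrite prodr_const card_ord.
apply: ler_prod => j _; rewrite sumr_ge0 => [|l _]; last by rewrite exprn_ge0.
by rewrite geometric_sum_le// half_power_lt1.
Qed.

End noise_bound.

(** * Block estimators lie between averages *)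

Section block_bounds.
Context {R : realType} {d n : nat}.
Variables (xs : 'I_n -> d.-tuple R) (ys : 'I_n -> R).
Hypotheses (n0 : (0 < n)%N) (cxs : forall i, unit_cube (xs i)).
Implicit Types u v x : d.-tuple R.

Lemma unit_cube0 : unit_cube (zerov : d.-tuple R).
Proof. by apply/unit_cubeP => j; rewrite tnth_mktuple lexx ler01. Qed.

Lemma unit_cube1 : unit_cube (onev : d.-tuple R).
Proof. by apply/unit_cubeP => j; rewrite tnth_mktuple lexx ler01. Qed.

Lemma lev0 x : unit_cube x -> lev zerov x.
Proof. by move=> /andP[]. Qed.

Lemma lev1 x : unit_cube x -> lev x onev.
Proof. by move=> /andP[]. Qed.

Lemma ybar_bound u v : `|ybar xs ys u v| <= \sum_(i < n) `|ys i|.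
Proof.
have h : `|\sum_(i | lev u (xs i) && lev (xs i) v) ys i| <= \sum_(i < n) `|ys i|.
  apply: le_trans (ler_norm_sum _ _ _) _.
  by rewrite [leRHS](bigID (fun i => lev u (xs i) && lev (xs i) v)) /= lerDl sumr_ge0.
rewrite /ybar; case: (count_box xs u v) => [|m].
  by rewrite invr0 mulr0 normr0; exact: le_trans h.
rewrite normrM normfV ler_pdivrMr ?normr_gt0 ?pnatr_eq0//.
apply: le_trans h _; rewrite ler_peMr ?sumr_ge0//.
by rewrite ger0_norm// ler1n.
Qed.

Lemma count_box1 u : count_box xs u onev = count_ge xs u.
Proof. by apply: eq_card => i; rewrite !inE lev1// andbT. Qed.

Lemma count_box0 v : count_box xs zerov v = count_le xs v.
Proof. by apply: eq_card => i; rewrite !inE lev0. Qed.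

Lemma count_ge0 : count_ge xs zerov = n.
Proof. by rewrite -[RHS]card_ord; apply: eq_card => i; rewrite !inE lev0. Qed.

Lemma count_le1 : count_le xs onev = n.
Proof. by rewrite -[RHS]card_ord; apply: eq_card => i; rewrite !inE lev1. Qed.

Lemma count_box_le u u' v v' : lev u' u -> lev v v' ->
  (count_box xs u v <= count_box xs u' v')%N.
Proof.
move=> uu vv; apply: subset_leq_card; apply/fintype.subsetP => i; rewrite !inE.
by move=> /andP[a b]; rewrite (lev_trans uu a) (lev_trans b vv).
Qed.

Let S x u := [set ybar xs ys u v | v in
  [set v | [/\ unit_cube v, lev x v & (0 < count_box xs u v)%N]]].
Let S' x v := [set ybar xs ys u v | u in
  [set u | [/\ unit_cube u, lev u x & (0 < count_box xs u v)%N]]].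

Let has_lbS x u : has_lbound (S x u).
Proof.
exists (- \sum_(i < n) `|ys i|) => _ [v _ <-].
by have := ybar_bound u v; rewrite ler_norml => /andP[].
Qed.

Let has_ubS' x v : has_ubound (S' x v).
Proof.
exists (\sum_(i < n) `|ys i|) => _ [u _ <-].
by have := ybar_bound u v; rewrite ler_norml => /andP[].
Qed.

Let S_neq0 x u : unit_cube x -> (0 < count_ge xs u)%N -> S x u (ybar xs ys u onev).
Proof.
by move=> cx cu; exists onev => //; split; [exact: unit_cube1|exact: lev1|rewrite count_box1].
Qed.

Let S'_neq0 x v : unit_cube x -> (0 < count_le xs v)%N -> S' x v (ybar xs ys zerov v).
Proof.
by move=> cx cv; exists zerov => //; split; [exact: unit_cube0|exact: lev0|rewrite count_box0].
Qed.

(** The corner v competes in both minima: in the outer one of the min-max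
   estimator, and in the inner ones of the max-min estimator because it is
   admissible for every u. *)
Lemma block_upper x v (B : R) : unit_cube x -> unit_cube v -> lev x v ->
  (0 < count_le xs v)%N ->
  (forall u, lev u x -> (0 < count_ge xs u)%N -> (0 < count_box xs u v)%N) ->
  (forall u, unit_cube u -> lev u x -> (0 < count_box xs u v)%N -> ybar xs ys u v <= B) ->
  Num.max (max_min xs ys x) (min_max xs ys x) <= B.
Proof.
move=> cx cv xv nv nuv HB; rewrite ge_max; apply/andP; split.
  apply: ge_sup.
    by exists (inf (S x zerov)), zerov => //; split; [exact: unit_cube0|exact: lev0|rewrite count_ge0].
  move=> _ [u [cu ux nu] <-].
  apply: le_trans (HB u cu ux (nuv u ux nu)).
  by apply: ge_inf; [exact: has_lbS|exists v => //; split => //; exact: nuv].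
apply: (@le_trans _ _ (sup (S' x v))); last first.
  apply: ge_sup; first by exists (ybar xs ys zerov v); exact: S'_neq0.
  by move=> _ [u [cu ux nu] <-]; exact: HB.
apply: ge_inf; last by exists v.
exists (- \sum_(i < n) `|ys i|) => _ [v' [cv' xv' nv'] <-].
apply: (@le_trans _ _ (ybar xs ys zerov v')).
  by have := ybar_bound zerov v'; rewrite ler_norml => /andP[].
by apply: ub_le_sup; [exact: has_ubS'|exact: S'_neq0].
Qed.

Lemma block_lower x u (B : R) : unit_cube x -> unit_cube u -> lev u x ->
  (0 < count_ge xs u)%N ->
  (forall v, lev x v -> (0 < count_le xs v)%N -> (0 < count_box xs u v)%N) ->
  (forall v, unit_cube v -> lev x v -> (0 < count_box xs u v)%N -> B <= ybar xs ys u v) ->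
  B <= Num.min (max_min xs ys x) (min_max xs ys x).
Proof.
move=> cx cu ux nu nuv HB; rewrite le_min; apply/andP; split; last first.
  apply: lb_le_inf.
    by exists (sup (S' x onev)), onev => //; split; [exact: unit_cube1|exact: lev1|rewrite count_le1].
  move=> _ [v [cv xv nv] <-].
  apply: le_trans (HB v cv xv (nuv v xv nv)) _.
  by apply: ub_le_sup; [exact: has_ubS'|exists u => //; split => //; exact: nuv].
apply: (@le_trans _ _ (inf (S x u))).
  apply: lb_le_inf; first by exists (ybar xs ys u onev); exact: S_neq0.
  by move=> _ [v [cv xv nv] <-]; exact: HB.
apply: ub_le_sup; last by exists u.
exists (\sum_(i < n) `|ys i|) => _ [u' [cu' ux' nu'] <-].
apply: (@le_trans _ _ (ybar xs ys u' onev)).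
  by apply: ge_inf; [exact: has_lbS|exact: S_neq0].
by have := ybar_bound u' onev; rewrite ler_norml => /andP[].
Qed.

End block_bounds.

Section signal.
Context {R : realType} {d n : nat}.
Variables (xs : 'I_n -> d.-tuple R) (eps : 'I_n -> R) (f : d.-tuple R -> R).
Hypotheses (n0 : (0 < n)%N) (cxs : forall i, unit_cube (xs i)).
Hypothesis (mf : nondecreasing_on_cube f).
Implicit Types u v x : d.-tuple R.

Let ys i := f (xs i) + eps i.

Lemma ybarD u v : ybar xs ys u v = ybar xs (fun i => f (xs i)) u v + ybar xs eps u v.
Proof. by rewrite /ybar big_split mulrDl. Qed.

Lemma ybar_signal u v : unit_cube u -> unit_cube v -> (0 < count_box xs u v)%N ->
  f u <= ybar xs (fun i => f (xs i)) u v <= f v.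
Proof.
move=> cu cv cnt; have c0 : 0 < (count_box xs u v)%:R :> R by rewrite ltr0n.
rewrite /ybar ler_pdivlMr// ler_pdivrMr//.
have E (c : R) : c * (count_box xs u v)%:R = \sum_(i | lev u (xs i) && lev (xs i) v) c.
  by rewrite sumr_const mulr_natr.
rewrite !E; apply/andP; split; apply: ler_sum => i /andP[ui iv]; exact: mf.
Qed.

(** If there is a point between x and v, then v is an admissible corner, and f is
   at most f v = f x on the boxes below v. Otherwise the corner 1 is taken, which
   costs the oscillation D. *)
Lemma block_error_le g x v (B D : R) : block_estimate xs ys unit_cube g ->
  unit_cube x -> unit_cube v -> lev x v -> f v = f x -> f onev - f zerov <= D ->
  (((0 < count_box xs x v)%N /\ forall u, unit_cube u -> lev u x ->
      (0 < count_box xs u v)%N -> `|ybar xs eps u v| <= B) \/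
   forall u, unit_cube u -> lev u x ->
      (0 < count_box xs u onev)%N -> D + `|ybar xs eps u onev| <= B) ->
  g x - f x <= B.
Proof.
move=> gb cx cv xv fxv fD H; rewrite lerBlDr.
have /andP[_ gx] := gb x cx; apply: le_trans gx _.
have f0x : f zerov <= f x by apply: mf => //; [exact: unit_cube0|exact: lev0].
case: H => [[xv0 H]|H].
  apply: (@block_upper _ _ _ xs ys n0 cxs x v) => //.
  - rewrite -(count_box0 cxs); apply: leq_trans xv0 _; apply: count_box_le (lev_refl v).
    exact: lev0.
  - by move=> u ux _; apply: leq_trans xv0 _; apply: count_box_le (lev_refl v).
  - move=> u cu ux nu; rewrite ybarD.
    have /andP[_ h] := ybar_signal cu cv nu.
    have := H u cu ux nu; have := ler_norm (ybar xs eps u v); rewrite -fxv; lra.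
apply: (@block_upper _ _ _ xs ys n0 cxs x onev) => //.
- exact: unit_cube1.
- exact: lev1.
- by rewrite count_le1.
- by move=> u ux; rewrite count_box1.
- move=> u cu ux nu; rewrite ybarD.
  have /andP[_ h] := ybar_signal cu unit_cube1 nu.
  have := H u cu ux nu; have := ler_norm (ybar xs eps u onev); lra.
Qed.

Lemma block_error_ge g x u (B D : R) : block_estimate xs ys unit_cube g ->
  unit_cube x -> unit_cube u -> lev u x -> f u = f x -> f onev - f zerov <= D ->
  (((0 < count_box xs u x)%N /\ forall v, unit_cube v -> lev x v ->
      (0 < count_box xs u v)%N -> `|ybar xs eps u v| <= B) \/
   forall v, unit_cube v -> lev x v ->
      (0 < count_box xs zerov v)%N -> D + `|ybar xs eps zerov v| <= B) ->
  f x - g x <= B.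
Proof.
move=> gb cx cu ux fux fD H; rewrite lerBlDr -lerBlDl.
have /andP[gx _] := gb x cx; apply: le_trans gx.
have fx1 : f x <= f onev by apply: mf => //; [exact: unit_cube1|exact: lev1].
case: H => [[xv0 H]|H].
  apply: (@block_lower _ _ _ xs ys n0 cxs x u) => //.
  - rewrite -(count_box1 cxs); apply: leq_trans xv0 _; apply: count_box_le (lev_refl u) _.
    exact: lev1.
  - by move=> v xv _; apply: leq_trans xv0 _; apply: count_box_le (lev_refl u) _.
  - move=> v cv xv nv; rewrite ybarD.
    have /andP[h _] := ybar_signal cu cv nv.
    have := H v cv xv nv; have := ler_norm (- ybar xs eps u v); rewrite normrN -fux; lra.
apply: (@block_lower _ _ _ xs ys n0 cxs x zerov) => //.
- exact: unit_cube0.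
- exact: lev0.
- by rewrite count_ge0.
- by move=> v xv; rewrite count_box0.
- move=> v cv xv nv; rewrite ybarD.
  have /andP[h _] := ybar_signal unit_cube0 cv nv.
  have := H v cv xv nv; have := ler_norm (- ybar xs eps zerov v); rewrite normrN; lra.
Qed.

End signal.

(** * The risk at a point *)

Section point_rate.
Context {R : realType}.
Implicit Types (q s c : R).

(** The rate of convergence at a point, s being the expected number of points
   between it and the corner of its piece. *)
Definition point_rate q s : R := if q < 2 then s `^ (- (q / 2)) else rate q s.

Lemma point_rate_ge0 q s : 0 <= point_rate q s.
Proof. by rewrite /point_rate; case: ifP; rewrite ?powR_ge0 ?rate_ge0. Qed.

Lemma powRN_anti (a s s' : R) : 0 <= a -> 0 < s -> s <= s' -> s' `^ (- a) <= s `^ (- a).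
Proof.
move=> a0 s0 ss; rewrite !powRN lef_pV2 ?posrE ?powR_gt0//.
  by apply: ler_powR2 => //; exact: ltW.
exact: lt_le_trans ss.
Qed.

Lemma point_rate_anti q s s' : 1 <= q -> 0 < s -> s <= s' ->
  point_rate q s' <= point_rate q s.
Proof.
move=> q1 s0 ss; have q0 : 0 <= q / 2 by rewrite divr_ge0// (le_trans ler01).
rewrite /point_rate /rate; case: ifP => _; first exact: powRN_anti.
by rewrite le_min !ge_min !powRN_anti// orbT.
Qed.

Lemma expRN_le (a s c : R) : 0 < a -> 0 < c -> 0 < s ->
  expR (- (c * s)) <= a `^ a * c `^ (- a) * s `^ (- a).
Proof.
move=> a0 c0 s0; have cs0 : 0 < c * s by exact: mulr_gt0.
have := powR_le_expR a0 (ltW cs0).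
rewrite powRM ?(ltW c0) ?(ltW s0)// => H.
rewrite !powRN -mulrA -invfM ler_pdivlMr ?mulr_gt0 ?powR_gt0//.
by rewrite expRN mulrC ler_pdivrMr ?expR_gt0.
Qed.

Definition exp_rate_cst q c : R :=
  (q / 2) `^ (q / 2) * c `^ (- (q / 2)) + 2^-1 `^ 2^-1 * c `^ (- 2^-1).

Lemma exp_rate_cst_ge0 q c : 0 <= exp_rate_cst q c.
Proof. by rewrite addr_ge0// mulr_ge0// powR_ge0. Qed.

(** The probability that no point falls between x and the corner of its piece is
   exponentially small, hence dominated by the rate. *)
Lemma exp_point_rate q c s : 1 <= q -> 0 < c -> 0 < s ->
  expR (- (c * s)) <= exp_rate_cst q c * point_rate q s.
Proof.
move=> q1 c0 s0; have q0 : 0 < q / 2 by rewrite divr_gt0// (lt_le_trans ltr01).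
have H1 : expR (- (c * s)) <= exp_rate_cst q c * s `^ (- (q / 2)).
  apply: le_trans (expRN_le q0 c0 s0) _; rewrite ler_wpM2r ?powR_ge0//.
  by rewrite lerDl mulr_ge0// powR_ge0.
have H2 : expR (- (c * s)) <= exp_rate_cst q c * s `^ (- 2^-1).
  have h2 : 0 < 2^-1 :> R by rewrite invr_gt0.
  apply: le_trans (expRN_le h2 c0 s0) _.
  rewrite ler_wpM2r ?powR_ge0// lerDr mulr_ge0// powR_ge0//.
rewrite /point_rate /rate; case: ifP => // _.
by case: (leP (s `^ (- 2^-1)) (s `^ (- (q / 2)))).
Qed.

(** For q < 2 only second moments are available; t is the typical size of the
   square root of Z. *)
Lemma powR_interpolate q (t Z : R) : 1 <= q -> q < 2 -> 0 < t -> 0 <= Z ->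
  Z `^ (q / 2) <= t `^ q + t `^ (q - 2) * Z.
Proof.
move=> q1 q2 t0 Z0; have q0 : 0 <= q / 2 by rewrite divr_ge0// (le_trans ler01).
have [h|h] := leP Z (t ^+ 2).
  rewrite (@le_trans _ _ (t `^ q))// ?lerDl ?mulr_ge0 ?powR_ge0//.
  apply: le_trans (ler_powR2 q0 Z0 h) _.
  rewrite -powR_mulrn ?(ltW t0)// -powRrM le_eqVlt; apply/orP; left; apply/eqP.
  by congr (_ `^ _); field.
have {}Z0 : 0 < Z by apply: le_lt_trans h; exact: sqr_ge0.
rewrite (@le_trans _ _ (t `^ (q - 2) * Z))// ?lerDr ?powR_ge0//.
have -> : Z `^ (q / 2) = Z `^ (- (1 - q / 2)) * Z.
  rewrite -[X in _ = _ * X]powRr1 ?(ltW Z0)// -powRD_pos//; congr (_ `^ _); ring.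
have t2 : 0 < t ^+ 2 by rewrite exprn_gt0.
rewrite ler_wpM2r ?(ltW Z0)//.
have a0 : 0 <= 1 - q / 2 by lra.
apply: le_trans (powRN_anti a0 t2 (ltW h)) _.
rewrite -powR_mulrn ?(ltW t0)// -powRrM le_eqVlt; apply/orP; left; apply/eqP.
by congr (_ `^ _); field.
Qed.

End point_rate.

Section upper_noise.
Context {R : realType} {disp : measure_display} {Omega : measurableType disp}.
Context (P : probability Omega R) {d n : nat}.
Variables (X : 'I_n -> Omega -> d.-tuple R) (eps : 'I_n -> {RV P >-> R}).
Variables (q sigma rho1 rho2 : R).
Hypotheses (q1 : 1 <= q) (sigma0 : 0 < sigma) (rho10 : 0 < rho1) (n0 : (0 < n)%N).
Hypotheses (HX : design_model P X rho1 rho2)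
  (Heps : noise_model X eps (Num.max q 2) sigma).

Let p := Num.max q 2.
Let p2 : 2 <= p. Proof. by rewrite le_max lexx orbT. Qed.

Lemma moment_interpolate (Z : Omega -> R) (C s : R) : 0 <= C -> 0 < s ->
  measurable_fun setT Z -> (forall w, 0 <= Z w) ->
  (\int[P]_w (Z w)%:E <= (C * sigma `^ p * rate p s)%:E)%E ->
  (\int[P]_w (Z w `^ (q / p))%:E <= ((1 + C) * sigma `^ q * point_rate q s)%:E)%E.
Proof.
move=> C0 s0 mZ Z0 HZ; rewrite /point_rate; case: ltP => q2.
  have pE : p = 2 by apply/max_idPr; exact: ltW.
  rewrite pE in HZ *.
  pose t := sigma * s `^ (- 2^-1).
  have t0 : 0 < t by rewrite mulr_gt0// powR_gt0.
  apply: (@le_trans _ _ (\int[P]_w (t `^ q + t `^ (q - 2) * Z w)%:E)%E).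
    apply: ge0_le_integral_nomeas => w _; rewrite lee_fin ?powR_ge0//.
    exact: powR_interpolate.
  apply: (@le_trans _ _ (t `^ q + t `^ (q - 2) * (C * sigma `^ 2 * rate 2 s))%:E).
    apply: integral_add_le => //.
    - by move=> _; exact: powR_ge0.
    - by rewrite integral_probability_cst.
    - exact: measurable_funM.
    - by move=> w; rewrite mulr_ge0 ?powR_ge0.
    - by apply: integral_scale_le => //; exact: powR_ge0.
  rewrite lee_fin.
  have tq (a : R) : t `^ a = sigma `^ a * s `^ (- (a / 2)).
    rewrite powRM ?(ltW sigma0) ?powR_ge0// -powRrM; congr (_ * _ `^ _).
    by field.
  rewrite !tq.
  have r2 : rate 2 s <= s `^ (-1).
    by rewrite /rate ge_min divff// lexx orbT.
  have -> : (1 + C) * sigma `^ q * s `^ (- (q / 2)) =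
     sigma `^ q * s `^ (- (q / 2)) + C * (sigma `^ q * s `^ (- (q / 2))) by ring.
  rewrite lerD2l.
  have -> : sigma `^ q = sigma `^ (q - 2) * sigma `^ 2.
    by rewrite -powRD_pos// subrK.
  have -> : s `^ (- (q / 2)) = s `^ (- ((q - 2) / 2)) * s `^ (-1).
    by rewrite -powRD_pos//; congr (_ `^ _); field.
  set a := sigma `^ (q - 2); set b := s `^ (- ((q - 2) / 2)); set c := sigma `^ 2.
  have -> : a * b * (C * c * rate 2 s) = C * a * c * b * rate 2 s by ring.
  have -> : C * (a * c * (b * s `^ (-1))) = C * a * c * b * s `^ (-1) by ring.
  by rewrite ler_wpM2l// !mulr_ge0// powR_ge0.
have pE : p = q by apply/max_idPl.
rewrite pE in HZ *; rewrite divff; last by rewrite gt_eqF// (lt_le_trans ltr01).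
under eq_integral do rewrite powRr1//.
apply: le_trans HZ _; rewrite lee_fin !ler_wpM2r ?rate_ge0 ?powR_ge0//.
by rewrite lerDr.
Qed.

Definition pointwise_cst : R :=
  let C := noise_cst (d := d) p rho1 rho2 in
  (1 + C) + 2 `^ q * (exp_rate_cst q (rho1 / 2) + (1 + C)).

(** The error B on one side of f x: the noise of the averages below v if there is a
   point between x and v, and otherwise, on an event of exponentially small
   probability, D plus the noise of the averages below the corner 1. *)
Lemma upper_noise (D : R) (x v : d.-tuple R) : 0 <= D ->
  unit_cube x -> unit_cube v -> (forall j, tnth x j < tnth v j) ->
  exists U : Omega -> R,
  [/\ measurable_fun setT U, forall w, 0 <= U w,
      (\int[P]_w (U w)%:E <= (pointwise_cst * (sigma `^ q + D `^ q)
         * point_rate q (n%:R * volume x v))%:E)%E &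
      forall w, exists B, [/\ 0 <= B, B `^ q <= U w &
        ((0 < count_box (fun i => X i w) x v)%N /\ forall u, unit_cube u -> lev u x ->
          (0 < count_box (fun i => X i w) u v)%N ->
          `|ybar (fun i => X i w) (fun i => eps i w) u v| <= B) \/
        forall u, unit_cube u -> lev u x ->
          (0 < count_box (fun i => X i w) u onev)%N ->
          D + `|ybar (fun i => X i w) (fun i => eps i w) u onev| <= B]].
Proof.
move=> D0 cx cv xv; have [mX cX indX bX] := HX.
have x1 j : tnth x j < tnth onev j.
  rewrite tnth_mktuple; apply: lt_le_trans (xv j) _.
  by have /andP[] := (unit_cubeP v).1 cv j.
have [Zv [mZv Zv0 HZv EZv]] := noise_sup_moment p2 sigma0 rho10 n0 HX Heps cx cv xv.
have [Z1 [mZ1 Z10 HZ1 EZ1]] := noise_sup_moment p2 sigma0 rho10 n0 HX Heps cx unit_cube1 x1.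
have p0 : 0 < p by exact: lt_le_trans p2.
have q0 : 0 < q by exact: lt_le_trans q1.
set C := noise_cst (d := d) p rho1 rho2 in EZv EZ1.
have vol0 : 0 < volume x v by apply: prodr_gt0 => j _; rewrite subr_gt0.
have vol1 : 0 < volume x onev by apply: prodr_gt0 => j _; rewrite subr_gt0.
have n_gt0 : 0 < n%:R :> R by rewrite ltr0n.
set s := n%:R * volume x v in EZv *.
have s0 : 0 < s by exact: mulr_gt0.
have C0 : 0 <= C.
  have : (0 <= (C * sigma `^ p * rate p s)%:E)%E.
    by apply: le_trans EZv; apply: integral_ge0 => w _; rewrite lee_fin.
  rewrite lee_fin -mulrA pmulr_lge0// mulr_gt0 ?powR_gt0// lt_min !powR_gt0//.
pose N w := occurrences (fun i => X i @^-1` box x v) w.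
have NE w : N w = count_box (fun i => X i w) x v.
  rewrite /N /occurrences /count_box -sum1_card [RHS]big_mkcond.
  apply: eq_bigr => i _; rewrite inE.
  have -> : (w \in X i @^-1` box x v) = lev x (X i w) && lev (X i w) v.
    by apply/idP/idP => /[!inE].
  by case: ifP.
have lxv : lev x v by apply/levP => j; exact: ltW.
have indN := indX _ _ cx cv lxv.
have mN : measurable_fun setT (fun w => expR (-1) ^+ N w : R).
  exact: (measurable_occurrences indN (fun k => expR (-1) ^+ k)).
have EN : (\int[P]_w (expR (-1) ^+ N w)%:E <=
    (exp_rate_cst q (rho1 / 2) * point_rate q s)%:E)%E.
  have Hin i : rho1 * (s / n%:R) <= fine (P (X i @^-1` box x v)).
    have -> : s / n%:R = volume x v by rewrite /s mulrAC divff ?mul1r// gt_eqF.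
    by have /andP[] := bX i _ _ cx cv lxv.
  apply: le_trans (occurrences_lower_tail n0 indN Hin) _; rewrite lee_fin.
  have := @exp_point_rate _ q (rho1 / 2) s q1 _ s0.
  by rewrite mulrAC; apply; rewrite divr_gt0.
have mpow (Z : Omega -> R) (a : R) : measurable_fun setT Z ->
    measurable_fun setT (fun w => Z w `^ a).
  by move=> mZ; exact: (measurableT_comp (measurable_powR _) mZ).
have EZv' := moment_interpolate C0 s0 mZv Zv0 EZv.
have s10 : 0 < n%:R * volume x onev by exact: mulr_gt0.
have EZ1' : (\int[P]_w (Z1 w `^ (q / p))%:E <=
    ((1 + C) * sigma `^ q * point_rate q s)%:E)%E.
  apply: le_trans (moment_interpolate C0 s10 mZ1 Z10 EZ1) _; rewrite lee_fin.
  rewrite ler_wpM2l ?mulr_ge0 ?powR_ge0 ?addr_ge0// point_rate_anti// ler_wpM2l//.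
  apply: ler_prod => j _; rewrite subr_ge0 (ltW (xv j)) lerD2r /= [leRHS]tnth_mktuple.
  by have /andP[] := (unit_cubeP v).1 cv j.
exists (fun w => Zv w `^ (q / p) + 2 `^ q * (D `^ q * expR (-1) ^+ N w + Z1 w `^ (q / p))).
have e0 w : 0 <= expR (-1) ^+ N w by rewrite exprn_ge0// expR_ge0.
have m2 : measurable_fun setT (fun w => D `^ q * expR (-1) ^+ N w + Z1 w `^ (q / p)).
  by apply: measurable_funD; [exact: measurable_funM|exact: mpow].
have p20 w : 0 <= D `^ q * expR (-1) ^+ N w + Z1 w `^ (q / p).
  by rewrite addr_ge0 ?powR_ge0// mulr_ge0 ?powR_ge0.
split.
- by apply: measurable_funD; [exact: mpow|exact: measurable_funM].
- by move=> w; rewrite addr_ge0 ?powR_ge0// mulr_ge0// powR_ge0.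
- apply: (@le_trans _ _ ((1 + C) * sigma `^ q * point_rate q s + 2 `^ q *
    (D `^ q * (exp_rate_cst q (rho1 / 2) * point_rate q s)
     + (1 + C) * sigma `^ q * point_rate q s))%:E).
    apply: integral_add_le => //.
    + exact: mpow.
    + by move=> w; exact: powR_ge0.
    + exact: measurable_funM.
    + by move=> w; rewrite mulr_ge0// powR_ge0.
    apply: integral_scale_le => //.
    apply: integral_add_le => //.
    + exact: measurable_funM.
    + by move=> w; rewrite mulr_ge0// powR_ge0.
    + by apply: integral_scale_le => //; exact: powR_ge0.
    + exact: mpow.
    + by move=> w; exact: powR_ge0.
  rewrite lee_fin /pointwise_cst -/p -/C.
  have a0 := powR_ge0 sigma q; have b0 := powR_ge0 D q; have c0 := powR_ge0 2 q.
  have f0 := exp_rate_cst_ge0 q (rho1 / 2); have r0 := point_rate_ge0 q s.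
  set a := sigma `^ q in a0 *; set b := D `^ q in b0 *; set c := 2 `^ q in c0 *.
  set e := exp_rate_cst _ _ in f0 *; set r := point_rate q s in r0 *.
  have -> : (1 + C + c * (e + (1 + C))) * (a + b) * r =
    ((1 + C) * a * r + c * (b * (e * r) + (1 + C) * a * r)) +
    ((1 + C) * b * r + c * e * a * r + c * (1 + C) * b * r) by ring.
  by rewrite lerDl !addr_ge0// !mulr_ge0// addr_ge0.
move=> w.
have root (Z y : R) : 0 <= y -> y `^ p <= Z -> y <= Z `^ p^-1.
  move=> y0 yZ; have -> : y = (y `^ p) `^ p^-1.
    by rewrite -powRrM divff ?powRr1// gt_eqF.
  by apply: ler_powR2 => //; rewrite ?invr_ge0 ?(ltW p0) ?powR_ge0.
have powq (Z : R) : (Z `^ p^-1) `^ q = Z `^ (q / p).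
  by rewrite -powRrM mulrC.
have [cnt|cnt] := posnP (count_box (fun i => X i w) x v); last first.
  exists (Zv w `^ p^-1); split; first exact: powR_ge0.
    by rewrite powq lerDl mulr_ge0// powR_ge0.
  left; split => // u cu ux nu; apply: root => //; exact: HZv.
exists (D + Z1 w `^ p^-1); split; first by rewrite addr_ge0// powR_ge0.
  apply: (@le_trans _ _ (2 `^ q * (D `^ q * expR (-1) ^+ N w + Z1 w `^ (q / p)))).
    rewrite NE cnt expr0 mulr1 -powq; apply: powR_add_le => //; first exact: ltW.
    exact: powR_ge0.
  by rewrite lerDr powR_ge0.
right=> u cu ux nu; rewrite lerD2l; apply: root => //; exact: HZ1.
Qed.

End upper_noise.

(** ** Reflection of the cube *)

Section reflection.
Context {R : realType} {d : nat}.
Implicit Types u v x : d.-tuple R.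

(** Reflection exchanges the corners above x and below x, hence the two sides of
   the error; the noise is not reflected. *)
Definition refl u : d.-tuple R := [tuple 1 - tnth u j | j < d].

Lemma tnth_refl u j : tnth (refl u) j = 1 - tnth u j.
Proof. by rewrite tnth_mktuple. Qed.

Lemma reflK : involutive refl.
Proof. by move=> u; apply: eq_from_tnth => j; rewrite !tnth_refl subKr. Qed.

Lemma lev_refl_refl u v : lev (refl u) (refl v) = lev v u.
Proof. by apply: eq_forallb => j; rewrite !tnth_refl lerD2l lerN2. Qed.

Lemma unit_cube_refl u : unit_cube u -> unit_cube (refl u).
Proof.
move=> /unit_cubeP cu; apply/unit_cubeP => j; rewrite tnth_refl.
by have /andP[a b] := cu j; apply/andP; split; lra.
Qed.

Lemma volume_refl u v : volume (refl v) (refl u) = volume u v.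
Proof. by apply: eq_bigr => j _; rewrite !tnth_refl; ring. Qed.

Lemma refl0 : refl zerov = onev.
Proof. by apply: eq_from_tnth => j; rewrite tnth_refl !tnth_mktuple subr0. Qed.

Lemma measurable_refl : measurable_fun setT refl.
Proof.
apply/measurable_fun_tnthP => j /=.
apply: (eq_measurable_fun (fun u : d.-tuple R => 1 - tnth u j)).
  by move=> u _; rewrite /= tnth_refl.
by apply: measurable_funB => //; exact: measurable_tnth.
Qed.

Lemma count_box_refl n (xs : 'I_n -> d.-tuple R) u v :
  count_box (fun i => refl (xs i)) (refl v) (refl u) = count_box xs u v.
Proof. by apply: eq_card => i; rewrite !inE !lev_refl_refl andbC. Qed.

Lemma ybar_refl n (xs : 'I_n -> d.-tuple R) (ys : 'I_n -> R) u v :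
  ybar (fun i => refl (xs i)) ys (refl v) (refl u) = ybar xs ys u v.
Proof.
rewrite /ybar count_box_refl; congr (_ / _); apply: eq_bigl => i.
by rewrite !lev_refl_refl andbC.
Qed.

End reflection.

Section reflected_models.
Context {R : realType} {disp : measure_display} {Omega : measurableType disp}.
Context (P : probability Omega R) {d n : nat}.
Variables (X : 'I_n -> Omega -> d.-tuple R) (eps : 'I_n -> {RV P >-> R}).

Let X' i w := refl (X i w).

Let preimage_refl i u v : X' i @^-1` box u v = X i @^-1` box (refl v) (refl u).
Proof.
apply/funext => w; rewrite /preimage /box /X' /= -[u in LHS]reflK -[v in LHS]reflK.
by rewrite !lev_refl_refl andbC.
Qed.

Lemma design_model_refl rho1 rho2 :
  design_model P X rho1 rho2 -> design_model P X' rho1 rho2.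
Proof.
move=> [mX cX indX bX]; split.
- by move=> i; apply: measurableT_comp (mX i); exact: measurable_refl.
- by move=> i w; apply: unit_cube_refl.
- move=> u v cu cv uv.
  rewrite (_ : (fun i => _) = (fun i => X i @^-1` box (refl v) (refl u))).
    by apply: indX; [exact: unit_cube_refl|exact: unit_cube_refl|rewrite lev_refl_refl].
  by apply/funext => i; exact: preimage_refl.
- move=> i u v cu cv uv; rewrite preimage_refl -(volume_refl u v).
  by apply: bX; [exact: unit_cube_refl|exact: unit_cube_refl|rewrite lev_refl_refl].
Qed.

Lemma noise_model_refl p sigma : noise_model X eps p sigma -> noise_model X' eps p sigma.
Proof.
move=> H A mA.
pose r (z : n.-tuple (d.-tuple R)) : n.-tuple (d.-tuple R) := [tuple refl (tnth z i) | i < n].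
have mr : measurable_fun setT r.
  apply/measurable_fun_tnthP => i /=.
  apply: (eq_measurable_fun (fun z : n.-tuple (d.-tuple R) => refl (tnth z i))).
    by move=> z _; rewrite /= tnth_mktuple.
  by apply: measurableT_comp measurable_refl _; exact: measurable_tnth.
have mA' : measurable (r @^-1` A).
  by rewrite -[X in measurable X]setTI; exact: mr.
have [Q [HQ QE]] := H _ mA'; exists Q; split => // g g0 mg.
rewrite QE// (_ : points X @^-1` _ = points X' @^-1` A)//.
apply/funext => w; rewrite /preimage /=; congr A.
by apply: eq_from_tnth => i; rewrite !tnth_mktuple.
Qed.

End reflected_models.

Section lower_noise.
Context {R : realType} {disp : measure_display} {Omega : measurableType disp}.
Context (P : probability Omega R) {d n : nat}.
Variables (X : 'I_n -> Omega -> d.-tuple R) (eps : 'I_n -> {RV P >-> R}).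
Variables (q sigma rho1 rho2 : R).
Hypotheses (q1 : 1 <= q) (sigma0 : 0 < sigma) (rho10 : 0 < rho1) (n0 : (0 < n)%N).
Hypotheses (HX : design_model P X rho1 rho2)
  (Heps : noise_model X eps (Num.max q 2) sigma).

Lemma lower_noise (D : R) (x u : d.-tuple R) : 0 <= D ->
  unit_cube x -> unit_cube u -> (forall j, tnth u j < tnth x j) ->
  exists U : Omega -> R,
  [/\ measurable_fun setT U, forall w, 0 <= U w,
      (\int[P]_w (U w)%:E <= (pointwise_cst (d := d) q rho1 rho2 * (sigma `^ q + D `^ q)
         * point_rate q (n%:R * volume u x))%:E)%E &
      forall w, exists B, [/\ 0 <= B, B `^ q <= U w &
        ((0 < count_box (fun i => X i w) u x)%N /\ forall v, unit_cube v -> lev x v ->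
          (0 < count_box (fun i => X i w) u v)%N ->
          `|ybar (fun i => X i w) (fun i => eps i w) u v| <= B) \/
        forall v, unit_cube v -> lev x v ->
          (0 < count_box (fun i => X i w) zerov v)%N ->
          D + `|ybar (fun i => X i w) (fun i => eps i w) zerov v| <= B]].
Proof.
move=> D0 cx cu ux.
have ux' j : tnth (refl x) j < tnth (refl u) j by rewrite !tnth_refl ltrD2l ltrN2.
have [U [mU U0 EU HU]] := upper_noise q1 sigma0 rho10 n0 (design_model_refl HX)
  (noise_model_refl Heps) D0 (unit_cube_refl cx) (unit_cube_refl cu) ux'.
rewrite volume_refl in EU.
exists U; split => // w; have [B [B0 BU HB]] := HU w; exists B; split => //.
rewrite count_box_refl in HB.
case: HB => [[cnt H]|H]; [left; split => //|right] => v cv xv nv.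
  have := H (refl v) (unit_cube_refl cv); rewrite lev_refl_refl count_box_refl ybar_refl.
  exact.
have := H (refl v) (unit_cube_refl cv).
by rewrite lev_refl_refl -refl0 count_box_refl ybar_refl; exact.
Qed.

(** The positive and the negative part of the error are bounded separately, with v
   and with u. *)
Lemma pointwise_risk (f : d.-tuple R -> R) (fhat : Omega -> R) (u x v : d.-tuple R) (D : R) :
  nondecreasing_on_cube f -> unit_cube u -> unit_cube x -> unit_cube v ->
  (forall j, tnth u j < tnth x j) -> (forall j, tnth x j < tnth v j) ->
  f u = f x -> f v = f x -> D = f onev - f zerov ->
  (forall w, exists2 g, block_estimate (fun i => X i w)
     (fun i => f (X i w) + eps i w) unit_cube g & fhat w = g x) ->
  (\int[P]_w (`|fhat w - f x| `^ q)%:E <=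
    (pointwise_cst (d := d) q rho1 rho2 * (sigma `^ q + D `^ q)
      * (point_rate q (n%:R * volume u x) + point_rate q (n%:R * volume x v)))%:E)%E.
Proof.
move=> mf cu cx cv ux xv fux fvx DE Hfhat.
have [_ cX _ _] := HX.
have D0 : 0 <= D.
  rewrite DE subr_ge0; apply: mf; [exact: unit_cube0|exact: unit_cube1|].
  exact: lev0 unit_cube1.
have [U [mU U0 EU HU]] := upper_noise q1 sigma0 rho10 n0 HX Heps D0 cx cv xv.
have [L [mL L0 EL HL]] := lower_noise D0 cx cu ux.
apply: (@le_trans _ _ (\int[P]_w (L w + U w)%:E)%E); last first.
  rewrite mulrDr; exact: integral_add_le.
apply: ge0_le_integral_nomeas => w _; rewrite lee_fin ?powR_ge0//.
have [g gb ->] := Hfhat w.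
have lxv : lev x v by apply/levP => j; exact: ltW.
have lux : lev u x by apply/levP => j; exact: ltW.
have Dle : f onev - f zerov <= D by rewrite DE.
have q0 : 0 <= q by exact: le_trans q1.
have [B1 [B10 B1U H1]] := HU w.
have [B2 [B20 B2L H2]] := HL w.
have h1 := block_error_le n0 (fun i => cX i w) mf gb cx cv lxv fvx Dle H1.
have h2 := block_error_ge n0 (fun i => cX i w) mf gb cx cu lux fux Dle H2.
have [h|/ltW h] := leP 0 (g x - f x).
  rewrite ger0_norm//; apply: le_trans (ler_powR2 q0 h h1) _.
  by apply: le_trans B1U _; rewrite lerDr.
rewrite ler0_norm// opprB; apply: le_trans (ler_powR2 q0 _ h2) _.
  by rewrite -opprB oppr_ge0.
by apply: le_trans B2L _; rewrite lerDl.
Qed.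

End lower_noise.

Section given_models.
Context {R : realType} {disp : measure_display} {Omega : measurableType disp}.
Context (P : probability Omega R) {d n : nat}.
Variables (X : 'I_n -> {RV P >-> d.-tuple R}) (eps : 'I_n -> {RV P >-> R}).

Lemma iid_design_model (rho1 rho2 : R) : (forall i w, unit_cube (X i w)) ->
  iid X -> design_point_law_bounds rho1 rho2 X ->
  design_model P (fun i => X i : Omega -> d.-tuple R) rho1 rho2.
Proof.
move=> cX [_ indX] bX; split => //.
- move=> u v cu cv uv; split.
    by move=> i; apply: measurable_funPTI; exact: measurable_box.
  move=> J.
  have := indX (fun i => if i \in J then box u v else setT).
  rewrite (_ : \bigcap_(i in _) _ = \bigcap_(i in [set: 'I_n])
     (if i \in J then X i @^-1` box u v else setT)); last first.
    by apply: eq_bigcapr => i _; case: ifP => // _; rewrite preimage_setT.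
  move=> ->; last by move=> i; case: ifP => // _; exact: measurable_box.
  by apply: eq_bigr => i _; case: ifP => // _; rewrite preimage_setT.
- move=> i u v cu cv uv; have := bX i u v cu cv uv.
  rewrite lebesgue_tuple_box// -/(volume u v) -!EFinM.
  have fP : P (X i @^-1` box u v) \is a fin_num.
    by apply: fin_num_measure; apply: measurable_funPTI; exact: measurable_box.
  by rewrite -(fineK fP) !lee_fin.
Qed.

Lemma noise_given_design_model (q sigma : R) : noise_given_design q sigma X eps ->
  noise_model (fun i => X i : Omega -> d.-tuple R) eps (Num.max q 2) sigma.
Proof.
move=> H A mA; exists (noise_law X eps mA); split.
  exact: independent_noise_law H _ mA.
by move=> g g0 mg; rewrite integral_noise_law.
Qed.

End given_models.

(** * Integration over the pieces *)

Section one_dimension.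
Context {R : realType}.
Implicit Types (a b c e r s y M w theta q : R).
Local Notation mu := (@lebesgue_measure R).

Section affine_power.
Variables (alpha beta r : R).
Hypotheses (beta2 : beta * beta = 1) (r1 : r != 1).
Let y s := alpha + beta * s.
Let F s : R := beta / (1 - r) * y s `^ (1 - r).

Let r1' : 1 - r != 0. Proof. by rewrite subr_eq0 eq_sym. Qed.

Let is_derive_y s : is_derive s 1 y beta.
Proof.
have : is_derive s 1 (cst alpha + beta *: id : R -> R) (0 + beta *: (1 : R)).
  exact: is_deriveD.
by rewrite add0r scaler1.
Qed.

Let is_derive_pow s (t : R) : 0 < y s ->
  is_derive s 1 (fun s => y s `^ t) ((t * y s `^ (t - 1)) * beta).
Proof.
move=> ys; have := is_derive1_powR t ys => H.
exact: (is_derive1_comp (f := fun u => u `^ t) (g := y) H (is_derive_y s)).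
Qed.

Lemma integral_affine_power c e : c < e -> 0 < y c -> 0 < y e ->
  (\int[mu]_(s in `[c, e]) (y s `^ (- r))%:E = (F e - F c)%:E)%E.
Proof.
move=> ce yc ye.
have ypos s : c <= s <= e -> 0 < y s.
  move=> /andP[cs se]; rewrite /y in yc ye *.
  have [b0|b0] := leP 0 beta.
    by apply: lt_le_trans yc _; rewrite lerD2l ler_wpM2l.
  by apply: lt_le_trans ye _; rewrite lerD2l ler_wnM2l// ltW.
have dF s : c <= s <= e -> is_derive s 1 F (y s `^ (- r)).
  move=> cse; have := is_derive_pow (1 - r) (ypos s cse) => H.
  have HF := is_deriveZ (beta / (1 - r)) H.
  apply: is_derive_eq HF _.
  rewrite (_ : 1 - r - 1 = - r); last ring.
  rewrite /GRing.scale /=.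
  transitivity ((beta * beta) * y s `^ (- r)); first by field.
  by rewrite beta2 mul1r.
rewrite (@continuous_FTC2 _ (fun s => y s `^ (- r)) F)//.
- apply: continuous_in_subspaceT => s /[!inE] /=; rewrite in_itv /= => cse.
  have := is_derive_pow (- r) (ypos s cse) => H.
  by apply: differentiable_continuous; apply/derivable1_diffP; apply: ex_derive.
- have cF s : c <= s <= e -> {for s, continuous F}.
    move=> cse; have := dF s cse => H.
    by apply: differentiable_continuous; apply/derivable1_diffP; apply: ex_derive.
  split.
  + move=> s; rewrite in_itv /= => /andP[cs se].
    by have := dF s; rewrite !ltW// => /(_ isT) H; apply: ex_derive.
  + by apply: cvg_at_right_filter; apply: cF; rewrite lexx ltW.
  + by apply: cvg_at_left_filter; apply: cF; rewrite lexx ltW.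
- move=> s; rewrite in_itv /= => /andP[cs se]; rewrite derive1E.
  by have := dF s; rewrite !ltW// => /(_ isT) H; apply: derive_val.
Qed.

(** Both signs of beta and both ranges of the exponent at once. *)
Lemma integral_affine_power_le c e K : c < e -> 0 < y c -> 0 < y e ->
  y c `^ (1 - r) <= K -> y e `^ (1 - r) <= K ->
  (\int[mu]_(s in `[c, e]) (y s `^ (- r))%:E <= (`|1 - r|^-1 * K)%:E)%E.
Proof.
move=> ce yc ye Kc Ke; rewrite integral_affine_power// lee_fin /F -mulrBr.
apply: le_trans (ler_norm _) _.
have b1 : `|beta| = 1.
  have : `|beta| ^+ 2 = 1 by rewrite sqr_normr expr2.
  by move/eqP; rewrite sqrp_eq1// => /eqP.
rewrite normrM normrM normfV b1 mul1r ler_wpM2l ?invr_ge0//.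
have c0 := powR_ge0 (y c) (1 - r); have e0 := powR_ge0 (y e) (1 - r).
by rewrite ler_norml; apply/andP; split; lra.
Qed.

Lemma affine_between c e s : c <= s <= e -> Num.min (y c) (y e) <= y s <= Num.max (y c) (y e).
Proof.
move=> /andP[cs se]; rewrite /y; have [b0|b0] := leP 0 beta.
  have h1 := ler_wpM2l b0 cs; have h2 := ler_wpM2l b0 se.
  by rewrite ge_min le_max; apply/andP; split; apply/orP; [left|right]; lra.
have h1 := ler_wnM2l (ltW b0) cs; have h2 := ler_wnM2l (ltW b0) se.
by rewrite ge_min le_max; apply/andP; split; apply/orP; [right|left]; lra.
Qed.

End affine_power.

(** Exhaustion by closed intervals, on which the fundamental theorem of calculus
   applies although the integrand may blow up at the end points. *)
Lemma integral_oo_le (f : R -> \bar R) a b (C : \bar R) :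
  measurable_fun setT f -> (forall s, 0 <= f s)%E -> (0 <= C)%E ->
  (forall c e, a < c -> c < e -> e < b -> (\int[mu]_(s in `[c, e]) f s <= C)%E) ->
  (\int[mu]_(s in `]a, b[) f s <= C)%E.
Proof.
move=> mf f0 C0 H; have [ab|ba] := ltP a b; last first.
  rewrite set_itv_ge ?integral_set0//.
  by rewrite bnd_simp -leNgt.
pose w := b - a; have w0 : 0 < w by rewrite subr_gt0.
pose dl (n : nat) : R := w / n.+3%:R.
have dl0 n : 0 < dl n by rewrite divr_gt0.
have dlh n : dl n <= w / 3 by rewrite ler_pM2l// lef_pV2 ?posrE// ler_nat.
pose E n : set R := [set` `[a + dl n, b - dl n]].
have EU : `]a, b[%classic = \bigcup_n E n.
  apply/seteqP; split => s /=.
    rewrite in_itv /= => /andP[as_ sb].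
    pose m := Num.min (s - a) (b - s).
    have m0 : 0 < m by rewrite lt_min !subr_gt0 as_ sb.
    exists (Num.truncn (w / m)) => //; rewrite /E /= in_itv /=.
    have : dl (Num.truncn (w / m)) <= m.
      rewrite /dl ler_pdivrMr// mulrC -ler_pdivrMr// ltW//.
      by apply: lt_le_trans (truncnS_gt _) _; rewrite ler_nat; do 2 apply: leqW.
    rewrite le_min => /andP[h1 h2]; apply/andP; split; lra.
  move=> [n _]; rewrite /E /= !in_itv /= => /andP[h1 h2].
  by have := dl0 n => ?; apply/andP; split; lra.
rewrite EU.
have nd : nondecreasing_seq E.
  move=> m n mn; apply/subsetPset => s; rewrite /E /= !in_itv /= => /andP[h1 h2].
  have : dl n <= dl m by rewrite ler_pM2l// lef_pV2 ?posrE// ler_nat !ltnS.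
  by move=> ?; apply/andP; split; lra.
have cv : (\int[mu]_(s in E n) f s @[n --> \oo] --> \int[mu]_(s in \bigcup_n E n) f s)%E.
  apply: ge0_nondecreasing_set_cvg_integral => //; first by move=> i; exact: measurable_itv.
  by move=> i; exact: measurable_funTS.
rewrite -(cvg_lim _ cv)//.
apply: lime_le; first by apply/cvg_ex; exists (\int[mu]_(s in \bigcup_n E n) f s)%E.
near=> n; apply: H.
- by rewrite ltrDl.
- by have := dlh n; have := dl0 n; rewrite /w => ? ?; lra.
- by rewrite ltrBlDr ltrDl.
Unshelve. all: by end_near.
Qed.

Lemma measurable_affine (alpha beta : R) : measurable_fun setT (fun s => alpha + beta * s).
Proof. by apply: measurable_funD => //; exact: measurable_funM. Qed.

Lemma measurable_affine_power (alpha beta t : R) :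
  measurable_fun setT (fun s => (alpha + beta * s) `^ t).
Proof. exact: (measurableT_comp (measurable_powR _) (measurable_affine _ _)). Qed.

Lemma integral_side_power (theta alpha beta a b : R) : theta < 1 -> beta * beta = 1 -> a < b ->
  (forall s, a < s < b -> 0 < alpha + beta * s <= b - a) ->
  (\int[mu]_(s in `]a, b[) ((alpha + beta * s) `^ (- theta))%:E
    <= ((b - a) `^ (1 - theta) / (1 - theta))%:E)%E.
Proof.
move=> th1 b2 ab yb; have h : 0 < 1 - theta by rewrite subr_gt0.
have tn1 : theta != 1 by rewrite lt_eqF.
apply: integral_oo_le.
- by apply/measurable_EFinP; exact: measurable_affine_power.
- by move=> s; rewrite lee_fin powR_ge0.
- by rewrite lee_fin divr_ge0 ?powR_ge0// ltW.
move=> c e ac ce eb.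
have /andP[c0 c1] : 0 < alpha + beta * c <= b - a.
  by apply: yb; rewrite ac (lt_trans ce).
have /andP[e0 e1] : 0 < alpha + beta * e <= b - a.
  by apply: yb; rewrite eb (lt_trans ac).
have := @integral_affine_power_le alpha beta theta b2 tn1 c e
  ((b - a) `^ (1 - theta)) ce c0 e0.
move=> H; apply: le_trans (H _ _) _.
- by apply: ler_powR2; rewrite ?(ltW h) ?(ltW c0).
- by apply: ler_powR2; rewrite ?(ltW h) ?(ltW e0).
- by rewrite (gtr0_norm h) mulrC.
Qed.

Lemma integral_split_le (f : R -> \bar R) (c m e : R) : measurable_fun setT f ->
  (forall s, 0 <= f s)%E ->
  (\int[mu]_(s in `[c, e]) f s
    <= \int[mu]_(s in `[c, m]) f s + \int[mu]_(s in `[m, e]) f s)%E.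
Proof.
move=> mf f0; rewrite integral_mkcond [X in (_ <= X + _)%E]integral_mkcond
  [X in (_ <= _ + X)%E]integral_mkcond -ge0_integralD//.
- apply: ge0_le_integral_nomeas => s _; first by apply: erestrict_ge0.
  rewrite !patchE; case: ifPn => [|_]; last by rewrite adde_ge0//; case: ifP.
  rewrite !inE /= !in_itv /= => /andP[cs se].
  have [sm|/ltW ms] := leP s m.
    have -> : s \in `[c, m]%classic by rewrite inE /= in_itv /= cs sm.
    by rewrite leeDl//; case: ifP.
  have -> : s \in `[m, e]%classic by rewrite inE /= in_itv /= ms se.
  by rewrite leeDr//; case: ifP.
- by move=> s _; apply: erestrict_ge0.
- by apply/(measurable_restrictT f) => //; exact: measurable_funTS.
- by move=> s _; apply: erestrict_ge0.
- by apply/(measurable_restrictT f) => //; exact: measurable_funTS.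
Qed.

End one_dimension.

Section first_coordinate.
Context {R : realType}.
Local Notation mu := (@lebesgue_measure R).
Variables (q theta : R).
Hypotheses (th0 : 2^-1 <= theta) (th1 : theta < 1).

Lemma measurable_point_rate : measurable_fun setT (point_rate q : R -> R).
Proof.
rewrite /point_rate; case: (q < 2); first exact: measurable_powR.
by apply: measurable_minr; exact: measurable_powR.
Qed.

(** Constant of [integral_side_rate]: for q > 2 the rate decreases faster than 1 / s,
   which is integrable at infinity and saves one logarithm. *)
Definition tail_cst : R := 2 * (2 + (q / 2 - 1)^-1) + 2.

Let one_piece (alpha beta c e M : R) : 2 < q -> beta * beta = 1 -> c < e -> 0 < M ->
  0 < alpha + beta * c -> 0 < alpha + beta * e ->
  (alpha + beta * c <= M^-1 /\ alpha + beta * e <= M^-1) \/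
  (M^-1 <= alpha + beta * c /\ M^-1 <= alpha + beta * e) ->
  (\int[mu]_(s in `[c, e]) (rate q (M * (alpha + beta * s)))%:E
    <= ((2 + (q / 2 - 1)^-1) / M)%:E)%E.
Proof.
move=> q2 b2 ce M0 c0 e0 H.
have Mi0 : 0 < M^-1 by rewrite invr_gt0.
have r1 : 0 < q / 2 - 1 by lra.
have ypos s : s \in `[c, e] -> 0 < alpha + beta * s.
  rewrite in_itv /= => cse; have /andP[h _] := affine_between alpha beta cse.
  by apply: lt_le_trans h; rewrite lt_min c0 e0.
have bound (t K : R) : t != 1 -> 0 <= K ->
    (alpha + beta * c) `^ (1 - t) <= K -> (alpha + beta * e) `^ (1 - t) <= K ->
    (forall s, 0 < s -> rate q s <= s `^ (- t)) ->
    (\int[mu]_(s in `[c, e]) (rate q (M * (alpha + beta * s)))%:E <=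
      (M `^ (- t) * (`|1 - t|^-1 * K))%:E)%E.
  move=> t1 K0 Kc Ke Ht.
  apply: (@le_trans _ _ (\int[mu]_(s in `[c, e])
      ((M `^ (- t))%:E * ((alpha + beta * s) `^ (- t))%:E))%E).
    apply: ge0_le_integral_nomeas => s /= cs; rewrite -?EFinM lee_fin; first exact: rate_ge0.
    have ys := ypos s cs.
    by rewrite -powRM ?(ltW M0) ?(ltW ys)//; apply: Ht; exact: mulr_gt0.
  rewrite ge0_integralZl//; last 3 first.
  - by apply: measurable_funTS; apply/measurable_EFinP; exact: measurable_affine_power.
  - by move=> s _; rewrite lee_fin powR_ge0.
  - by rewrite lee_fin powR_ge0.
  rewrite [X in (_ <= X)%E]EFinM lee_wpmul2l ?lee_fin ?powR_ge0//.
  exact: integral_affine_power_le.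
have E1 (t : R) : M `^ (- t) * M^-1 `^ (1 - t) = M^-1.
  rewrite powRV ?(ltW M0)// powRN -invfM -powRD_pos// addrC subrK powRr1 ?(ltW M0)//.
have M10 : 0 <= M^-1 by exact: ltW.
case: H => -[Hc He].
  apply: le_trans (bound 2^-1 (M^-1 `^ (1 - 2^-1)) _ _ _ _ _) _.
  - by lra.
  - exact: powR_ge0.
  - by apply: ler_powR2; rewrite ?(ltW c0)//; lra.
  - by apply: ler_powR2; rewrite ?(ltW e0)//; lra.
  - by move=> s s0; rewrite /rate ge_min lexx.
  rewrite mulrCA E1 lee_fin ler_wpM2r// ger0_norm; last by lra.
  rewrite (_ : 1 - 2^-1 = 2^-1); last by field.
  by rewrite invrK lerDl invr_ge0 ltW.
have an : 1 - q / 2 = - (q / 2 - 1) by ring.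
apply: le_trans (bound (q / 2) (M^-1 `^ (1 - q / 2)) _ _ _ _ _) _.
- by apply/eqP => H; lra.
- exact: powR_ge0.
- by rewrite an; apply: powRN_anti => //; exact: ltW.
- by rewrite an; apply: powRN_anti => //; exact: ltW.
- by move=> s s0; rewrite /rate ge_min lexx orbT.
rewrite mulrCA E1 lee_fin ler_wpM2r// an normrN gtr0_norm//.
by rewrite lerDr.
Qed.

(** The side is cut where M (alpha + beta s) = 1, the point at which the rate
   changes its exponent. A side too short to be cut has (b - a) M < 1, and the
   exponent 1/2 serves on all of it. *)
Lemma integral_side_rate (alpha beta a b M : R) : 2 < q -> beta * beta = 1 -> a < b ->
  0 < M -> (forall s, a < s < b -> 0 < alpha + beta * s <= b - a) ->
  (\int[mu]_(s in `]a, b[) (rate q (M * (alpha + beta * s)))%:E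
    <= (tail_cst * ((b - a) * ((b - a) * M) `^ (- theta)))%:E)%E.
Proof.
move=> q2 b2 ab M0 yb.
have mrate : measurable_fun setT (fun s => (rate q (M * (alpha + beta * s)))%:E).
  apply/measurable_EFinP; apply: (measurableT_comp (f := rate q)).
    by apply: measurable_minr; exact: measurable_powR.
  by apply: measurable_funM => //; exact: measurable_affine.
pose A := 2 + (q / 2 - 1)^-1.
have A0 : 0 < A by rewrite addr_gt0// invr_gt0; lra.
pose w := b - a; have w0 : 0 < w by rewrite subr_gt0.
have wM0 : 0 < w * M by exact: mulr_gt0.
have [wM|wM] := leP 1 (w * M).
  have h1 : (\int[mu]_(s in `]a, b[) (rate q (M * (alpha + beta * s)))%:E
      <= (2 * (A / M))%:E)%E.
    apply: integral_oo_le => //.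
    - by move=> s; rewrite lee_fin rate_ge0.
    - by rewrite lee_fin mulr_ge0// divr_ge0// ltW.
    move=> c e ac ce eb.
    have /andP[c0 _] : 0 < alpha + beta * c <= b - a by apply: yb; rewrite ac (lt_trans ce).
    have /andP[e0 _] : 0 < alpha + beta * e <= b - a by apply: yb; rewrite eb (lt_trans ac).
    have AM0 : 0 <= A / M by rewrite divr_ge0// ltW.
    have one c' e' := @one_piece alpha beta c' e' M q2 b2.
    have le2 : ((A / M)%:E <= (2 * (A / M))%:E)%E by rewrite lee_fin ler_peMl// ler1n.
    have cross : (alpha + beta * c < M^-1 < alpha + beta * e) \/
        (alpha + beta * e < M^-1 < alpha + beta * c) ->
        (\int[mu]_(s in `[c, e]) (rate q (M * (alpha + beta * s)))%:E <= (2 * (A / M))%:E)%E.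
      move=> H; pose m := beta * (M^-1 - alpha).
      have ym : alpha + beta * m = M^-1 by rewrite /m mulrA b2 mul1r addrC subrK.
      have mc : m - c = beta * (M^-1 - (alpha + beta * c)).
        rewrite -ym; have -> : alpha + beta * m - (alpha + beta * c) = beta * (m - c) by ring.
        by rewrite mulrA b2 mul1r.
      have em : e - m = beta * (alpha + beta * e - M^-1).
        rewrite -ym; have -> : alpha + beta * e - (alpha + beta * m) = beta * (e - m) by ring.
        by rewrite mulrA b2 mul1r.
      have ec : 0 < beta * (alpha + beta * e - (alpha + beta * c)).
        have -> : beta * (alpha + beta * e - (alpha + beta * c)) = (beta * beta) * (e - c) by ring.
        by rewrite b2 mul1r subr_gt0.
      have /andP[cm me] : (c < m < e).
        rewrite -[c < m]subr_gt0 -[m < e]subr_gt0 mc em.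
        case: H => /andP[h1 h2].
          have bp : 0 < beta by rewrite -(pmulr_lgt0 _ (_ : 0 < alpha + beta * e - (alpha + beta * c)))//; lra.
          by rewrite !mulr_gt0// subr_gt0.
        have bn : beta < 0 by rewrite -(nmulr_lgt0 _ (_ : alpha + beta * e - (alpha + beta * c) < 0))//; lra.
        by rewrite !nmulr_rgt0// !subr_lt0 h1 h2.
      have ym0 : 0 < alpha + beta * m by rewrite ym invr_gt0.
      apply: le_trans (integral_split_le c m e mrate _) _.
        by move=> s; rewrite lee_fin rate_ge0.
      rewrite mulr_natl mulr2n EFinD; apply: leeD.
        apply: one => //; rewrite ym lexx; case: H => /andP[h1 h2]; [left|right];
          by split => //; exact: ltW.
      apply: one => //; rewrite ym lexx; case: H => /andP[h1 h2]; [right|left];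
        by split => //; exact: ltW.
    have [hc|hc] := leP (alpha + beta * c) M^-1; have [he|he] := leP (alpha + beta * e) M^-1.
    - exact: le_trans (one c e ce M0 c0 e0 (or_introl (conj hc he))) le2.
    - move: hc; rewrite le_eqVlt => /predU1P[hc|hc].
        apply: le_trans (one c e ce M0 c0 e0 (or_intror (conj _ (ltW he)))) le2.
        by rewrite hc.
      by apply: cross; left; rewrite hc he.
    - move: he; rewrite le_eqVlt => /predU1P[he|he].
        apply: le_trans (one c e ce M0 c0 e0 (or_intror (conj (ltW hc) _))) le2.
        by rewrite he.
      by apply: cross; right; rewrite hc he.
    - exact: le_trans (one c e ce M0 c0 e0 (or_intror (conj (ltW hc) (ltW he)))) le2.
  apply: le_trans h1 _; rewrite lee_fin /tail_cst -/A -/w.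
  have -> : 2 * (A / M) = 2 * A * (w * (w * M) `^ (-1)).
    by rewrite powR_inv1 ?(ltW wM0)//; field; rewrite !gt_eqF.
  apply: ler_pM.
  - by rewrite mulr_ge0// ltW.
  - by rewrite mulr_ge0 ?powR_ge0// ltW.
  - by rewrite lerDl.
  - by rewrite ler_wpM2l ?(ltW w0)// ler_powR// lerN2 ltW.
have h2 : (\int[mu]_(s in `]a, b[) (rate q (M * (alpha + beta * s)))%:E
    <= (M `^ (- 2^-1) * (w `^ (1 - 2^-1) / (1 - 2^-1)))%:E)%E.
  apply: (@le_trans _ _ (\int[mu]_(s in `]a, b[)
      ((M `^ (- 2^-1))%:E * ((alpha + beta * s) `^ (- 2^-1))%:E))%E).
    apply: ge0_le_integral_nomeas => s /=; rewrite in_itv /= => cs;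
      rewrite -?EFinM lee_fin; first exact: rate_ge0.
    have /andP[ys _] := yb s cs.
    by rewrite -powRM ?(ltW M0) ?(ltW ys)// /rate ge_min lexx.
  rewrite ge0_integralZl//; last 3 first.
  - by apply: measurable_funTS; apply/measurable_EFinP; exact: measurable_affine_power.
  - by move=> s _; rewrite lee_fin powR_ge0.
  - by rewrite lee_fin powR_ge0.
  rewrite [X in (_ <= X)%E]EFinM lee_wpmul2l ?lee_fin ?powR_ge0//.
  by apply: integral_side_power => //; lra.
apply: le_trans h2 _; rewrite lee_fin -/w.
have h : (1 - 2^-1 : R) = 2^-1 by field.
rewrite h invrK.
have -> : M `^ (- 2^-1) * (w `^ 2^-1 * 2) = 2 * (w * (w * M) `^ (- 2^-1)).
  have ww : w `^ 2^-1 = w * w `^ (- 2^-1).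
    rewrite -[X in _ = X * _]powRr1 ?(ltW w0)// -powRD_pos//.
    by congr (_ `^ _); field.
  by rewrite powRM ?(ltW w0) ?(ltW M0)// ww; ring.
apply: ler_pM => //.
- by rewrite mulr_ge0 ?powR_ge0// ltW.
- by rewrite lerDr mulr_ge0// ltW.
- rewrite ler_wpM2l ?(ltW w0)// !powRN -!powRV ?(ltW wM0)// ler_powR//.
  by rewrite invf_ge1// ltW.
Qed.

End first_coordinate.

(** ** Integrals over boxes of any dimension *)

Section tuple_integral.
Context {R : realType}.
Local Notation mu := (@lebesgue_measure R).

Lemma integral_tuple_cons d (H : d.+1.-tuple R -> \bar R) :
  measurable_fun setT H -> (forall x, 0 <= H x)%E ->
  (\int[lebesgue_tuple d.+1]_x H x =
   \int[lebesgue_tuple d]_t \int[mu]_s H (tuple_cons (s, t)))%E.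
Proof.
move=> mH H0.
transitivity (\int[pushforward (mu \x lebesgue_tuple d) (@tuple_cons R d)]_x H x)%E.
  apply: eq_measure_integral => [|mphi A _ _]; first exact: measurable_tuple_cons.
  exact: erefl.
rewrite ge0_integral_pushforward//; last exact: measurable_tuple_cons.
rewrite preimage_setT fubini_tonelli2//.
  exact: measurableT_comp mH (@measurable_tuple_cons R d).
by move=> z; exact: H0.
Qed.

Lemma measurable_coordinates d (F : 'I_d -> R -> R) :
  (forall j, measurable_fun setT (F j)) ->
  measurable_fun setT (fun x : d.-tuple R => \prod_(j < d) F j (tnth x j)).
Proof.
move=> mF; apply: measurable_prod => j _.
by apply: (measurableT_comp (mF j)); exact: measurable_tnth.
Qed.

Lemma integral_product_le d (F : 'I_d -> R -> R) (c : 'I_d -> R) :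
  (forall j, measurable_fun setT (F j)) -> (forall j s, 0 <= F j s) ->
  (forall j, 0 <= c j) -> (forall j, \int[mu]_s (F j s)%:E <= (c j)%:E)%E ->
  (\int[lebesgue_tuple d]_x (\prod_(j < d) F j (tnth x j))%:E
    <= (\prod_(j < d) c j)%:E)%E.
Proof.
elim: d F c => [|d IH] F c mF F0 c0 Fc.
  rewrite /= big_ord0; under eq_integral do rewrite big_ord0.
  by rewrite integral_dirac// diracT mul1e.
rewrite integral_tuple_cons; last 2 first.
- by apply/measurable_EFinP; exact: measurable_coordinates.
- by move=> x; rewrite lee_fin prodr_ge0.
pose F' (j : 'I_d) := F (lift ord0 j).
apply: (@le_trans _ _ (\int[lebesgue_tuple d]_t
   ((c ord0)%:E * (\prod_(j < d) F' j (tnth t j))%:E))%E).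
  apply: ge0_le_integral_nomeas => t _.
    by apply: integral_ge0 => s _; rewrite lee_fin prodr_ge0.
  have E s : ((\prod_(j < d.+1) F j (tnth (tuple_cons (s, t)) j))%:E =
      (\prod_(j < d) F' j (tnth t j))%:E * (F ord0 s)%:E)%E.
    rewrite big_ord_recl -EFinM mulrC; congr (_ * _)%:E.
    by apply: eq_bigr => j _; rewrite /tuple_cons tnthS.
  under eq_integral do rewrite E.
  rewrite ge0_integralZl//; last 3 first.
  - by apply/measurable_EFinP; exact: mF.
  - by move=> s _; rewrite lee_fin.
  - by rewrite lee_fin prodr_ge0// => j _; exact: F0.
  rewrite muleC; apply: lee_wpmul2r; last exact: Fc.
  by rewrite lee_fin prodr_ge0// => j _; exact: F0.
rewrite ge0_integralZl//; last 3 first.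
- by apply/measurable_EFinP; apply: measurable_coordinates => j; exact: mF.
- by move=> t _; rewrite lee_fin prodr_ge0// => j _; exact: F0.
- by rewrite lee_fin.
rewrite big_ord_recl EFinM lee_wpmul2l ?lee_fin//.
by apply: IH => [j|j s|j|j]; [exact: mF|exact: F0|exact: c0|exact: Fc].
Qed.

End tuple_integral.

Section piece_integral.
Context {R : realType}.
Local Notation mu := (@lebesgue_measure R).
Variables (q theta : R).
Hypotheses (th0 : 2^-1 <= theta) (th1 : theta < 1).
Hypothesis compat : forall s, q <= 2 -> 0 < s -> point_rate q s <= s `^ (- theta).

Lemma powR_prod d (g : 'I_d -> R) (r : R) : (forall j, 0 <= g j) ->
  (\prod_(j < d) g j) `^ r = \prod_(j < d) g j `^ r.
Proof.
move=> g0; elim: d g g0 => [|d IH] g g0; first by rewrite !big_ord0 powR1.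
by rewrite !big_ord_recl powRM ?g0 ?prodr_ge0// IH.
Qed.

Definition coord_cst : R := if 2 < q then tail_cst q else (1 - theta)^-1.

Lemma coord_cst_ge0 : 0 <= coord_cst.
Proof.
rewrite /coord_cst; case: ifP => q2; last by rewrite invr_ge0 subr_ge0 ltW.
have : 0 < q / 2 - 1 by lra.
by move=> h; rewrite addr_ge0// mulr_ge0// addr_ge0// invr_ge0 ltW.
Qed.

Lemma integral_side_point_rate (alpha beta a b M : R) : beta * beta = 1 -> a < b ->
  0 < M -> (forall s, a < s < b -> 0 < alpha + beta * s <= b - a) ->
  (\int[mu]_(s in `]a, b[) (point_rate q (M * (alpha + beta * s)))%:E
    <= (coord_cst * ((b - a) * ((b - a) * M) `^ (- theta)))%:E)%E.
Proof.
move=> b2 ab M0 yb; rewrite /coord_cst; case: ltP => q2.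
  have E s : point_rate q s = rate q s by rewrite /point_rate ltNge (ltW q2).
  under eq_integral do rewrite E.
  exact: integral_side_rate.
apply: (@le_trans _ _ (\int[mu]_(s in `]a, b[)
    ((M `^ (- theta))%:E * ((alpha + beta * s) `^ (- theta))%:E))%E).
  apply: ge0_le_integral_nomeas => s /=; rewrite in_itv /= => cs;
    rewrite -?EFinM lee_fin; first exact: point_rate_ge0.
  have /andP[ys _] := yb s cs.
  by rewrite -powRM ?(ltW M0) ?(ltW ys)//; apply: compat => //; exact: mulr_gt0.
rewrite ge0_integralZl//; last 3 first.
- by apply: measurable_funTS; apply/measurable_EFinP; exact: measurable_affine_power.
- by move=> s _; rewrite lee_fin powR_ge0.
- by rewrite lee_fin powR_ge0.
apply: (@le_trans _ _ ((M `^ (- theta))%:E * ((b - a) `^ (1 - theta) / (1 - theta))%:E)%E).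
  rewrite lee_wpmul2l ?lee_fin ?powR_ge0//.
  exact: integral_side_power.
have w0 : 0 < b - a by rewrite subr_gt0.
rewrite -EFinM lee_fin powRM ?(ltW w0) ?(ltW M0)// powRD_pos// powRr1 ?(ltW w0)//.
by rewrite le_eqVlt; apply/orP; left; apply/eqP; ring.
Qed.

Definition open_box d (a b : 'I_d -> R) : set (d.-tuple R) :=
  [set x | forall j, a j < tnth x j < b j].

Lemma indic_open_box d (a b : 'I_d -> R) x :
  \1_(open_box a b) x = \prod_(j < d) \1_`]a j, b j[ (tnth x j) :> R.
Proof.
rewrite indicE; case: (boolP (x \in _)) => [/[!inE] H|].
  by rewrite big1// => j _; rewrite indicE mem_set//= in_itv /=; exact: H.
rewrite notin_setE => H; symmetry.
have [j Hj] : exists j, ~ (a j < tnth x j < b j) by exact/existsNP.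
by rewrite (bigD1 j)//= indicE memNset ?mul0r//= in_itv.
Qed.

(** Integrating the first coordinate costs [coord_cst] and leaves the power - theta
   of the other sides, each of which then costs 1 / (1 - theta). Only the first
   coordinate can profit from the decay of the rate at infinity. *)
Lemma integral_piece d (a b alpha beta : 'I_d.+1 -> R) (kap : R) :
  0 < kap -> (forall j, a j < b j) -> (forall j, beta j * beta j = 1) ->
  (forall j s, a j < s < b j -> 0 < alpha j + beta j * s <= b j - a j) ->
  (\int[lebesgue_tuple d.+1]_(x in open_box a b)
     (point_rate q (kap * \prod_(j < d.+1) (alpha j + beta j * tnth x j)))%:E
   <= (coord_cst * (kap `^ (- theta) * ((1 - theta)^-1 ^+ d
        * (\prod_(j < d.+1) (b j - a j)) `^ (1 - theta))))%:E)%E.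
Proof.
move=> kap0 ab b2 yb.
pose y j s := alpha j + beta j * s.
pose w j := b j - a j.
have w0 j : 0 < w j by rewrite subr_gt0.
have my j : measurable_fun setT (y j) by exact: measurable_affine.
pose I j : R -> R := \1_`]a j, b j[.
have mI j : measurable_fun setT (I j) by exact: measurable_indic.
pose H (x : d.+1.-tuple R) : R :=
  \prod_(j < d.+1) I j (tnth x j) * point_rate q (kap * \prod_(j < d.+1) y j (tnth x j)).
have I0 j s : 0 <= I j s by rewrite /I indicE.
have H0 x : 0 <= H x by rewrite mulr_ge0 ?point_rate_ge0// prodr_ge0.
have mH : measurable_fun setT H.
  apply: measurable_funM; first exact: measurable_coordinates.
  apply: (measurableT_comp (f := point_rate q)); first exact: measurable_point_rate.
  by apply: measurable_funM => //; exact: measurable_coordinates.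
rewrite integral_mkcond.
rewrite (_ : _ \_ _ = EFin \o H); last first.
  apply/funext => x; rewrite patchE /H /= -indic_open_box indicE.
  by case: ifP => _; rewrite ?mul1r ?mul0r.
rewrite integral_tuple_cons; last 2 first.
- exact/measurable_EFinP.
- by move=> x; rewrite lee_fin.
pose I' (j : 'I_d) := I (lift ord0 j); pose y' (j : 'I_d) := y (lift ord0 j).
pose w' (j : 'I_d) := w (lift ord0 j).
pose C := coord_cst * (kap `^ (- theta) * w ord0 `^ (1 - theta)).
have C0 : 0 <= C by rewrite mulr_ge0 ?coord_cst_ge0// mulr_ge0// powR_ge0.
pose F (j : 'I_d) (s : R) : R := I' j s * y' j s `^ (- theta).
have F0 j s : 0 <= F j s by rewrite mulr_ge0 ?powR_ge0.
have mF j : measurable_fun setT (F j).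
  by apply: measurable_funM; [exact: mI|exact: measurable_affine_power].
apply: (@le_trans _ _ (\int[lebesgue_tuple d]_t
   (C%:E * (\prod_(j < d) F j (tnth t j))%:E))%E).
  apply: ge0_le_integral_nomeas => t _.
    by apply: integral_ge0 => s _; rewrite lee_fin.
  pose P := \prod_(j < d) I' j (tnth t j).
  pose Y := \prod_(j < d) y' j (tnth t j).
  have HE s : (EFin \o H) (tuple_cons (s, t)) =
      (P * (I ord0 s * point_rate q (kap * Y * y ord0 s)))%:E.
    rewrite /= /H !big_ord_recl /tuple_cons tnth0.
    have -> : \prod_(i < d) I (lift ord0 i) (tnth [tuple of (s, t).1 :: (s, t).2] (lift ord0 i)) = P.
      by apply: eq_bigr => j _; rewrite tnthS.
    have -> : \prod_(i < d) y (lift ord0 i) (tnth [tuple of (s, t).1 :: (s, t).2] (lift ord0 i)) = Y.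
      by apply: eq_bigr => j _; rewrite tnthS.
    have -> : kap * (y ord0 s * Y) = kap * Y * y ord0 s by ring.
    by congr EFin; rewrite /=; ring.
  have [tin|tout] := pselect (open_box (fun j => a (lift ord0 j)) (fun j => b (lift ord0 j)) t); last first.
    have P0 : P = 0.
      have := indic_open_box (fun j => a (lift ord0 j)) (fun j => b (lift ord0 j)) t.
      by rewrite indicE memNset// => /esym.
    under eq_integral do rewrite HE P0 mul0r.
    by rewrite integral0 mule_ge0 ?lee_fin// prodr_ge0.
  have y'0 j : 0 < y' j (tnth t j) by have /andP[] := yb (lift ord0 j) _ (tin j).
  have Y0 : 0 < Y by rewrite prodr_gt0.
  have PI : P = 1.
    have := indic_open_box (fun j => a (lift ord0 j)) (fun j => b (lift ord0 j)) t.
    by rewrite indicE mem_set// => /esym.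
  under eq_integral do rewrite HE PI mul1r.
  have -> : (\int[mu]_s (I ord0 s * point_rate q (kap * Y * y ord0 s))%:E =
      \int[mu]_(s in `]a ord0, b ord0[) (point_rate q (kap * Y * y ord0 s))%:E)%E.
    rewrite [RHS]integral_mkcond; apply: eq_integral => s _.
    by rewrite patchE /I indicE; case: ifP => _; rewrite ?mul1r ?mul0r.
  have kY0 : 0 < kap * Y by rewrite mulr_gt0.
  apply: le_trans (integral_side_point_rate (b2 ord0) (ab ord0) kY0 (yb ord0)) _.
  have -> : \prod_(j < d) F j (tnth t j) = Y `^ (- theta).
    rewrite powR_prod; last by move=> j; exact: ltW.
    rewrite /F big_split /= [X in X * _](_ : _ = P)// PI mul1r//.
  rewrite -EFinM lee_fin -/(w ord0) !powRM ?(ltW kY0) ?(ltW (w0 _)) ?(ltW kap0) ?(ltW Y0)//.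
  rewrite /C powRD_pos// powRr1 ?(ltW (w0 _))//.
  by rewrite le_eqVlt; apply/orP; left; apply/eqP; ring.
pose c j := w' j `^ (1 - theta) / (1 - theta).
have c0 j : 0 <= c j by rewrite divr_ge0 ?powR_ge0// subr_ge0 ltW.
have Fc j : (\int[mu]_s (F j s)%:E <= (c j)%:E)%E.
  have -> : (\int[mu]_s (F j s)%:E =
      \int[mu]_(s in `]a (lift ord0 j), b (lift ord0 j)[) (y' j s `^ (- theta))%:E)%E.
    rewrite [RHS]integral_mkcond; apply: eq_integral => s _.
    by rewrite patchE /F /I' /I indicE; case: ifP => _; rewrite ?mul1r ?mul0r.
  exact: integral_side_power (yb _).
rewrite ge0_integralZl//; last 2 first.
- by apply/measurable_EFinP; exact: measurable_coordinates.
- by move=> t _; rewrite lee_fin prodr_ge0.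
apply: (@le_trans _ _ (C%:E * (\prod_(j < d) c j)%:E)%E).
  by rewrite lee_wpmul2l ?lee_fin//; exact: integral_product_le.
rewrite -EFinM lee_fin /c big_split /= prodr_const card_ord.
rewrite big_ord_recl powRM ?(ltW (w0 _)) ?prodr_ge0//; last first.
  by move=> j _; exact: ltW (w0 _).
rewrite /C powR_prod; last by move=> j; exact: ltW (w0 _).
rewrite /w' /w.
by rewrite le_eqVlt; apply/orP; left; apply/eqP; ring.
Qed.

End piece_integral.

(** * From one piece of constancy to the integrated risk *)

Section exponent.
Context {R : realType}.
Variables q L : R.
Hypotheses (q1 : 1 <= q) (L1 : 1 <= L).

(** The integrals of the powers - theta of the distances to the faces converge
   for theta < 1 only. For q < 2 this is the exponent q / 2 of the pointwise
   rate; for q >= 2 the critical exponent 1 is approached at the distance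
   1 / (2 L), so that 1 / (1 - theta) = 2 L replaces a logarithm. *)
Definition exponent : R := if q < 2 then q / 2 else 1 - (2 * L)^-1.

Lemma exponent_ge : 2^-1 <= exponent.
Proof.
rewrite /exponent; case: ifP => _; first by have := q1; lra.
have L0 : 0 < L by apply: lt_le_trans L1.
have : (2 * L)^-1 <= 2^-1 by rewrite lef_pV2 ?posrE ?mulr_gt0// ler_peMr.
lra.
Qed.

Lemma exponent_lt1 : exponent < 1.
Proof.
rewrite /exponent; case: ifP => q2; first by lra.
have : 0 < (2 * L)^-1 by rewrite invr_gt0 mulr_gt0//; exact: lt_le_trans L1.
lra.
Qed.

Lemma point_rate_le_exponent s : q <= 2 -> 0 < s ->
  point_rate q s <= s `^ (- exponent).
Proof.
rewrite le_eqVlt => /predU1P[q2|q2] s0; last by rewrite /point_rate /exponent q2.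
have := exponent_ge; have := exponent_lt1.
rewrite /point_rate q2 ltxx => th1 th0.
rewrite /rate divff//; have [s1|s1] := leP s 1.
  rewrite ge_min; apply/orP; left.
  apply: ger_powR; first by rewrite s0.
  by rewrite lerN2.
rewrite ge_min; apply/orP; right; apply: ler_powR; first exact: ltW.
by rewrite lerN2 ltW.
Qed.

Definition log_cst (d : nat) : R :=
  if q < 2 then (1 - q / 2)^-1 ^+ d.+1
  else if q == 2 then 2 ^+ d.+1 else tail_cst q * 2 ^+ d.

(** The powers of L are the logarithms of the final bound. For q = 2 each of the
   d + 1 coordinates contributes one; for q > 2 the first one does not; for q < 2
   the exponent stays away from 1. *)
Lemma coord_cst_log d :
  coord_cst q exponent * (1 - exponent)^-1 ^+ d =
  log_cst d * L ^+ (d.+1 * (q == 2) + d * (2 < q)%R).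
Proof.
have L0 : L != 0 by rewrite gt_eqF//; exact: lt_le_trans L1.
rewrite /coord_cst /log_cst /exponent.
have E : (1 - (1 - (2 * L)^-1))^-1 = 2 * L by rewrite opprB addrC subrK invrK.
case: (ltgtP q 2) => q2; rewrite ?E ?muln0 ?muln1 ?addn0 ?add0n.
- by rewrite mulr1 exprS.
- by rewrite exprMn mulrA.
- by rewrite -exprS exprMn.
Qed.

(** The loss from using the exponent 1 - 1 / (2 L) instead of 1 is the factor
   (n / k)^(1 / (2 L)), which is bounded because L is at least ln (n / k). *)
Lemma powR_exponent_le (k n : nat) : (0 < k <= n)%N -> L = logp (n%:R / k%:R) ->
  (k%:R / n%:R) `^ exponent <= expR 1 * (k%:R / n%:R) `^ Num.min 1 (q / 2).
Proof.
move=> /andP[k0 kn] LE.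
have n0 : (0 < n)%N by exact: leq_trans kn.
have e1 : 1 <= expR 1 :> R by apply: le_trans (expR_ge1Dx 1); lra.
pose r : R := k%:R / n%:R.
have r0 : 0 < r by rewrite divr_gt0// ltr0n.
rewrite /exponent; case: ltP => q2.
  have -> : Num.min 1 (q / 2) = q / 2 by apply/min_idPr; lra.
  by rewrite ler_peMl// powR_ge0.
have -> : Num.min 1 (q / 2) = 1 by apply/min_idPl; lra.
rewrite -/r powRD_pos// mulrC ler_wpM2r ?powR_ge0// powRN -powRV ?(ltW r0)//.
have -> : r^-1 = n%:R / k%:R by rewrite invf_div.
rewrite /powR gt_eqF ?divr_gt0 ?ltr0n// ler_expR.
have L0 : 0 < L by apply: lt_le_trans L1.
rewrite mulrC ler_pdivrMr ?mul1r; last by rewrite mulr_gt0.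
have : ln (n%:R / k%:R) <= L by rewrite LE /logp le_max lexx orbT.
by have := L0; lra.
Qed.

End exponent.

Section sum_of_powers.
Context {R : realType}.

(** For a concave power, k equal volumes are the worst case, up to the constant. *)
Lemma sum_powR_le (k : nat) (theta c : R) (V : 'I_k -> R) :
  0 <= theta <= 1 -> (0 < k)%N -> (forall i, 0 <= V i) -> \sum_(i < k) V i <= c ->
  \sum_(i < k) V i `^ (1 - theta) <= (1 + c) * k%:R `^ theta.
Proof.
move=> /andP[th0 th1] k0 V0 Vc.
have K0 : 0 < k%:R :> R by rewrite ltr0n.
have one i : V i `^ (1 - theta) <= (1 + k%:R * V i) * k%:R `^ (theta - 1).
  have -> : V i `^ (1 - theta) = (k%:R * V i) `^ (1 - theta) * k%:R `^ (theta - 1).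
    rewrite powRM// ?ltW// mulrAC -powRD_pos//.
    have -> : 1 - theta + (theta - 1) = 0 by ring.
    by rewrite powRr0 mul1r.
  rewrite ler_wpM2r ?powR_ge0//; have y0 : 0 <= k%:R * V i by rewrite mulr_ge0// ltW.
  have [y1|y1] := leP (k%:R * V i) 1.
    apply: (@le_trans _ _ 1); last by rewrite lerDl.
    have := @ler_powR2 _ (1 - theta) (k%:R * V i) 1.
    by rewrite powR1; apply => //; rewrite subr_ge0.
  apply: (@le_trans _ _ (k%:R * V i)); last by rewrite lerDr.
  rewrite -[leRHS]powRr1//; apply: ler_powR; first exact: ltW.
  lra.
apply: (@le_trans _ _ (\sum_(i < k) (1 + k%:R * V i) * k%:R `^ (theta - 1))).
  by apply: ler_sum => i _; exact: one.
rewrite -mulr_suml big_split /= sumr_const card_ord -mulr_sumr.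
have -> : k%:R `^ theta = k%:R * k%:R `^ (theta - 1) :> R.
  by rewrite -{2}(powRr1 (ltW K0)) -powRD_pos// addrC subrK.
rewrite mulrA ler_wpM2r ?powR_ge0// -[X in X + _]mulr1 -mulrDr mulrC ler_wpM2r ?(ltW K0)//.
by rewrite lerD2l.
Qed.

End sum_of_powers.

Section cover.
Context d (T : measurableType d) (R : realType).
Variable mu : {measure set T -> \bar R}.

(** Neither D nor h is measurable in general: their integral is compared with
   measurable majorants on a measurable cover. *)
Lemma integral_cover_le (I : finType) (D : set T) (A : I -> set T)
    (h : T -> \bar R) (G : I -> T -> \bar R) :
  (forall i, measurable (A i)) -> D `<=` \bigcup_i A i ->
  (forall i, measurable_fun setT (G i)) -> (forall i x, (0 <= G i x)%E) ->
  (forall x, D x -> (0 <= h x)%E) -> (forall i x, D x -> A i x -> (h x <= G i x)%E) ->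
  (\int[mu]_(x in D) h x <= \sum_(i : I) \int[mu]_(x in A i) G i x)%E.
Proof.
move=> mA DA mG G0 h0 hG.
apply: (@le_trans _ _ (\int[mu]_x \sum_(i : I) (G i \_ (A i)) x)%E).
  rewrite integral_mkcond; apply: ge0_le_integral_nomeas => x _.
    by rewrite patchE; case: ifPn => // /[!inE] /h0.
  have S0 : (0 <= \sum_(i : I) (G i \_ (A i)) x)%E.
    by apply: sume_ge0 => i _; apply: erestrict_ge0.
  rewrite patchE; case: ifPn => // /[!inE] Dx.
  have [i _ Ax] := DA x Dx.
  rewrite (bigD1 i)//= patchE mem_set//; apply: le_trans (hG i x Dx Ax) _.
  by rewrite leeDl// sume_ge0// => j _; apply: erestrict_ge0.
rewrite ge0_integral_sum//.
- by apply: lee_sum => i _; rewrite -integral_mkcond.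
- by move=> i; apply/(measurable_restrictT _ _).1 => //; exact: measurable_funTS.
- by move=> i x _; apply: erestrict_ge0.
Qed.

End cover.

Section pieces.
Context {R : realType} {d : nat}.
Implicit Types (a b : 'I_d -> R) (x u v : d.-tuple R).

Lemma hyperrectangle_corners (B : set (d.-tuple R)) : hyperrectangle B ->
  exists a b : 'I_d -> R, open_box a b `<=` B /\
    forall x, B x -> forall j, a j <= tnth x j <= b j.
Proof.
move=> [a [b [l [r ->]]]]; exists (tnth a), (tnth b); split.
  move=> x xab j /=; have /andP[ax xb] := xab j.
  rewrite in_itv; case: (l j); case: (r j); rewrite /= ?ax ?xb ?(ltW ax) ?(ltW xb)//.
move=> x xB j; have := xB j; rewrite in_itv => /andP[].
by case: (l j); case: (r j); rewrite !/= => h1 h2; rewrite ?h1 ?h2 ?ltW.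
Qed.

Lemma measurable_open_box a b : measurable (open_box a b).
Proof.
rewrite (_ : open_box a b = \bigcap_(j in [set: 'I_d])
    ((@tnth d R)^~ j @^-1` `]a j, b j[)).
  apply: fin_bigcap_measurable => // j _.
  by rewrite -[X in measurable X]setTI; exact: measurable_tnth.
apply/seteqP; split => x; first by move=> h j _; rewrite /= in_itv /= h.
by move=> h j; have := h j I; rewrite /= in_itv.
Qed.

Definition face (j : 'I_d) (c : R) : set (d.-tuple R) :=
  [set x | unit_cube x /\ tnth x j = c].

(** A face in the cube is a closed box one side of which has length 0. *)
Lemma face_null j c : measurable (face j c) /\ lebesgue_tuple d (face j c) = 0%E.
Proof.
have [c01|c01] := boolP (0 <= c <= 1); last first.
  rewrite (_ : face j c = set0) ?measure0//; apply/seteqP; split => // x [cx xc].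
  by have /unit_cubeP/(_ j) := cx; rewrite xc (negbTE c01).
have /andP[c0 c1] := c01.
pose u : d.-tuple R := [tuple if i == j then c else 0 | i < d].
pose v : d.-tuple R := [tuple if i == j then c else 1 | i < d].
have -> : face j c = box u v.
  apply/seteqP; split => x.
    move=> [/unit_cubeP cx xc]; apply/andP; split; apply/levP => i;
      rewrite tnth_mktuple; case: eqP => [->|_]; rewrite ?xc//;
      by have /andP[] := cx i.
  move=> /andP[/levP ux /levP xv]; split.
    apply/unit_cubeP => i; move: (ux i) (xv i); rewrite !tnth_mktuple.
    case: ifP => _ h1 h2; last by rewrite h1 h2.
    by rewrite (le_trans c0 h1) (le_trans h2 c1).
  by apply/eqP; rewrite eq_le; move: (ux j) (xv j); rewrite !tnth_mktuple eqxx => -> ->.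
split; first exact: measurable_box.
rewrite lebesgue_tuple_box; last first.
  by apply/levP => i; rewrite !tnth_mktuple; case: ifP => // _; exact: ler01.
by rewrite (bigD1 j)//= !tnth_mktuple eqxx subrr mul0r.
Qed.

(** Pieces with a side reduced to a point have volume 0, whatever the product of
   the other sides. *)
Definition box_volume a b : R :=
  if [forall j, a j < b j] then \prod_(j < d) (b j - a j) else 0.

Lemma box_volume_ge0 a b : 0 <= box_volume a b.
Proof.
rewrite /box_volume; case: ifP => // /forallP ab.
by apply: prodr_ge0 => j _; rewrite subr_ge0 ltW.
Qed.

(** Each piece contains a closed box with sides half as long, whose measure is
   known; these boxes are disjoint and lie in the cube, of measure 1. *)
Lemma sum_box_volume_le (k : nat) (B : 'I_k -> set (d.-tuple R))
    (a b : 'I_k -> 'I_d -> R) :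
  trivIset setT B -> (forall i, B i `<=` unit_cube) ->
  (forall i, open_box (a i) (b i) `<=` B i) ->
  \sum_(i < k) box_volume (a i) (b i) <= 2 ^+ d.
Proof.
move=> tB cB oB.
pose lo i : d.-tuple R := [tuple a i j + (b i j - a i j) / 4 | j < d].
pose hi i : d.-tuple R := [tuple b i j - (b i j - a i j) / 4 | j < d].
pose H i := if [forall j, a i j < b i j] then box (lo i) (hi i) else set0.
have mH i : measurable (H i) by rewrite /H; case: ifP => // _; exact: measurable_box.
have HB i : H i `<=` B i.
  rewrite /H; case: ifP => [/forallP ab x|_ x []].
  rewrite /box /= => /andP[/levP lx /levP xh].
  apply: oB => j; move: (lx j) (xh j) (ab j); rewrite !tnth_mktuple; lra.
have EH i : lebesgue_tuple d (H i) = (2 ^- d * box_volume (a i) (b i))%:E.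
  rewrite /H /box_volume; case: ifP => [/forallP ab|_]; last by rewrite measure0 mulr0.
  rewrite lebesgue_tuple_box; last first.
    by apply/levP => j; rewrite !tnth_mktuple; have := ab j; lra.
  rewrite -exprVn -[d in _ ^+ d]card_ord -prodr_const -big_split /=; congr EFin.
  by apply: eq_bigr => j _; rewrite !tnth_mktuple; field.
have : (\sum_(i < k) lebesgue_tuple d (H i) <= 1)%E.
  rewrite -measure_bigsetU_ord//; last first.
    apply/trivIsetP => i j _ _ ij; apply/seteqP; split => // x [Hi Hj].
    by have /trivIsetP/(_ i j I I ij) <- := tB; split; exact: HB.
  have <- : lebesgue_tuple d (@unit_cube R d) = 1%E.
    rewrite lebesgue_tuple_box ?big1//; last exact: lev0 unit_cube1.
    by move=> j _; rewrite !tnth_mktuple subr0.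
  apply: le_measure; rewrite ?inE; [exact: bigsetU_measurable|exact: measurable_box|].
  by move=> x; rewrite -bigcup_seq => -[i _ Hx]; exact: (cB i _ (HB i _ Hx)).
under eq_bigr do rewrite EH.
rewrite sumEFin lee_fin -mulr_sumr mulrC ler_pdivrMr ?exprn_gt0// mul1r.
exact.
Qed.

End pieces.

Section risk.
Context {R : realType} {d : nat}.
Variables (q L kap : R).
Hypotheses (q1 : 1 <= q) (L1 : 1 <= L) (kap0 : 0 < kap).
Local Notation theta := (exponent q L).
Implicit Types (a b : 'I_d.+1 -> R).

(** The pointwise bound at x, for the sub-boxes whose corners are halfway
   between x and the corners of its piece. *)
Definition two_sided_rate a b (x : d.+1.-tuple R) : R :=
  point_rate q (kap * \prod_(j < d.+1) (- a j + 1 * tnth x j)) +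
  point_rate q (kap * \prod_(j < d.+1) (b j + -1 * tnth x j)).

Lemma measurable_two_sided_rate a b : measurable_fun setT (two_sided_rate a b).
Proof.
apply: measurable_funD; (apply: (measurableT_comp (f := point_rate q));
  first exact: measurable_point_rate); apply: measurable_funM => //;
  apply: (measurable_coordinates (F := fun j s => _ + _ * s)) => j;
  exact: measurable_affine.
Qed.

Lemma integral_two_sided_rate a b :
  (\int[lebesgue_tuple d.+1]_(x in open_box a b) (two_sided_rate a b x)%:E
   <= (2 * coord_cst q theta * (1 - theta)^-1 ^+ d * kap `^ (- theta)
         * box_volume a b `^ (1 - theta))%:E)%E.
Proof.
have th1 := exponent_lt1 q L1; have th0 := exponent_ge q1 L1.
rewrite /box_volume; case: ifP => [/forallP ab|]; last first.
  move=> /negbT; rewrite negb_forall => /existsP[j /negP abj].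
  rewrite (_ : open_box a b = set0) ?integral_set0; last first.
    by apply/seteqP; split => // x /(_ j) /andP[h1 h2]; apply: abj; exact: lt_trans h2.
  by rewrite lee_fin powR0 ?mulr0// gt_eqF// subr_gt0.
have compat s := @point_rate_le_exponent _ q L q1 L1 s.
have mp alpha beta : measurable_fun (open_box a b) (fun x : d.+1.-tuple R =>
    (point_rate q (kap * \prod_(j < d.+1) (alpha j + beta j * tnth x j)))%:E).
  apply: measurable_funTS; apply/measurable_EFinP.
  apply: (measurableT_comp (f := point_rate q)); first exact: measurable_point_rate.
  apply: measurable_funM => //.
  apply: (measurable_coordinates (F := fun j s => _ + _ * s)) => j.
  exact: measurable_affine.
under eq_integral do rewrite EFinD.
rewrite ge0_integralD//; last 3 first.
- exact: measurable_open_box.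
- by move=> x _; rewrite lee_fin point_rate_ge0.
- by move=> x _; rewrite lee_fin point_rate_ge0.
apply: le_trans (leeD (@integral_piece _ _ _ th0 th1 compat d a b (fun j => - a j)
  (fun=> 1) kap kap0 ab _ _) (@integral_piece _ _ _ th0 th1 compat d a b b
  (fun=> -1) kap kap0 ab _ _)) _.
- by move=> _; rewrite mulr1.
- by move=> j s; lra.
- by move=> _; rewrite mulrNN mulr1.
- by move=> j s; lra.
by rewrite -EFinD lee_fin le_eqVlt; apply/orP; left; apply/eqP; ring.
Qed.

End risk.

Section piecewise.
Context {R : realType} {d : nat}.
Variables (q : R) (n k : nat).
Hypotheses (q1 : 1 <= q) (k0 : (0 < k)%N) (kn : (k <= n)%N).
Variable B : 'I_k -> set (d.+1.-tuple R).
Hypothesis partB : partition [set: 'I_k] B unit_cube.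
Hypothesis rectB : forall i, hyperrectangle (B i).

Definition pieces_cst : R :=
  2 * log_cst q d * 2 ^+ d.+1 * (1 + 2 ^+ d.+1) * expR 1.

(** Up to the faces of the pieces, which are null, every point of the cube is in the
   interior of its piece, where the corners halfway to those of the piece give the
   pointwise bound. The majorant is infinite on the faces. *)
Lemma integral_pieces_le (h : d.+1.-tuple R -> \bar R) (C : R) : 0 <= C ->
  (forall x, unit_cube x -> (0 <= h x)%E) ->
  (forall i u x v, B i u -> B i x -> B i v ->
     (forall j, tnth u j < tnth x j) -> (forall j, tnth x j < tnth v j) ->
     (h x <= (C * (point_rate q (n%:R * volume u x)
                   + point_rate q (n%:R * volume x v)))%:E)%E) ->
  (\int[lebesgue_tuple d.+1]_(x in unit_cube) h x <=
   (C * pieces_cst * (k%:R / n%:R) `^ Num.min 1 (q / 2)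
      * logp (n%:R / k%:R) ^+ (d.+1 * (q == 2) + d * (2 < q)%R))%:E)%E.
Proof.
move=> C0 h0 hB; have [covB tB _] := partB.
have n0 : (0 < n)%N by exact: leq_trans kn.
have cB i : B i `<=` unit_cube by move=> x Bx; rewrite -covB; exists i.
pose L : R := logp (n%:R / k%:R).
have L1 : 1 <= L by rewrite /L /logp le_max lexx.
pose theta := exponent q L; pose kap : R := n%:R * 2 ^- d.+1.
have kap0 : 0 < kap by rewrite mulr_gt0 ?ltr0n// invr_gt0 exprn_gt0.
have th1 : theta < 1 := exponent_lt1 q L1.
have th2 : 0 <= theta by apply: le_trans (exponent_ge q1 L1).
have /choice[ab Hab] : forall i, exists ab : ('I_d.+1 -> R) * ('I_d.+1 -> R),
    open_box ab.1 ab.2 `<=` B i /\ forall x, B i x -> forall j, ab.1 j <= tnth x j <= ab.2 j.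
  by move=> i; have [a [b H]] := hyperrectangle_corners (rectB i); exists (a, b).
pose a i := (ab i).1; pose b i := (ab i).2.
have oB i : open_box (a i) (b i) `<=` B i by have [] := Hab i.
pose I := ('I_k * option ('I_d.+1 * bool))%type.
pose A (i : I) : set (d.+1.-tuple R) :=
  if i.2 is Some (j, e) then face j (if e then a i.1 j else b i.1 j)
  else open_box (a i.1) (b i.1).
pose G (i : I) (x : d.+1.-tuple R) : \bar R :=
  if i.2 is Some _ then +oo%E else (C * two_sided_rate q kap (a i.1) (b i.1) x)%:E.
pose c i : R := C * (2 * coord_cst q theta * (1 - theta)^-1 ^+ d * kap `^ (- theta)
         * box_volume (a i) (b i) `^ (1 - theta)).
apply: (@le_trans _ _ (\sum_(i : I) \int[lebesgue_tuple d.+1]_(x in A i) G i x)%E).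
  apply: integral_cover_le => //.
  - move=> [i [[j e]|]]; [exact: (face_null _ _).1|exact: measurable_open_box].
  - move=> x cx; have := cx; rewrite -covB => -[i _ Bx].
    have [Ox|/existsNP[j Oj]] := pselect (open_box (a i) (b i) x); first by exists (i, None).
    have /andP[ax xb] := (Hab i).2 x Bx j.
    have [xa|xa] := eqVneq (tnth x j) (a i j); first by exists (i, Some (j, true)).
    exists (i, Some (j, false)) => //; split => //=.
    apply/eqP; rewrite eq_le xb /=; rewrite leNgt; apply/negP => xb'; apply: Oj.
    by rewrite xb' lt_neqAle eq_sym xa ax.
  - move=> [i [?|]]; first exact: measurable_cst.
    by apply/measurable_EFinP; apply: measurable_funM => //; exact: measurable_two_sided_rate.
  - move=> [i [?|]] x; rewrite /G //= lee_fin mulr_ge0// addr_ge0//; exact: point_rate_ge0.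
  - move=> [i [?|]] x cx; first by rewrite /G /= leey.
    rewrite /A /G /= => Ox.
    pose u : d.+1.-tuple R := [tuple (a i j + tnth x j) / 2 | j < d.+1].
    pose v : d.+1.-tuple R := [tuple (tnth x j + b i j) / 2 | j < d.+1].
    have ux j : a i j < tnth u j < tnth x j.
      by rewrite tnth_mktuple; have /andP[] := Ox j; lra.
    have xv j : tnth x j < tnth v j < b i j.
      by rewrite tnth_mktuple; have /andP[] := Ox j; lra.
    have Bu : B i u.
      by apply: oB => j; have /andP[-> h1] := ux j; have /andP[_] := Ox j; exact: lt_trans.
    have Bv : B i v.
      apply: oB => j; have /andP[h1 ->] := xv j; have /andP[h2 _] := Ox j.
      by rewrite (lt_trans h2 h1).
    have := hB i u x v Bu (oB i x Ox) Bv (fun j => (andP (ux j)).2) (fun j => (andP (xv j)).1).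
    have half (g : 'I_d.+1 -> R) : n%:R * \prod_j (2^-1 * g j) = kap * \prod_j g j.
      by rewrite big_split /= prodr_const card_ord exprVn mulrA.
    have -> : n%:R * volume u x = kap * \prod_(j < d.+1) (- a i j + 1 * tnth x j).
      rewrite -half; congr (_ * _); apply: eq_bigr => j _.
      by rewrite tnth_mktuple; field.
    have -> : n%:R * volume x v = kap * \prod_(j < d.+1) (b i j + -1 * tnth x j).
      rewrite -half; congr (_ * _); apply: eq_bigr => j _.
      by rewrite tnth_mktuple; field.
    exact.
apply: (@le_trans _ _ (\sum_(i : I) (if i.2 is Some _ then 0 else c i.1)%:E)%E).
  have face0 j (r : R) : (\int[lebesgue_tuple d.+1]_(x in face j r) +oo = 0)%E.
    have [mF F0] := face_null j r.
    by rewrite integral_cst// [X in (_ * X)%E](_ : _ = 0%E) ?mule0//; exact: F0.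
  apply: lee_sum => -[i [[j e]|]] _; first by rewrite -[leRHS](face0 j (if e then a i j else b i j)); exact: lexx.
  rewrite /A /G [_.1]/= [_.2]/=.
  under eq_integral do rewrite EFinM.
  rewrite ge0_integralZl//; last 3 first.
  - exact: measurable_open_box.
  - apply: measurable_funTS; apply/measurable_EFinP; exact: measurable_two_sided_rate.
  - by move=> x _; rewrite lee_fin addr_ge0//; exact: point_rate_ge0.
  by rewrite /c EFinM lee_wpmul2l ?lee_fin//; exact: (integral_two_sided_rate q1 L1 kap0).
rewrite sumEFin lee_fin.
rewrite -(pair_bigA _ (fun i (o : option ('I_d.+1 * bool)) => if o is Some _ then 0 else c i)) /=.
have -> : \sum_(i < k) \sum_(o : option ('I_d.+1 * bool)) (if o is Some _ then 0 else c i)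
    = \sum_(i < k) c i.
  by apply: eq_bigr => i _; rewrite (bigD1 None)//= big1 ?addr0// => -[].
rewrite /c -mulr_sumr -!(mulrA C); apply: ler_wpM2l => //; rewrite -mulr_sumr -/L.
have -> : 2 * coord_cst q theta * (1 - theta)^-1 ^+ d =
    2 * log_cst q d * L ^+ (d.+1 * (q == 2) + d * (2 < q)%R).
  by rewrite -mulrA coord_cst_log// mulrA.
have K0 : 0 < k%:R :> R by rewrite ltr0n.
have N0 : 0 < n%:R :> R by rewrite ltr0n.
have kapE : kap `^ (- theta) <= n%:R `^ (- theta) * 2 ^+ d.+1.
  rewrite powRM ?(ltW N0) ?invr_ge0 ?exprn_ge0// ler_wpM2l ?powR_ge0//.
  rewrite powRN powRV ?exprn_ge0// invrK -[leRHS]powRr1 ?exprn_ge0//.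
  by apply: ler_powR; [rewrite exprn_ege1// ler1n|exact: ltW].
have S : \sum_(i < k) box_volume (a i) (b i) `^ (1 - theta) <= (1 + 2 ^+ d.+1) * k%:R `^ theta.
  apply: sum_powR_le => //; first by rewrite th2 ltW.
    by move=> i; exact: box_volume_ge0.
  exact: sum_box_volume_le tB cB oB.
have KN : n%:R `^ (- theta) * k%:R `^ theta <= expR 1 * (k%:R / n%:R) `^ Num.min 1 (q / 2).
  have := @powR_exponent_le _ q L L1 k n; rewrite k0 kn => /(_ isT erefl).
  by apply: le_trans; rewrite powRM ?invr_ge0 ?(ltW K0) ?(ltW N0)// powRV ?(ltW N0)// powRN mulrC.
have S0 : 0 <= \sum_(i < k) box_volume (a i) (b i) `^ (1 - theta).
  by apply: sumr_ge0 => i _; exact: powR_ge0.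
have Lc0 : 0 <= log_cst q d.
  rewrite /log_cst; case: ltgtP => q2; rewrite ?exprn_ge0//.
    by rewrite invr_ge0; lra.
  by rewrite mulr_ge0 ?exprn_ge0// addr_ge0// mulr_ge0// addr_ge0// invr_ge0; lra.
set Z := _ ^+ (_ + _).
have Z0 : 0 <= Z by rewrite exprn_ge0//; exact: le_trans L1.
have H := ler_pM (powR_ge0 _ _) S0 kapE S.
apply: (@le_trans _ _ (2 * log_cst q d * Z * (n%:R `^ (- theta) * 2 ^+ d.+1 * ((1 + 2 ^+ d.+1) * k%:R `^ theta)))).
  by rewrite -[leLHS]mulrA; apply: ler_wpM2l => //; rewrite !mulr_ge0.
rewrite /pieces_cst.
have -> : 2 * log_cst q d * Z * (n%:R `^ (- theta) * 2 ^+ d.+1 * ((1 + 2 ^+ d.+1) * k%:R `^ theta))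
  = (2 * log_cst q d * Z * 2 ^+ d.+1 * (1 + 2 ^+ d.+1)) * (n%:R `^ (- theta) * k%:R `^ theta).
  by ring.
have W0 : 0 <= 2 * log_cst q d * Z * 2 ^+ d.+1 * (1 + 2 ^+ d.+1).
  by rewrite !mulr_ge0// ?addr_ge0// ?exprn_ge0.
apply: le_trans (ler_wpM2l W0 KN) _.
by rewrite le_eqVlt; apply/orP; left; apply/eqP; ring.
Qed.

End piecewise.

Theorem theorem8 (R : realType) (d : nat) (q rho1 rho2 : R) :
  (0 < d)%N -> 1 <= q -> 0 < rho1 -> rho1 <= rho2 ->
  exists C : R, 0 < C /\
    forall (disp : measure_display) (Omega : measurableType disp)
      (P : probability Omega R) (n K : nat)
      (X : 'I_n -> {RV P >-> d.-tuple R}) (eps : 'I_n -> {RV P >-> R})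
      (sigma : R) (f : d.-tuple R -> R) (fhat : Omega -> d.-tuple R -> R),
    0 < sigma ->
    (K <= n)%N ->
    (forall i w, unit_cube (X i w)) ->
    iid X ->
    design_point_law_bounds rho1 rho2 X ->
    nondecreasing_on_cube f ->
    noise_given_design q sigma X eps ->
    piecewise_constant K f ->
    (forall x, unit_cube x -> measurable_fun setT (fun w => fhat w x)) ->
    (forall w, block_estimate (fun i => X i w)
                 (fun i => f (X i w) + eps i w) unit_cube (fhat w)) ->
    let Delta := (f onev - f zerov) / sigma in
    (integrated_risk P q fhat f <=
       (C * (sigma `^ q * (Delta `^ q + 1)
             * (K%:R / n%:R) `^ Num.min 1 (q / 2)
             * logp (n%:R / K%:R) ^+ (d * (q == 2) + d.-1 * (2 < q)%R)))%:E)%E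
    /\ (q = 2 ->
        (integrated_risk P 2 fhat f <=
           (C * (sigma ^+ 2 * (Delta ^+ 2 + 1)
                 * (K%:R / n%:R) * logp (n%:R / K%:R) ^+ d))%:E)%E).
Proof.
move=> d0 q1 rho10 rho12; case: d d0 => [//|d] _.
pose Cpt := `|@pointwise_cst R d.+1 q rho1 rho2|.
exists (1 + `|Cpt * pieces_cst (d := d) q|); split; first by rewrite ltr_wpDr.
move=> disp Omega P n K X eps sigma f fhat sigma0 Kn cX iidX lawX mf noiseX pcf _ blockf Delta.
have main : (integrated_risk P q fhat f <=
    ((1 + `|Cpt * pieces_cst (d := d) q|) * (sigma `^ q * (Delta `^ q + 1)
             * (K%:R / n%:R) `^ Num.min 1 (q / 2)
             * logp (n%:R / K%:R) ^+ (d.+1 * (q == 2) + d * (2 < q)%R)))%:E)%E.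
  have [B [partB rectB constB]] := pcf.
  have [covB _ _] := partB.
  have cB i x : B i x -> unit_cube x by move=> Bx; rewrite -covB; exists i.
  have K0 : (0 < K)%N.
    have : unit_cube (@zerov R d.+1) by exact: unit_cube0.
    by rewrite -covB => -[i _ _]; exact: leq_ltn_trans (ltn_ord i).
  have n0 : (0 < n)%N by exact: leq_trans Kn.
  have HX := iid_design_model cX iidX lawX.
  have Heps := noise_given_design_model noiseX.
  have D0 : 0 <= f onev - f zerov.
    by rewrite subr_ge0; apply: mf; [exact: unit_cube0|exact: unit_cube1|exact: lev0 unit_cube1].
  have DE : sigma `^ q + (f onev - f zerov) `^ q = sigma `^ q * (Delta `^ q + 1).
    rewrite mulrDr mulr1 addrC -powRM ?(ltW sigma0) ?divr_ge0 ?(ltW sigma0)//.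
    by rewrite [sigma * _]mulrC divfK// gt_eqF.
  pose A := sigma `^ q * (Delta `^ q + 1).
  have Cpt0 : 0 <= Cpt by exact: normr_ge0.
  have A0 : 0 <= A by rewrite mulr_ge0 ?addr_ge0 ?powR_ge0.
  apply: (@le_trans _ _ (Cpt * A * pieces_cst (d := d) q * (K%:R / n%:R) `^ Num.min 1 (q / 2)
      * logp (n%:R / K%:R) ^+ (d.+1 * (q == 2) + d * (2 < q)%R))%:E)%E.
    apply: (integral_pieces_le q1 K0 Kn partB rectB).
    - by rewrite mulr_ge0.
    - by move=> x _; rewrite expectation.unlock; apply: integral_ge0 => w _; rewrite lee_fin powR_ge0.
    move=> i u x v Bu Bx Bv ux xv; rewrite expectation.unlock.
    apply: le_trans (pointwise_risk q1 sigma0 rho10 n0 HX Heps (f := f)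
      (fhat := fun w => fhat w x) mf (cB _ _ Bu) (cB _ _ Bx) (cB _ _ Bv) ux xv
      (constB _ _ _ Bu Bx) (constB _ _ _ Bv Bx) erefl _) _.
      by move=> w; exists (fhat w) => //; exact: blockf.
    rewrite lee_fin DE -/A -!(mulrA _ A); apply: ler_wpM2r; last exact: ler_norm.
    by apply: mulr_ge0 => //; apply: addr_ge0; exact: point_rate_ge0.
  rewrite lee_fin -!(mulrA _ (_ `^ _) (_ ^+ _)).
  set Z := _ `^ Num.min _ _ * _.
  have Z0 : 0 <= Z.
    rewrite mulr_ge0 ?powR_ge0// exprn_ge0//.
    by apply: (@le_trans _ _ 1); rewrite /logp ?le_max ?lexx.
  have -> : Cpt * A * pieces_cst (d := d) q * Z = Cpt * pieces_cst (d := d) q * (A * Z) by ring.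
  apply: ler_wpM2r; first exact: mulr_ge0.
  by apply: le_trans (ler_norm _) _; rewrite lerDr.
split=> // q2; move: main; rewrite q2 eqxx ltxx muln0 muln1 addn0.
rewrite divff ?pnatr_eq0// minxx powRr1; last by rewrite divr_ge0.
rewrite !powR_mulrn ?(ltW sigma0)//.
rewrite /Delta divr_ge0 ?(ltW sigma0)// subr_ge0.
by apply: mf; [exact: unit_cube0|exact: unit_cube1|exact: lev0 unit_cube1].
Qed.
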